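(* Let $K$ be a field and $m,n,r$ positive integers. Let $R=K[x_{ij}^k \mid 1\le i\le m,\ 1\le j\le n,\ 1\le k\le r]$ with standard grading, and let $I_{mn}^r\subseteq R$ be the ideal generated by all $2$-minors of the horizontal concatenation $H=(X_1\ \cdots\ X_r)$ and all $2$-minors of the vertical concatenation $V$ (the $X_k$ stacked vertically) of the $m\times n$ matrices $X_k=(x_{ij}^k)$. Then: (1) the minimal number of generators of $I_{mn}^r$ is $\mu(I_{mn}^r)=\binom{mnr+1}{2}-\binom{m+1}{2}\binom{n+1}{2}\binom{r+1}{2}$; (2) $\dim R/I_{mn}^r=m+n+r-2$; (3) the multiplicity is $e(R/I_{mn}^r)=\frac{(m+n+r-3)!}{(m-1)!(n-1)!(r-1)!}$; (4) the Castelnuovo–Mumford regularity is $\operatorname{reg}(R/I_{mn}^r)=m+n+r-2-\max\{m,n,r\}$; (5) the $a$-invariant is $a(R/I_{mn}^r)=-\max\{m,n,r\}$; (6) the Hilbert function is $\operatorname{HF}(R/I_{mn}^r,d)=\binom{m-1+d}{d}\binom{n-1+d}{d}\binom{r-1+d}{d}$ for all $d\ge 0$. *)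

(* Defs.v *)
From mathcomp Require Import all_boot all_order all_algebra.
From mathcomp Require Import mpoly.

Set Implicit Arguments.
Unset Strict Implicit.
Unset Printing Implicit Defensive.

Import Order.TTheory GRing.Theory Num.Theory.
Local Open Scope ring_scope.

Section CommAlg.
Variables (K : fieldType) (N : nat).
Local Notation R := {mpoly K[N]}.

Definition in_ideal (G : R -> Prop) (p : R) : Prop :=
  exists s : seq (R * R),
    (forall x, x \in s -> G x.2) /\ p = \sum_(x <- s) x.1 * x.2.

Definition min_num_gens (I : R -> Prop) (k : nat) : Prop :=
  (exists g : k.-tuple R, forall p, I p <-> in_ideal (fun q => q \in g) p) /\
  (forall k' (g : k'.-tuple R),
      (forall p, I p <-> in_ideal (fun q => q \in g) p) -> (k <= k')%N).

Definition is_ideal (J : R -> Prop) : Prop :=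
  J 0 /\ (forall a b, J a -> J b -> J (a + b)) /\ (forall a b, J b -> J (a * b)).

Definition is_prime (J : R -> Prop) : Prop :=
  is_ideal J /\ ~ J 1 /\ (forall a b, J (a * b) -> J a \/ J b).

Definition prime_chain (I : R -> Prop) (P : nat -> R -> Prop) (k : nat) : Prop :=
  (forall i, (i <= k)%N -> is_prime (P i) /\ (forall p, I p -> P i p)) /\
  (forall i, (i < k)%N ->
     (forall p, P i p -> P i.+1 p) /\ (exists p, P i.+1 p /\ ~ P i p)).

Definition krull_dim_quot (I : R -> Prop) (D : nat) : Prop :=
  (exists P, prime_chain I P D) /\ ~ (exists P, prime_chain I P D.+1).

(** p is homogeneous of degree d (standard grading); 0 is homogeneous of
    every degree. *)
Definition is_homog (d : nat) (p : R) : Prop :=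
  forall mm : 'X_{1..N}, mm \in msupp p -> mdeg mm = d.

Definition quot_dim (V : lmodType K) (Z B : V -> Prop) (h : nat) : Prop :=
  exists s : h.-tuple V,
    (forall i, Z (tnth s i)) /\
    (forall c : 'I_h -> K, B (\sum_i c i *: tnth s i) -> forall i, c i = 0) /\
    (forall z, Z z -> exists c : 'I_h -> K, B (z - \sum_i c i *: tnth s i)).

Definition hilb_fun (I : R -> Prop) (d h : nat) : Prop :=
  quot_dim (is_homog d) (fun p => is_homog d p /\ I p) h.

Definition multiplicity (I : R -> Prop) (e : rat) : Prop :=
  exists P : {poly rat},
    (exists d0, forall d, (d0 <= d)%N ->
        exists h, hilb_fun I d h /\ P.[d%:R] = h%:R) /\
    e = lead_coef P * ((size P).-1)`!%:R.

(** a-invariant: the degree of the Hilbert series HS(t) = sum_d HF(d) t^d as a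
    rational function, i.e. HS(t) = Q(t)/(1-t)^D with Q a nonzero integer
    polynomial, and a = deg Q - D. *)
Definition a_invariant (I : R -> Prop) (a : int) : Prop :=
  exists (D : nat) (Q : {poly int}),
    Q != 0 /\
    (forall k, exists hf : 'I_k.+1 -> nat,
        (forall i : 'I_k.+1, hilb_fun I i (hf i)) /\
        Q`_k = \sum_(i < k.+1) ((1 - 'X) ^+ D)`_(k - i) * (hf i)%:R) /\
    a = ((size Q).-1)%:Z - D%:Z.

(** A (finite) minimal graded free resolution of R/I:
      ... -> F_2 --M 1--> F_1 --M 0--> F_0 = R -> R/I -> 0,
    F_i = (+)_{l < b i} R(-a i l); M i : F_(i+1) -> F_i acts on column
    vectors; entries of M i are homogeneous of the degree prescribed by the
    shifts; minimality: no nonzero entry is a unit (strictly positive degree). *)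
Definition min_graded_free_res (I : R -> Prop) (b : nat -> nat)
    (a : forall i, 'I_(b i) -> nat) (M : forall i, 'M[R]_(b i, b i.+1)) : Prop :=
  b 0 = 1%N /\ (forall k, a 0 k = 0%N) /\
  (exists p, forall i, (p < i)%N -> b i = 0%N) /\
  (forall i k l, is_homog (a i.+1 l - a i k) (M i k l) /\
                 (M i k l = 0 \/ (a i k < a i.+1 l)%N)) /\
  (forall u : 'cV_(b 0), (forall k, I (u k 0)) <->
                         exists v : 'cV_(b 1), u = M 0 *m v) /\
  (forall i (v : 'cV_(b i.+1)),
      M i *m v = 0 <-> exists w : 'cV_(b i.+2), v = M i.+1 *m w).

Definition regularity (I : R -> Prop) (rho : int) : Prop :=
  exists b a M, @min_graded_free_res I b a M /\
    (forall i (l : 'I_(b i)), (a i l)%:Z - i%:Z <= rho) /\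
    (exists i (l : 'I_(b i)), (a i l)%:Z - i%:Z = rho).

End CommAlg.

Definition nvars (m n r : nat) : nat := #|{: 'I_m * 'I_n * 'I_r}|.

Definition xv (K : fieldType) (m n r : nat) (i : 'I_m) (j : 'I_n) (k : 'I_r)
  : {mpoly K[nvars m n r]} := 'X_(enum_rank (i, j, k)).

Definition minor2 (T : comRingType) (RI CI : Type) (A : RI -> CI -> T)
  (a1 a2 : RI) (b1 b2 : CI) : T :=
  A a1 b1 * A a2 b2 - A a1 b2 * A a2 b1.

(** H = (X_1 ... X_r): m x (n r), entry at (i, (j,k)) is x_ij^k. *)
Definition Hmat (K : fieldType) (m n r : nat) (i : 'I_m) (jk : 'I_n * 'I_r)
  := xv K i jk.1 jk.2.
(** V = X_1 over ... over X_r: (m r) x n, entry at ((i,k), j) is x_ij^k. *)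
Definition Vmat (K : fieldType) (m n r : nat) (ik : 'I_m * 'I_r) (j : 'I_n)
  := xv K ik.1 j ik.2.

Definition gensI (K : fieldType) (m n r : nat) (p : {mpoly K[nvars m n r]}) : Prop :=
  (exists i1 i2 c1 c2, p = minor2 (@Hmat K m n r) i1 i2 c1 c2) \/
  (exists r1 r2 j1 j2, p = minor2 (@Vmat K m n r) r1 r2 j1 j2).

Definition Imnr (K : fieldType) (m n r : nat) : {mpoly K[nvars m n r]} -> Prop :=
  in_ideal (@gensI K m n r).
Arguments Imnr K m n r : clear implicits.

(* Main.v *)
Require Import Defs.
From mathcomp Require Import all_boot all_order all_algebra.
From mathcomp Require Import mpoly.
From mathcomp Require Import all_fingroup zify ring.
From Stdlib Require Import Classical_Prop.
Import Order.TTheory GRing.Theory Num.Theory.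
Set Implicit Arguments.
Unset Strict Implicit.
Unset Printing Implicit Defensive.
Local Open Scope ring_scope.

(** Sending x_ijk to h y_(0,i) y_(1,j) y_(2,k), with y_(.,0) = 1, identifies
    R/I with the Segre ring A spanned by the monomials h^d y^a having degree at
    most d in each of the three groups of variables: modulo the minors the
    first, second and third indices of a product of variables can be permuted
    independently, hence sorted.  This gives the Hilbert function, the number
    of generators and the multiplicity.  A chain of primes over I yields
    elements algebraically independent modulo its bottom, whose number is
    bounded by the number m + n + r - 2 of variables h, y_(i,a).

    The sums theta_k of the x_ijl with i + j + l = k are parameters over any
    field, and A is free over K[theta].  The top parameter acts as a monomial;
    the quotient by it is filtered by divisibility by the last variable of each
    group, and the pieces are modules of the same kind with one variable less
    (multisets of words being enumerated by their last letter, the degrees of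
    the basis are numbers of descents).  A basis over K[theta] is a resolution
    of length 0; adjoining one of the remaining variables, acting through a
    matrix Y, replaces a resolution by the mapping cone of y - Y, so the i-th
    module keeps its degrees below rho + i and the last one attains the bound.
    Cancelling unit entries makes it minimal without affecting the last top
    degree, which gives the regularity; the degrees of the basis give the
    numerator of the Hilbert series. *)

(** * Multivariate polynomials *)

(** Two obstacles shape the argument. The sums [theta] replace them because of two exact properties:
    the one of highest index is [h] times the last variables of all nonempty groups, and setting the
    last variable of one group to zero turns the [theta] of [P] into those of [P] with that entry
    lowered. Divisibility by last variables tightens the degree bound in some groups only, so the
    induction must carry the defects [Z]; groups without defect are treated first, since otherwise
    defects outside {0, 1} would appear. The formula [tdeg] is what this recursion forces.

    Moreover, the regularity asks for an explicit minimal resolution of R/I, whereas the resolution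
    built here starts with one generator per basis element. Cancellation therefore also has to
    collapse the first module to rank one. It removes generators of equal degree from consecutive
    modules; the last module but one has no generator in the top degree of the last, so the
    generator attaining the bound survives. *)

Definition supp (K : fieldType) (n : nat) (Q : 'X_{1..n} -> Prop)
  (f : {mpoly K[n]}) : Prop := forall m, m \in msupp f -> Q m.

Notation psub h := (mmap (@mpolyC _ _) h).

Section Support.
Variables (K : fieldType) (n : nat).
Implicit Types (f g : {mpoly K[n]}) (m mu : 'X_{1..n}) (Q : 'X_{1..n} -> Prop).

Lemma supp_sub Q Q' f : (forall m, Q m -> Q' m) -> supp Q f -> supp Q' f.
Proof. by move=> QQ' Qf m /Qf/QQ'. Qed.

Lemma supp0 Q : supp Q (0 : {mpoly K[n]}).
Proof. by move=> m; rewrite mcoeff_msupp mcoeff0 eqxx. Qed.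

Lemma suppD Q f g : supp Q f -> supp Q g -> supp Q (f + g).
Proof.
move=> Qf Qg m /msuppD_le; rewrite mem_cat => /orP[/Qf|/Qg] //.
Qed.

Lemma suppN Q f : supp Q f -> supp Q (- f).
Proof. by move=> Qf m; rewrite (perm_mem (msuppN f)) => /Qf. Qed.

Lemma suppB Q f g : supp Q f -> supp Q g -> supp Q (f - g).
Proof. by move=> Qf Qg; apply: suppD Qf _; apply: suppN. Qed.

Lemma suppZ Q c f : supp Q f -> supp Q (c *: f).
Proof. by move=> Qf m /msuppZ_le/Qf. Qed.

Lemma suppX Q m : Q m -> supp Q ('X_[m] : {mpoly K[n]}).
Proof. by move=> Qm m' /mem_msuppXP <-. Qed.

Lemma supp_sum Q (I : Type) (r : seq I) (P : pred I) (F : I -> {mpoly K[n]}) :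
  (forall i, P i -> supp Q (F i)) -> supp Q (\sum_(i <- r | P i) F i).
Proof. by move=> QF; apply: big_ind => //; [exact: supp0|exact: suppD]. Qed.

Lemma suppM Q1 Q2 Q f g : (forall m1 m2, Q1 m1 -> Q2 m2 -> Q (m1 + m2)%MM) ->
  supp Q1 f -> supp Q2 g -> supp Q (f * g).
Proof.
by move=> QQ Qf Qg m /msuppM_le/allpairsP[[m1 m2] /= [/Qf Q1m /Qg Q2m ->]]; apply: QQ.
Qed.

Lemma supp_ind Q (P : {mpoly K[n]} -> Prop) f : supp Q f ->
  P 0 -> (forall p q, P p -> P q -> P (p + q)) ->
  (forall c m, Q m -> P (c *: 'X_[m])) -> P f.
Proof.
move=> Qf P0 PD PX; rewrite [f]mpolyE big_seq_cond.
by apply: big_ind => // m /andP[/Qf Qm _]; apply: PX.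
Qed.

Lemma mpoly_lin_ind (P : {mpoly K[n]} -> Prop) f :
  P 0 -> (forall p q, P p -> P q -> P (p + q)) ->
  (forall c m, P (c *: 'X_[m])) -> P f.
Proof. by move=> P0 PD PX; apply: (@supp_ind (fun=> True)). Qed.

Lemma supp_False f : supp (fun=> False) f -> f = 0.
Proof.
move=> Qf; apply/mpolyP => m; rewrite mcoeff0.
by apply/memN_msupp_eq0/negP => /Qf.
Qed.

(** The projection onto the span of a set of monomials. It serves as homogeneous component, as the
    part free of a variable and as the part of a given degree in one variable. *)
Definition mrest (p : pred 'X_{1..n}) f : {mpoly K[n]} :=
  \sum_(m <- msupp f | p m) f@_m *: 'X_[m].

Lemma mcoeff_mrest p f m : (mrest p f)@_m = if p m then f@_m else 0.
Proof.
rewrite /mrest raddf_sum /= -big_filter.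
under eq_bigr do rewrite mcoeffZ mcoeffX.
have [ms|ms] := boolP (m \in [seq i <- msupp f | p i]).
  rewrite (bigD1_seq m) ?filter_uniq ?msupp_uniq //= eqxx mulr1 big1 ?addr0.
    by move: ms; rewrite mem_filter => /andP[-> _].
  by move=> i /negbTE ->; rewrite mulr0.
rewrite big_seq big1 => [|i]; last first.
  by case: (eqVneq i m) => [->|]; rewrite ?(negbTE ms) // mulr0.
move: ms; rewrite mem_filter; case: (p m) => //= /memN_msupp_eq0 -> //.
Qed.

Lemma mrest_supp (p : pred 'X_{1..n}) f : supp (fun m => p m /\ m \in msupp f) (mrest p f).
Proof.
move=> m; rewrite !mcoeff_msupp mcoeff_mrest.
by case: (p m); rewrite ?eqxx.
Qed.

Lemma mrest_split p f : f = mrest p f + mrest (predC p) f.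
Proof.
apply/mpolyP => m; rewrite mcoeffD !mcoeff_mrest /=.
by case: (p m); rewrite ?addr0 ?add0r.
Qed.

Lemma mrestD p f g : mrest p (f + g) = mrest p f + mrest p g.
Proof.
apply/mpolyP => m; rewrite mcoeffD !mcoeff_mrest mcoeffD.
by case: (p m); rewrite ?addr0.
Qed.

Lemma mrestZ p c f : mrest p (c *: f) = c *: mrest p f.
Proof.
apply/mpolyP => m; rewrite mcoeffZ !mcoeff_mrest mcoeffZ.
by case: (p m); rewrite ?mulr0.
Qed.

Lemma mrest_sum p (I : Type) (r : seq I) (P : pred I) (F : I -> {mpoly K[n]}) :
  mrest p (\sum_(i <- r | P i) F i) = \sum_(i <- r | P i) mrest p (F i).
Proof.
apply: (big_morph (mrest p) (mrestD p)).
by apply/mpolyP => m; rewrite mcoeff_mrest mcoeff0; case: (p m).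
Qed.

Lemma mrest_id (p : pred 'X_{1..n}) f : supp p f -> mrest p f = f.
Proof.
move=> pf; apply/mpolyP => m; rewrite mcoeff_mrest.
by case: ifP => // /negP np; apply/esym/memN_msupp_eq0/negP => /pf.
Qed.

Lemma mrest0 (p : pred 'X_{1..n}) f : supp (fun m => ~~ p m) f -> mrest p f = 0.
Proof.
move=> pf; apply/mpolyP => m; rewrite mcoeff_mrest mcoeff0.
by case: ifP => // np; apply/memN_msupp_eq0/negP => /pf; rewrite np.
Qed.

Lemma dvd_mpolyX mu f : supp (fun m => mu <= m)%MM f ->
  exists2 g, f = 'X_[mu] * g & supp (fun m => (mu + m)%MM \in msupp f) g.
Proof.
move=> muf; exists (\sum_(m <- msupp f) f@_m *: 'X_[m - mu]).
  rewrite mulr_sumr [LHS]mpolyE !big_seq; apply: eq_bigr => m mf.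
  by rewrite -scalerAr -mpolyXD addmC submK // muf.
rewrite big_seq; apply: supp_sum => m mf; apply: suppZ; apply: suppX.
by rewrite addmC submK // muf.
Qed.

Lemma msupp_mulX mu f m : (m \in msupp f) = ((mu + m)%MM \in msupp ('X_[mu] * f)).
Proof. by rewrite !mcoeff_msupp mulrC mcoeffMX. Qed.

Lemma supp_mulX Q mu f : supp Q ('X_[mu] * f) <-> supp (fun m => Q (mu + m)%MM) f.
Proof.
split=> [Qf m|Qf m]; first by rewrite (msupp_mulX mu) => /Qf.
move=> mf; have /allpairsP[[m1 m2] /= [/mem_msuppXP <- m2f eqm]] := msuppM_le mf.
by rewrite eqm; apply: Qf.
Qed.

Lemma mpolyX_neq0 mu : 'X_[mu] != 0 :> {mpoly K[n]}.
Proof. by rewrite -msupp_eq0 msuppX. Qed.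

Lemma mulX_inj mu f g : 'X_[mu] * f = 'X_[mu] * g -> f = g.
Proof. exact: (mulfI (mpolyX_neq0 mu)). Qed.

End Support.

Section Subst.
Variables (K : fieldType).

Lemma psubX n k (h : 'I_n -> {mpoly K[k]}) (i : 'I_n) : psub h 'X_i = h i.
Proof. by rewrite mmapX mmap1U. Qed.

Lemma psubZ n k (h : 'I_n -> {mpoly K[k]}) c p : psub h (c *: p) = c *: psub h p.
Proof. by rewrite mmapZ mul_mpolyC. Qed.

Lemma eq_psub n k (h1 h2 : 'I_n -> {mpoly K[k]}) p : h1 =1 h2 ->
  psub h1 p = psub h2 p.
Proof.
by move=> h12; apply: eq_bigr => m _; rewrite (mmap1_eq _ h12).
Qed.

Lemma psub_uniq n (S : comNzRingType) (phi psi : {rmorphism {mpoly K[n]} -> S}) :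
  (forall c : K, phi c%:MP = psi c%:MP) ->
  (forall i, phi 'X_i = psi 'X_i) -> phi =1 psi.
Proof.
move=> phiC phiX p; rewrite [p]mpolyE !rmorph_sum; apply: eq_bigr => m _.
rewrite -mul_mpolyC !rmorphM /= phiC; congr (_ * _).
by rewrite mpolyXE_id !rmorph_prod; apply: eq_bigr => i _; rewrite !rmorphXn /= phiX.
Qed.

Lemma psub_id n (p : {mpoly K[n]}) : psub (fun i => 'X_i) p = p.
Proof.
apply: (@psub_uniq _ _ (psub (fun i => 'X_i)) idfun) => [c|i] /=.
  by rewrite mmapC.
exact: psubX.
Qed.

Lemma psub_comp n k l (g : 'I_k -> {mpoly K[l]}) (h : 'I_n -> {mpoly K[k]}) p :
  psub g (psub h p) = psub (psub g \o h) p.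
Proof.
apply: (@psub_uniq _ _ (psub g \o psub h) (psub (psub g \o h))) => [c|i] /=.
  by rewrite !mmapC.
by rewrite !psubX.
Qed.

Lemma psub_mwiden n k (g : 'I_n.+1 -> {mpoly K[k]}) (p : {mpoly K[n]}) :
  psub g (mwiden p) = psub (fun i : 'I_n => g (widen_ord (leqnSn n) i)) p.
Proof.
apply: (@psub_uniq _ _ (psub g \o (@mwiden _ _)) (psub _)) => [c|i] /=.
  by rewrite mwidenC !mmapC.
by rewrite mwidenX mnmwiden1 !psubX.
Qed.

(** The degree [d] is any additive function, so that the lemma applies to the total degree as well
    as to the exponent of [h]. *)
Lemma psub_supp n k (h : 'I_n -> {mpoly K[k]}) (d : 'X_{1..k} -> nat)
  (dD : forall a b, d (a + b)%MM = (d a + d b)%N) (d0 : d 0%MM = 0%N) e p :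
  (forall i, supp (fun m => d m = 1%N) (h i)) ->
  supp (fun m => mdeg m = e) p -> supp (fun m => d m = e) (psub h p).
Proof.
move=> hd pd; rewrite /mmap big_seq; apply: supp_sum => m /pd <-.
rewrite mul_mpolyC; apply: suppZ; rewrite mdegE /mmap1.
elim/big_rec2: _ => [|i f e' _ IH]; first by rewrite -mpolyX0; apply: suppX.
apply: (suppM (Q1 := fun x => d x = m i)) IH => [m1 m2 |].
  by rewrite dD => -> ->.
elim: (m i) => [|j IH]; first by rewrite expr0 -mpolyX0; apply: suppX.
by rewrite exprS; apply: (suppM _ (hd i) IH) => m1 m2; rewrite dD => -> ->.
Qed.

(** Division by the last variable. The two support clauses preserve homogeneity and give the descent
    in [msize] on which later inductions rest. *)
Lemma mwiden_last_split n (c : {mpoly K[n.+1]}) :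
  exists a b, [/\ c = mwiden a + 'X_ord_max * b,
    supp (fun m => mnmwiden m \in msupp c) a &
    supp (fun m => (U_(ord_max) + m)%MM \in msupp c) b].
Proof.
pose p := [pred m : 'X_{1..n.+1} | m ord_max == 0%N].
pose nar (m : 'X_{1..n.+1}) := [multinom m (widen_ord (leqnSn n) i) | i < n].
have narK m : p m -> mnmwiden (nar m) = m.
  move=> /eqP pm; apply/mnmP => i; case: (unliftP ord_max i) => [j|] ->.
    have -> : lift ord_max j = widen_ord (leqnSn n) j.
      by apply: val_inj; rewrite /= /bump leqNgt ltn_ord.
    by rewrite mnmwiden_widen mnmE.
  by rewrite mnmwiden_ordmax pm.
have [b cE sb] : exists2 b, mrest (predC p) c = 'X_ord_max * b &
    supp (fun m => (U_(ord_max) + m)%MM \in msupp (mrest (predC p) c)) b.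
  by apply: dvd_mpolyX => m /mrest_supp[/= pm _]; rewrite lep1mP.
exists (\sum_(m <- msupp c | p m) c@_m *: 'X_[nar m]), b; split.
- rewrite {1}[c](mrest_split p) cE; congr (_ + _); rewrite rmorph_sum /=.
  by apply: eq_bigr => m pm; rewrite mwidenZ mwidenX narK.
- rewrite big_seq_cond; apply: supp_sum => m /andP[mc pm].
  by apply: suppZ; apply: suppX; rewrite narK.
- by apply: supp_sub sb => m /mrest_supp[].
Qed.

Lemma supp_mwiden n (Q : 'X_{1..n.+1} -> Prop) (p : {mpoly K[n]}) :
  supp (fun m => Q (mnmwiden m)) p -> supp Q (mwiden p).
Proof.
move=> Qp; apply: (supp_ind (P := fun p => supp Q (mwiden p)) Qp).
- by rewrite raddf0; apply: supp0.
- by move=> p1 p2; rewrite raddfD; apply: suppD.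
- by move=> c m Qm; rewrite mwidenZ mwidenX; apply: suppZ; apply: suppX.
Qed.

Lemma mdeg_mnmwiden n (m : 'X_{1..n}) : mdeg (mnmwiden m) = mdeg m.
Proof.
rewrite !mdegE big_ord_recr /= mnmwiden_ordmax addn0.
by apply: eq_bigr => i _; rewrite mnmwiden_widen.
Qed.

Lemma msize_mulX_last n (c b : {mpoly K[n.+1]}) :
  supp (fun m => (U_(ord_max) + m)%MM \in msupp c) b ->
  (msize b <= (msize c).-1)%N.
Proof.
move=> bc; rewrite msizeE; apply/bigmax_leqP_seq => m mb _.
by have /msize_mdeg_lt := bc _ mb; rewrite mdegD mdeg1; case: (msize c).
Qed.

End Subst.

(** * The Segre monomials *)

Section SegreMonomials.
Variables (K : fieldType) (F : finType) (Pm : F -> nat).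

(** [None] stands for [h] and [Some (i, a)] for y_(i,a+1): the element y_(i,0) = 1 is not a
    variable. *)
Definition svar := option {i : F & 'I_(Pm i)}.
Local Notation nS := #|{: svar}|.
Local Notation S := {mpoly K[nS]}.

Definition vh : 'I_nS := enum_rank (None : svar).
(** Meaningful for [0 < a <= Pm i] only: index 0 is read as 1, and an index out of range falls back
    to [vh]. The value y_(i,0) = 1 is therefore always treated separately. *)
Definition vy (i : F) (a : nat) : 'I_nS :=
  if (insub a.-1 : option (ordinal (Pm i))) is Some o
  then enum_rank (Some (Tagged (fun i => 'I_(Pm i)) o) : svar) else vh.

Lemma card_svar : nS = (\sum_i Pm i).+1.
Proof.
rewrite card_option card_tagged; congr _.+1.
by rewrite sumnE big_map big_enum; apply: eq_bigr => i _; rewrite card_ord.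
Qed.

Lemma vyE i a (aP : (a.-1 < Pm i)%N) :
  vy i a = enum_rank (Some (Tagged (fun i => 'I_(Pm i)) (Ordinal aP)) : svar).
Proof. by rewrite /vy insubT. Qed.

Lemma vy_neq_h i a : (0 < a <= Pm i)%N -> (vy i a == vh) = false.
Proof.
case/andP=> a0 aP; have aP' : (a.-1 < Pm i)%N by rewrite prednK.
by rewrite (vyE aP') (inj_eq enum_rank_inj).
Qed.

Lemma vy_eq i a j b : (0 < a <= Pm i)%N -> (0 < b <= Pm j)%N ->
  (vy i a == vy j b) = (i == j) && (a == b).
Proof.
case/andP=> a0 aP /andP[b0 bP].
have aP' : (a.-1 < Pm i)%N by rewrite prednK.
have bP' : (b.-1 < Pm j)%N by rewrite prednK.
rewrite (vyE aP') (vyE bP') (inj_eq enum_rank_inj).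
apply/eqP/andP => [/(congr1 (fun x : svar => if x is Some t
    then Some (tag t, val (tagged t)) else None)) [-> ab]|[/eqP ij /eqP ab]].
  by split=> //; lia.
by subst j; congr (Some (Tagged _ _)); apply: val_inj; rewrite /= ab.
Qed.

Lemma vP (v : 'I_nS) : v = vh \/ exists i a, (0 < a <= Pm i)%N /\ v = vy i a.
Proof.
rewrite -[v]enum_valK; case: (enum_val v) => [[i a]|]; last by left.
right; exists i, a.+1; split; first exact: ltn_ord.
by rewrite (vyE (ltn_ord a : (a.+1.-1 < Pm i)%N)); congr (enum_rank (Some (Tagged _ _))); apply: val_inj.
Qed.

Lemma mnm_vP (m m' : 'X_{1..nS}) : m vh = m' vh ->
  (forall i a, (0 < a <= Pm i)%N -> m (vy i a) = m' (vy i a)) -> m = m'.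
Proof. by move=> mh my; apply/mnmP => v; case: (vP v) => [->|[i [a [/my ? ->]]]]. Qed.

Definition wt (i : F) (m : 'X_{1..nS}) := (\sum_(1 <= a < (Pm i).+1) m (vy i a))%N.

Lemma wtD i m1 m2 : wt i (m1 + m2)%MM = (wt i m1 + wt i m2)%N.
Proof. by rewrite -big_split; apply: eq_bigr => a _; rewrite mnmDE. Qed.

Lemma wt0 i : wt i 0%MM = 0%N.
Proof. by rewrite /wt big1 // => a _; rewrite mnm0E. Qed.

Lemma wtUh i : wt i U_(vh)%MM = 0%N.
Proof.
rewrite /wt big_nat big1 // => a aP; rewrite mnm1E eq_sym vy_neq_h //.
Qed.

Lemma wtUy i j b : (0 < b <= Pm j)%N -> wt i U_(vy j b)%MM = (i == j).
Proof.
move=> bP; rewrite /wt; case: (eqVneq i j) => [->|ij].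
  rewrite (bigD1_seq b) ?iota_uniq ?mem_index_iota //= mnm1E eqxx big_nat_cond.
  rewrite big1 // => a /andP[aP ab]; rewrite mnm1E vy_eq //.
  by rewrite eqxx eq_sym (negbTE ab).
rewrite big_nat big1 // => a aP; rewrite mnm1E vy_eq //.
by rewrite eq_sym (negbTE ij).
Qed.

Lemma wt_ge i a (m : 'X_{1..nS}) : (0 < a <= Pm i)%N -> (m (vy i a) <= wt i m)%N.
Proof.
move=> aP; rewrite /wt (bigD1_seq a) ?iota_uniq ?mem_index_iota //=.
exact: leq_addr.
Qed.

Definition yv (i : F) (a : nat) : S := if a is 0 then 1 else 'X_(vy i a).

(* For P = Pm and three groups this is the image of the sum of the x_ijl with
   i + j + l = k. *)
Definition theta (P : F -> nat) (k : nat) : S :=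
  'X_vh * (\prod_i \poly_(a < (P i).+1) yv i a)`_k.

Definition inside (P : F -> nat) (m : 'X_{1..nS}) :=
  forall i a, (P i < a <= Pm i)%N -> m (vy i a) = 0%N.

(** The common shape of the monomials of [theta] and of the images of the x_ijk: multiplication by
    them raises the exponent of [h] by one and each group weight by at most one. *)
Definition slin (P : F -> nat) (m : 'X_{1..nS}) :=
  [/\ m vh = 1%N, inside P m & forall i, (wt i m <= 1)%N].

Lemma yv_supp P i a : (a <= P i)%N -> (P i <= Pm i)%N ->
  supp (fun m => [/\ m vh = 0%N, inside P m & forall j, (wt j m <= (i == j))%N])
       (yv i a).
Proof.
move=> aP PP; case: a aP => [|a] aP.
  rewrite /yv -mpolyX0; apply: suppX; split=> [|? ? _|j]; rewrite ?mnm0E //.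
  by rewrite wt0.
have aP' : (0 < a.+1 <= Pm i)%N by rewrite (leq_trans aP).
apply: suppX; split=> [|j b jb|j].
- by rewrite mnm1E vy_neq_h.
- have bP : (0 < b <= Pm j)%N by lia.
  rewrite mnm1E vy_eq //; case: eqP => // ij; subst j.
  by case: eqP => // ab; lia.
- by rewrite wtUy // eq_sym.
Qed.

Lemma theta_supp P k : (forall i, P i <= Pm i)%N -> supp (slin P) (theta P k).
Proof.
move=> PP.
(* The induction over the factors needs the sharper bound that a group not yet multiplied in has
   weight 0. *)
suff H : forall r : seq F, uniq r -> forall k, supp (fun m =>
    [/\ m vh = 0%N, inside P m & forall j, (wt j m <= (j \in r))%N])
    ((\prod_(i <- r) \poly_(a < (P i).+1) yv i a)`_k).
  rewrite /theta; apply: (@suppM _ _ (fun m => m = U_(vh)%MM) _ _ _ _ _ _ (H _ (index_enum_uniq F) k));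
    last exact: suppX.
  move=> m1 m2 -> [h2 in2 w2]; split=> [|i a ia|i].
  - by rewrite mnmDE mnm1E eqxx h2.
  - by rewrite mnmDE in2 // mnm1E eq_sym vy_neq_h //; lia.
  - by rewrite wtD wtUh; apply: leq_trans (w2 i) _; rewrite mem_index_enum.
elim=> [_|i r IH /= /andP[ir ru]] {}k.
  rewrite big_nil coef1; case: eqP => _; last exact: supp0.
  rewrite -mpolyX0; apply: suppX; split=> [|? ? _|j]; rewrite ?mnm0E //.
  by rewrite wt0.
rewrite big_cons coefM; apply: supp_sum => a _; rewrite coef_poly.
case: ltnP => aP; last by rewrite mul0r; apply: supp0.
have aP' : (a <= P i)%N by [].
apply: (suppM _ (yv_supp aP' (PP i)) (IH ru (k - a)%N)) => m1 m2.
move=> [h1 i1 w1] [h2 i2 w2]; split=> [|j b jb|j].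
- by rewrite mnmDE h1 h2.
- by rewrite mnmDE i1 ?i2.
- rewrite wtD in_cons; have := w1 j; have := w2 j.
  rewrite [j == i]eq_sym; case: eqP => [<-|_] /=; last lia.
  by rewrite (negbTE ir); lia.
Qed.

Definition zv (v u : 'I_nS) : S := if u == v then 0 else 'X_u.
Arguments zv : simpl never.

Lemma zvE v f : psub (zv v) f = mrest (fun m => m v == 0%N) f.
Proof.
elim/mpoly_lin_ind: f => [|p q IHp IHq|c m].
- by rewrite raddf0 mrest0 //; apply: supp0.
- by rewrite raddfD /= IHp IHq mrestD.
rewrite psubZ mrestZ; congr (_ *: _); rewrite mmapX /mmap1.
case: (altP (m v =P 0%N)) => mv.
  rewrite mrest_id; last by apply: suppX; rewrite mv.
  rewrite [RHS]mpolyXE_id; apply: eq_bigr => u _; rewrite /zv.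
  by case: eqP => [->|]; rewrite ?mv ?expr0.
rewrite mrest0; last by apply: suppX.
by rewrite (bigD1 v) //= /zv eqxx expr0n (negbTE mv) mul0r.
Qed.

Definition decr (j : F) (P : F -> nat) (i : F) := (P i - (i == j))%N.

(** Killing y_(j,P j) only drops the top term of the j-th factor of the product. This makes the
    quotient by that variable a module of the same kind. *)
Lemma zv_theta P j k : (forall i, P i <= Pm i)%N -> (0 < P j)%N ->
  psub (zv (vy j (P j))) (theta P k) = theta (decr j P) k.
Proof.
move=> PP Pj; have zX u : psub (zv (vy j (P j))) 'X_u = zv (vy j (P j)) u.
  exact: psubX.
have jP : (0 < P j <= Pm j)%N by rewrite Pj PP.
rewrite /theta rmorphM /=.
have -> : psub (zv (vy j (P j))) 'X_vh = 'X_vh by rewrite zX /zv eq_sym vy_neq_h.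
congr (_ * _); rewrite -coef_map; congr (nth _ (polyseq _) k).
elim/big_rec2: _ => [|i p q _ <-]; first by rewrite rmorph1.
rewrite rmorphM /=; congr (_ * _).
apply/polyP => a; rewrite coef_map /= !coef_poly /decr.
case: (eqVneq i j) => [->|ij]; last first.
  rewrite subn0; case: ltnP => aP; last by rewrite raddf0.
  case: a aP => [|a] aP; first by rewrite /= rmorph1.
  rewrite /yv zX /zv vy_eq //; first by rewrite (negbTE ij).
  by have := PP i; lia.
rewrite subn1 prednK //; case: (ltngtP a (P j)) => aP.
- rewrite ltnS ltnW //; case: a aP => [|a] aP; first by rewrite /= rmorph1.
  rewrite /yv zX /zv vy_eq //; first by rewrite eqxx (ltn_eqF aP).
  by have := PP j; lia.
- by rewrite ltnNge aP /= raddf0.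
- have yE : yv j (P j) = 'X_(vy j (P j)) by case: (P j) Pj.
  by rewrite aP ltnSn ?ltnn yE zX /zv eqxx.
Qed.

Lemma coef_prod_top (r : seq F) (p : F -> {poly S}) (N : F -> nat) :
  (forall i, size (p i) <= (N i).+1)%N ->
  (size (\prod_(i <- r) p i)%R <= (\sum_(i <- r) N i).+1)%N /\
  (\prod_(i <- r) p i)`_(\sum_(i <- r) N i) = \prod_(i <- r) (p i)`_(N i).
Proof.
move=> sp; elim: r => [|i r [IHs IHc]].
  by rewrite !big_nil size_poly1 coef1.
rewrite !big_cons; split.
  by apply: leq_trans (size_polyMleq _ _) _; have := sp i; lia.
rewrite -IHc; set q := \prod_(_ <- _) _ in IHs *; set b := (\sum_(_ <- _) _)%N in IHs *.
rewrite coefM (bigD1 (inord (N i) : 'I_(N i + b).+1)) //= inordK; last lia.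
rewrite addKn big1 ?addr0 // => k kN.
have {}kN : (k : nat) <> N i.
  by move=> E; move: kN; rewrite -val_eqE /= inordK ?E ?eqxx //; lia.
case: (ltnP k (N i)) => kNi.
  rewrite [q`_ _]nth_default ?mulr0 //; apply: leq_trans IHs _; lia.
by rewrite nth_default ?mul0r //; apply: leq_trans (sp i) _; lia.
Qed.

Definition topm (r : seq F) (P : F -> nat) : 'X_{1..nS} :=
  (\sum_(i <- r) U_(vy i (P i)))%MM.

(** In the highest degree of the product only the top terms of the factors meet. A group with
    [P i = 0] contributes y_(i,0) = 1, hence the filter. *)
Lemma theta_top P :
  theta P (\sum_i P i) =
  'X_[U_(vh) + topm [seq i <- index_enum F | (0 < P i)%N] P].
Proof.
rewrite /theta (coef_prod_top (index_enum F) (N := P) _).2; last by move=> i; apply: size_poly.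
rewrite mpolyXD; congr (_ * _).
rewrite /topm big_filter -mprodXE [RHS]big_mkcond /=; apply: eq_bigr => i _.
by rewrite coef_poly ltnSn /yv; case: (P i).
Qed.

Lemma topm_h r P : (forall i, P i <= Pm i)%N -> (forall i, i \in r -> 0 < P i)%N ->
  topm r P vh = 0%N.
Proof.
move=> PP rP; rewrite /topm mnm_sumE big_seq big1 // => i /rP Pi.
by rewrite mnm1E vy_neq_h // Pi PP.
Qed.

Lemma topm_y r P i a : (forall i, P i <= Pm i)%N ->
  (forall i, i \in r -> 0 < P i)%N -> uniq r -> (0 < a <= Pm i)%N ->
  topm r P (vy i a) = ((i \in r) && (a == P i))%N.
Proof.
move=> PP rP ru aP; rewrite /topm mnm_sumE.
have E j : j \in r -> U_(vy j (P j))%MM (vy i a) = (j == i) && (a == P i) :> nat.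
  move=> /rP Pj; rewrite mnm1E vy_eq ?Pj ?PP //.
  by case: eqP => // ->; rewrite eq_sym.
have [ir|ir] := boolP (i \in r).
  rewrite (bigD1_seq i) //= E // eqxx /= big_seq_cond big1 ?addn0 // => j.
  by move=> /andP[jr ji]; rewrite E // (negbTE ji).
rewrite big_seq big1 // => j jr; rewrite E //.
by case: eqP => // ji; rewrite -ji jr in ir.
Qed.

Lemma topm_wt r P i : (forall i, P i <= Pm i)%N ->
  (forall i, i \in r -> 0 < P i)%N -> uniq r -> wt i (topm r P) = (i \in r).
Proof.
move=> PP rP ru; rewrite /topm (big_morph (wt i) (wtD i) (wt0 i)) big_seq.
rewrite (eq_bigr (fun j => (j == i) : nat)) => [|j jr]; last first.
  by rewrite wtUy ?rP ?PP // eq_sym.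
have [ir|ir] := boolP (i \in r).
  rewrite -big_seq (bigD1_seq i) //= eqxx big1 // => j /negbTE -> //.
by rewrite big1 // => j jr; case: eqP => // ji; rewrite -ji jr in ir.
Qed.

End SegreMonomials.

(** * Freeness over the polynomial ring of the parameters *)

Section Freeness.
Variables (K : fieldType) (F : finType) (Pm : F -> nat).
Local Notation nS := #|{: svar Pm}|.
Local Notation S := {mpoly K[nS]}.
Local Notation vh := (vh Pm).
Local Notation vy := (vy Pm).
Local Notation theta := (@theta K F Pm).
Local Notation topm := (topm Pm).
Implicit Types (P : F -> nat) (U V : 'X_{1..nS} -> Prop).

Definition homU U d (f : S) := supp (fun m => U m /\ m vh = d) f.

(** Makes the span of [U] a module over the algebra generated by the [theta P k]. *)
Definition stable P U := forall m1 m2, slin P m1 -> U m2 -> U (m1 + m2)%MM.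

Definition comb n P (B : finType) (c : B -> {mpoly K[n]}) (e : B -> S) : S :=
  \sum_x psub (fun k : 'I_n => theta P k) (c x) * e x.

(** The span of [U], graded by the exponent of [h], as a free module. The coefficients are
    polynomials in fresh variables, so the last clause also contains the algebraic independence of
    the [n] parameters. *)
Definition FreeMod n P U t := exists (B : finType) (deg : B -> nat) (e : B -> S),
  [/\ forall x, (deg x <= t)%N, exists x, deg x = t,
      forall x, homU U (deg x) (e x),
      forall d f, homU U d f -> exists c : B -> {mpoly K[n]},
        (forall x, supp (fun m => mdeg m + deg x = d)%N (c x)) /\ f = comb P c e
    & forall c : B -> {mpoly K[n]}, comb P c e = 0 -> forall x, c x = 0].

(** The same for the span of [U] modulo that of [V], the quotient being expressed by membership in
    [supp V]. The flag [att] is needed because only one layer of a filtration has to attain the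
    degree [t]. *)
Definition FreeQuot n P U V t (att : bool) :=
  exists (B : finType) (deg : B -> nat) (e : B -> S),
  [/\ forall x, (deg x <= t)%N, att -> exists x, deg x = t,
      forall x, homU U (deg x) (e x),
      forall d f, homU U d f -> exists c : B -> {mpoly K[n]},
        (forall x, supp (fun m => mdeg m + deg x = d)%N (c x)) /\
        supp V (f - comb P c e)
    & forall c : B -> {mpoly K[n]}, supp V (comb P c e) -> forall x, c x = 0].

Lemma homU_and U d f : supp U f -> supp (fun m => m vh = d) f -> homU U d f.
Proof. by move=> Uf df m mf; split; [apply: Uf|apply: df]. Qed.

Lemma homU_supp U d f : homU U d f -> supp U f.
Proof. by apply: supp_sub => m []. Qed.

Lemma homU_deg U d f : homU U d f -> supp (fun m => m vh = d) f.
Proof. by apply: supp_sub => m []. Qed.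

Section WithP.
Variable P : F -> nat.
Hypothesis PP : forall i, (P i <= Pm i)%N.

Lemma stable_mul n U (c : {mpoly K[n]}) g : stable P U -> supp U g ->
  supp U (psub (fun k : 'I_n => theta P k) c * g).
Proof.
move=> sU; move: g; rewrite /mmap.
pose good (s : S) := forall g : S, supp U g -> supp U (s * g).
rewrite -/(good _); apply: big_ind => [g _|s1 s2 g1 g2 g Ug|m _ g Ug].
- by rewrite mul0r; apply: supp0.
- by rewrite mulrDl; apply: suppD; [apply: g1|apply: g2].
rewrite mul_mpolyC -scalerAl; apply: suppZ; move: g Ug; rewrite -/(good _) /mmap1.
apply: big_ind => [g Ug|s1 s2 g1 g2 g Ug|i _]; first by rewrite mul1r.
  by rewrite -mulrA; apply/g1/g2.
elim: (m i) => [|k IH] g Ug; first by rewrite expr0 mul1r.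
rewrite exprS -mulrA /=; exact: (suppM sU (theta_supp (k := i) PP) (IH _ Ug)).
Qed.

Lemma comb_supp n U (B : finType) (c : B -> {mpoly K[n]}) (e : B -> S) :
  stable P U -> (forall x, supp U (e x)) -> supp U (comb P c e).
Proof. by move=> sU Ue; apply: supp_sum => x _; apply: stable_mul. Qed.

Lemma comb_deg n (B : finType) (c : B -> {mpoly K[n]}) (e : B -> S) deg d :
  (forall x, supp (fun m => m vh = deg x) (e x)) ->
  (forall x, supp (fun m => mdeg m + deg x = d)%N (c x)) ->
  supp (fun m => m vh = d) (comb P c e).
Proof.
move=> he hc; apply: supp_sum => x _.
have [->|nz] := eqVneq (c x) 0; first by rewrite raddf0 mul0r; apply: supp0.
have dx : (deg x <= d)%N.
  have [m mc] : exists m, m \in msupp (c x).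
    by exists (mlead (c x)); apply: mlead_supp.
  by rewrite -(hc _ _ mc) leq_addl.
apply: (@suppM _ _ (fun m => m vh = d - deg x)%N _ _ _ _ _ _ (he x)).
  by move=> m1 m2; rewrite mnmDE => -> ->; rewrite subnK.
apply: (psub_supp (d := fun m : 'X_{1..nS} => m vh)) => [a b||k|].
- by rewrite mnmDE.
- by rewrite mnm0E.
- by apply: supp_sub (theta_supp (k := k) PP) => m [].
- by apply: supp_sub (hc x) => m; lia.
Qed.

(** An extension of free modules is free: the remainder of an expansion modulo [V] lies in the span
    of [V] and is expanded in turn. *)
Lemma FreeQuot_trans n U V W t a1 a2 : (forall m, V m -> U m) ->
  (forall m, W m -> V m) -> stable P U -> stable P V ->
  FreeQuot n P U V t a1 -> FreeQuot n P V W t a2 -> FreeQuot n P U W t (a1 || a2).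
Proof.
move=> VU WV sU sV [B1 [d1 [e1 [le1 at1 h1 g1 i1]]]] [B2 [d2 [e2 [le2 at2 h2 g2 i2]]]].
pose deg (x : B1 + B2) := match x with inl x => d1 x | inr x => d2 x end.
pose e (x : B1 + B2) := match x with inl x => e1 x | inr x => e2 x end.
have combE (c : B1 + B2 -> {mpoly K[n]}) :
    comb P c e = comb P (c \o inl) e1 + comb P (c \o inr) e2.
  by rewrite /comb big_sumType.
have sV2 c : supp V (comb P c e2).
  by apply: comb_supp => // x; apply: homU_supp (h2 x).
exists (B1 + B2)%type, deg, e; split=> [[x|x]||[x|x]|d f hf|c Wc].
- exact: le1.
- exact: le2.
- case: a1 at1 => [|_] /=; first by case=> // x <- _; exists (inl x).
  by move=> a2T; have [x <-] := at2 a2T; exists (inr x).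
- exact: h1.
- by apply: supp_sub (h2 x) => m [/VU].
- have [c1 [hc1 Vc1]] := g1 d f hf.
  have hV : homU V d (f - comb P c1 e1).
    apply: homU_and => //; apply: suppB; first exact: homU_deg hf.
    by apply: comb_deg hc1 => x; apply: homU_deg (h1 x).
  have [c2 [hc2 Wc2]] := g2 d _ hV.
  exists (fun x => match x with inl x => c1 x | inr x => c2 x end); split.
    by case.
  by rewrite combE opprD addrA.
rewrite combE in Wc.
have c1 : forall x, (c \o inl) x = 0.
  apply: i1; rewrite -[comb _ _ e1](addrK (comb P (c \o inr) e2)).
  by apply: suppB; [apply: supp_sub Wc|].
have c2 : forall x, (c \o inr) x = 0.
  apply: i2; move: Wc; rewrite [comb _ _ e1]big1 ?add0r // => x _.
  by rewrite c1 raddf0 mul0r.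
by case=> x; [apply: (c1 x)|apply: (c2 x)].
Qed.

Lemma FreeQuot_refl n U t : FreeQuot n P U U t false.
Proof.
exists void, (fun=> 0%N), (fun=> 0); split=> [[]|//|[]|d f hf|c _ []].
exists (fun=> 0); split=> [[]|]; rewrite /comb big1 ?subr0; last by case.
exact: homU_supp hf.
Qed.

Lemma FreeQuot_le n U V t t' a : (t <= t')%N ->
  FreeQuot n P U V t a -> FreeQuot n P U V t' (a && (t == t')).
Proof.
move=> tt' [B [deg [e [le at_ h g i]]]]; exists B, deg, e; split=> //.
  by move=> x; apply: leq_trans (le x) tt'.
by case/andP=> /at_[x <-] /eqP <-; exists x.
Qed.

(** Modulo the monomials divisible by [vy j (P j)], the parameters of [P] act as those of
    [decr j P]. So the monomials without this variable represent the quotient, with the module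
    structure known by induction. *)
Lemma FreeQuot_step n U t j : stable P U -> (0 < P j)%N ->
  FreeMod n (decr j P) (fun m => U m /\ m (vy j (P j)) = 0%N) t ->
  FreeQuot n P U (fun m => U m /\ m (vy j (P j)) <> 0%N) t true.
Proof.
move=> sU Pj [B [deg [e [le at_ h g i]]]]; set v := vy j (P j) in h g *.
have he x : homU U (deg x) (e x) by apply: supp_sub (h x) => m [[]].
have zcomb (c : B -> {mpoly K[n]}) :
    psub (zv K v) (comb P c e) = comb (decr j P) c e.
  rewrite /comb rmorph_sum; apply: eq_bigr => x _; rewrite rmorphM /=; congr (_ * _).
    rewrite psub_comp; apply: eq_psub => k /=; exact: zv_theta.
  by rewrite zvE mrest_id //; apply: supp_sub (h x) => m [[_ ->]].
exists B, deg, e; split=> // [d f hf|c Vc].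
  have [c [hc fE]] : exists c : B -> {mpoly K[n]},
      (forall x, supp (fun m => mdeg m + deg x = d)%N (c x)) /\
      psub (zv K v) f = comb (decr j P) c e.
    apply: g; rewrite zvE => m /mrest_supp[/eqP mv /hf[Um md]]; split=> //.
  exists c; split=> //.
  have z0 : mrest (fun m => m v == 0%N) (f - comb P c e) = 0.
    by rewrite -zvE raddfB /= zcomb fE subrr.
  move=> m mf; split.
    move: m mf; apply: suppB; first exact: homU_supp hf.
    by apply: comb_supp => // x; apply: homU_supp (he x).
  move/eqP=> mv; move/mpolyP/(_ m): z0; rewrite mcoeff_mrest mv mcoeff0.
  by apply/eqP; rewrite -mcoeff_msupp.
apply: i; rewrite -zcomb zvE mrest0 //; apply: supp_sub Vc => m [_] /eqP //.
Qed.

Definition mulset (mu : 'X_{1..nS}) U (m : 'X_{1..nS}) :=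
  exists2 m', m = (mu + m')%MM & U m'.

Lemma mulsetP mu U (f : S) : supp (mulset mu U) f ->
  exists2 g, f = 'X_[mu] * g & supp U g.
Proof.
move=> Uf; have [|g fE sg] := @dvd_mpolyX _ _ mu f.
  by move=> m /Uf[m' -> _]; rewrite lem_addr.
by exists g => // m /sg/Uf[m' /addmI ->].
Qed.

Lemma mulset_supp mu U (g : S) : supp U g -> supp (mulset mu U) ('X_[mu] * g).
Proof. by move=> Ug; apply/supp_mulX => m /Ug Um; exists m. Qed.

Lemma comb_mulX n (B : finType) (c : B -> {mpoly K[n]}) (e : B -> S) mu :
  comb P c (fun x => 'X_[mu] * e x) = 'X_[mu] * comb P c e.
Proof. by rewrite /comb mulr_sumr; apply: eq_bigr => x _; rewrite mulrCA. Qed.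

Lemma FreeMod_shift n U mu t :
  FreeMod n P U t -> FreeMod n P (mulset mu U) (mu vh + t)%N.
Proof.
move=> [B [deg [e [le at_ h g i]]]].
exists B, (fun x => mu vh + deg x)%N, (fun x => 'X_[mu] * e x); split=> [x||x|d f hf|c].
- by rewrite leq_add2l.
- by have [x <-] := at_; exists x.
- apply/supp_mulX => m /h[Um md]; split; first by exists m.
  by rewrite mnmDE md.
- have [f0 fE Uf0] := mulsetP (homU_supp hf).
  (* The zero element is homogeneous of every degree, so nothing then forces [mu vh <= d], on which
     the subtraction below relies. *)
  have [f00|f0n] := eqVneq f0 0.
    exists (fun=> 0); split=> [x|]; first exact: supp0.
    rewrite fE f00 mulr0 /comb big1 // => x _; by rewrite raddf0 mul0r.
  have df0 : supp (fun m => mu vh + m vh = d)%N f0.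
    move=> m mf0; have := msupp_mulX mu f0 m; rewrite mf0 -fE => /esym/hf[_].
    by rewrite mnmDE.
  have dmu : (mu vh <= d)%N by rewrite -(df0 _ (mlead_supp f0n)) leq_addr.
  have [|c [hc cE]] := g (d - mu vh)%N f0.
    by apply: homU_and => //; apply: supp_sub df0 => m; lia.
  exists c; split=> [x|]; first by apply: supp_sub (hc x) => m; lia.
  by rewrite comb_mulX -cE.
by rewrite comb_mulX -(mulr0 'X_[mu]) => /mulX_inj; apply: i.
Qed.

Lemma FreeMod_ext n U V t : (forall m, U m <-> V m) ->
  FreeMod n P U t -> FreeMod n P V t.
Proof.
move=> UV [B [deg [e [le at_ h g i]]]]; exists B, deg, e; split=> // [x|d f hf].
  by apply: supp_sub (h x) => m [/UV].
by apply: g; apply: supp_sub hf => m [/UV].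
Qed.

Lemma psub_last n (a : {mpoly K[n]}) b :
  psub (fun k : 'I_n.+1 => theta P k) (mwiden a + 'X_ord_max * b) =
  psub (fun k : 'I_n => theta P k) a +
  theta P n * psub (fun k : 'I_n.+1 => theta P k) b.
Proof.
rewrite raddfD /= rmorphM /= psubX psub_mwiden; congr (_ + _); exact: eq_psub.
Qed.

Lemma comb_last n (B : finType) (e : B -> S) (a : B -> {mpoly K[n]}) b :
  comb P (fun x => mwiden (a x) + 'X_ord_max * b x) e =
  comb P a e + theta P n * comb P b e.
Proof.
rewrite /comb mulr_sumr -big_split; apply: eq_bigr => x _.
by rewrite psub_last mulrDl mulrA.
Qed.

Lemma eq_comb n (B : finType) (e : B -> S) (a b : B -> {mpoly K[n]}) :
  a =1 b -> comb P a e = comb P b e.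
Proof. by move=> ab; apply: eq_bigr => x _; rewrite ab. Qed.

(** The new parameter is a monomial, hence acts injectively, and a basis modulo it lifts. For
    spanning, the remainder is divisible by [mu] and its quotient has [h]-degree one less. For
    independence, a relation read modulo [mu] loses all terms with the last parameter; the rest of
    it can be divided by [mu], and the coefficients get smaller. *)
Lemma FreeQuot_finish n U mu t : stable P U -> theta P n = 'X_[mu] ->
  mu vh = 1%N ->
  FreeQuot n P U (mulset mu U) t true -> FreeMod n.+1 P U t.
Proof.
move=> sU thn muh [B [deg [e [le at_ h g i]]]]; exists B, deg, e; split=> //.
- exact: at_.
- elim=> [|d IH] f hf; have [c [hc Vc]] := g _ f hf; have [f1 f1E Uf1] := mulsetP Vc.
    exists (fun x => mwiden (c x)); split=> [x|].
      by apply: supp_mwiden; apply: supp_sub (hc x) => m; rewrite mdeg_mnmwiden.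
    have f10 : f1 = 0.
      apply: supp_False => m; rewrite (msupp_mulX mu) -f1E => mf.
      have := suppB (homU_deg hf) (comb_deg (fun x => homU_deg (h x)) hc) mf.
      by rewrite mnmDE muh.
    move/eqP: f1E; rewrite f10 mulr0 subr_eq0 => /eqP ->.
    by apply: eq_bigr => x _; rewrite psub_mwiden.
  have hf1 : homU U d f1.
    apply: homU_and => // m; rewrite (msupp_mulX mu) -f1E => mf.
    have := suppB (homU_deg hf) (comb_deg (fun x => homU_deg (h x)) hc) mf.
    by rewrite mnmDE muh => -[].
  have [b [hb bE]] := IH f1 hf1.
  exists (fun x => mwiden (c x) + 'X_ord_max * b x); split=> [x|].
    apply: suppD.
      by apply: supp_mwiden; apply: supp_sub (hc x) => m; rewrite mdeg_mnmwiden.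
    by apply/supp_mulX; apply: supp_sub (hb x) => m; rewrite mdegD mdeg1; lia.
  by rewrite comb_last -bE thn -f1E addrC subrK.
move=> c; have [N cN] : exists N, forall x, (msize (c x) <= N)%N.
  by exists (\max_x msize (c x))%N => x; apply: leq_bigmax.
elim: N c cN => [|N IH] c cN c0 x; apply/eqP.
  by rewrite -msize_poly_eq0 -leqn0.
have /fin_all_exists[a /fin_all_exists[b abP]] := fun x => mwiden_last_split (c x).
have cE y : c y = mwiden (a y) + 'X_ord_max * b y by case: (abP y).
move: c0; rewrite (eq_comb _ cE) comb_last thn => c0.
have Ub : supp U (comb P b e).
  by apply: comb_supp => // y; apply: homU_supp (h y).
have a0 : forall y, a y = 0.
  apply: i; move/eqP: c0; rewrite addr_eq0 => /eqP ->.
  by apply: suppN; apply: mulset_supp.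
have b0 : forall y, b y = 0.
  apply: IH => [y|].
    have [_ _ /msize_mulX_last sb] := abP y.
    by apply: leq_trans sb _; have := cN y; lia.
  apply: (mulX_inj (mu := mu)); rewrite mulr0 -[RHS]c0.
  by rewrite [comb P a e]big1 ?add0r // => y _; rewrite a0 raddf0 mul0r.
by rewrite cE a0 b0 mulr0 raddf0 addr0.
Qed.
End WithP.
End Freeness.

(** * Filtration of the Segre modules by divisibility by last variables *)

Section SegreFree.
Variables (K : fieldType) (F : finType) (Pm : F -> nat).
Local Notation nS := #|{: svar Pm}|.
Local Notation vh := (vh Pm).
Local Notation vy := (vy Pm).
Local Notation topm := (topm Pm).
Implicit Types (P : F -> nat) (Z : F -> bool) (m : 'X_{1..nS}).

(* For P = Pm and Z = 0 these are the monomials h^d y^m of the Segre ring, of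
   degree at most d in each of the groups y_i; Z lowers the bound by one for
   some groups, and a group without variables imposes no bound. *)
Definition segset P Z m :=
  inside P m /\ forall i, (0 < P i)%N -> (wt i m + Z i <= m vh)%N.

Definition segtop P Z (r : seq F) m :=
  segset P Z m /\ forall i, i \in r -> m (vy i (P i)) <> 0%N.

(** The top degree of the basis. With no defects and [P] the sizes m-1, n-1, r-1 it is
    m+n+r-2-max{m,n,r}. *)
Definition tdeg P Z := (\sum_i P i - \max_i (P i - Z i))%N.

Lemma segset_stable P Z : stable P (segset P Z).
Proof.
move=> m1 m2 [h1 in1 w1] [in2 w2]; split=> [i a ia|i Pi].
  by rewrite mnmDE in1 ?in2.
by rewrite wtD mnmDE h1; have := w1 i; have := w2 i Pi; lia.
Qed.

Lemma segtop_stable P Z r : stable P (segtop P Z r).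
Proof.
move=> m1 m2 s1 [s2 t2]; split; first exact: segset_stable.
by move=> i /t2; rewrite mnmDE; lia.
Qed.

Lemma submKC_mnm n (m1 m2 : 'X_{1..n}) : (m1 <= m2)%MM -> m2 = (m1 + (m2 - m1))%MM.
Proof. by move=> le; rewrite addmC submK. Qed.

Section Fixed.
Variables (P : F -> nat) (Z : F -> bool).
Hypothesis PP : forall i, (P i <= Pm i)%N.

Section Piece.
Variables (pre : seq F) (j : F) (Z' : F -> bool) (b : bool).
Hypotheses (upre : uniq pre) (preP : forall i, i \in pre -> (0 < P i)%N).
Hypotheses (jpre : j \notin pre) (Pj : (0 < P j)%N) (Z'j : Z' j = false).
(** Division by [mu] below removes weight 1 from the groups in [pre] and [b] from the exponent of
    [h], which changes the defect [Z] into [Z']. For [i = j] the equation says [b = Z j]. *)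
Hypothesis ZZ' : forall i, (0 < P i)%N -> (Z i + (i \in pre) = Z' i + b)%N.

Let mu : 'X_{1..nS} := (topm pre P + U_(vh) *+ b)%MM.

Lemma piece_mu_h : mu vh = b.
Proof.
by rewrite /mu mnmDE topm_h // mulmnE mnm1E eqxx mul1n.
Qed.

Lemma piece_mu_y i a : (0 < a <= Pm i)%N -> mu (vy i a) = ((i \in pre) && (a == P i))%N.
Proof.
move=> aP; rewrite /mu mnmDE topm_y // mulmnE mnm1E [vh == _]eq_sym vy_neq_h //.
by rewrite mul0n addn0.
Qed.

Lemma piece_mu_wt i : wt i mu = (i \in pre).
Proof.
rewrite /mu wtD topm_wt //; case: (b); rewrite ?mulm1n ?mulm0n ?wtUh ?wt0 addn0 //.
Qed.

(** Such a monomial is divisible by the last variables of the groups in [pre], and by [h] if [Z j]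
    holds, because of the bound for group [j]. Dividing them out leaves the bounds with defect
    [Z']. *)
Lemma segtop_piece m : segtop P Z pre m /\ m (vy j (P j)) = 0%N <->
  mulset mu (segset (decr j P) Z') m.
Proof.
have Zj : Z j = b by have := ZZ' Pj; rewrite Z'j (negbTE jpre); case: (Z j) (b) => [] [].
have jP : (0 < P j <= Pm j)%N by rewrite Pj PP.
split=> [[[[inm wm] tm] mj]|[m' -> [inm wm]]].
  have lem : (mu <= m)%MM.
    apply/mnm_lepP => v; case: (vP v) => [->|[i [a [aP ->]]]].
      by rewrite piece_mu_h -Zj; have := wm j Pj; lia.
    rewrite piece_mu_y //; case: (boolP (i \in pre)) => //= ir.
    by case: eqP => // ->; have := tm i ir; lia.
  exists (m - mu)%MM; first exact: submKC_mnm.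
  have mE := submKC_mnm lem.
  split=> [i a|i].
    rewrite /decr => ia; have aP : (0 < a <= Pm i)%N by lia.
    rewrite mnmBE; case: (ltnP (P i) a) => Pia; first by rewrite inm ?Pia //; lia.
    have [ij aPi] : i = j /\ a = P j 
      by move: ia; case: eqP => [<-|_] ia; [split=> //; lia|exfalso; lia].
    by rewrite ij aPi mj.
  rewrite /decr => Pi; have {}Pi : (0 < P i)%N by lia.
  have e1 : wt i m = ((i \in pre) + wt i (m - mu))%N by rewrite {1}mE wtD piece_mu_wt.
  have e2 : m vh = (b + (m - mu)%MM vh)%N by rewrite {1}mE mnmDE piece_mu_h.
  have := wm i Pi; have := ZZ' Pi; rewrite e1 e2; lia.
have dj : (decr j P j < P j)%N by rewrite /decr eqxx; lia.
split; first split; first split.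
- move=> i a ia; rewrite mnmDE piece_mu_y; last lia.
  by rewrite inm; [case: eqP; [lia|rewrite andbF]|rewrite /decr; lia].
- move=> i Pi; rewrite wtD mnmDE piece_mu_h piece_mu_wt.
  have := ZZ' Pi; case: (ltnP 0 (decr j P i)) => [/wm|]; first lia.
  rewrite /decr; case: eqP => [->|]; last lia.
  (* Group [j] has no variable left, so [segset (decr j P) Z'] records no bound for it. The lost
     bound is trivial exactly because [Z' j] is false. *)
  move=> Pj0; have -> : wt j m' = 0%N.
    rewrite /wt big_nat big1 // => a aP; apply: inm; rewrite /decr eqxx; lia.
  by rewrite Z'j; lia.
- move=> i ir; rewrite mnmDE piece_mu_y ?ir ?eqxx //.
  by rewrite (preP ir) PP.
- rewrite mnmDE piece_mu_y // (negbTE jpre) inm //.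
  by rewrite dj PP.
Qed.

Lemma sum_decr : (\sum_i P i = (\sum_i decr j P i).+1)%N.
Proof.
clear -Pj.
rewrite (bigD1 j) //= [in RHS](bigD1 j) //= /decr eqxx.
rewrite [X in (_ = (_ + X).+1)%N](eq_bigr P) => [|i /negbTE ->]; lia.
Qed.

(** The sum drops by 1. The entry [P i - Z i] drops by [1 - b] for [i = j] and for [i] in [pre], and
    by less for the other groups, so the maximum drops by at most [1 - b]. If no other live group
    remains it drops by exactly that much, and the degrees agree. *)
Lemma tdeg_piece_le : (b + tdeg (decr j P) Z' <= tdeg P Z)%N /\
  ((forall i, (0 < P i)%N -> i \in rcons pre j) ->
   (b + tdeg (decr j P) Z')%N == tdeg P Z).
Proof.
clear -jpre Pj Z'j ZZ'.
rewrite /tdeg sum_decr.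
set M := (\max_i (P i - Z i))%N; set M' := (\max_i (decr j P i - Z' i))%N.
set n := (\sum_i decr j P i)%N.
have M'n : (M' <= n)%N.
  apply/bigmax_leqP => i _; apply: leq_trans (leq_subr _ _) _.
  by rewrite /n (bigD1 i) //= leq_addr.
have MM' : (M + b <= M'.+1)%N.
  suff : (M <= M'.+1 - b)%N by case: (b); lia.
  apply/bigmax_leqP => i _; case: (posnP (P i)) => [->//|Pi].
  have : (decr j P i - Z' i <= M')%N by apply: leq_bigmax.
  have := ZZ' Pi; rewrite /decr; case: eqP => [->|_].
    by rewrite (negbTE jpre); lia.
  by case: (i \in pre); lia.
split; first by lia.
move=> full; have M'M : (M'.+1 <= M + b)%N.
  suff : (M' <= (M + b).-1)%N /\ (0 < M + b)%N by lia.
  have Mj : (0 < M + b)%N.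
    have : (P j - Z j <= M)%N by apply: leq_bigmax.
    by have := ZZ' Pj; rewrite (negbTE jpre) Z'j; lia.
  split=> //; apply/bigmax_leqP => i _; case: (posnP (P i)) => [|Pi].
    by rewrite /decr => ->; rewrite !sub0n.
  have : (P i - Z i <= M)%N by apply: leq_bigmax.
  have := full i Pi; have := ZZ' Pi; rewrite mem_rcons in_cons /decr.
  by case: eqP => [->|_]; rewrite ?(negbTE jpre) /=; [lia|move=> h1 h2; rewrite h2 in h1; lia].
by apply/eqP; lia.
Qed.

End Piece.

(** Divisibility by a last variable makes some weight positive, so the bound of that group forces a
    factor [h]. The end of the filtration is thus the image of the top parameter. *)
Lemma segtop_all (r : seq F) m : uniq r -> (forall i, (i \in r) = (0 < P i)%N) ->
  (exists i, i \in r) ->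
  segtop P Z r m <-> mulset (U_(vh) + topm r P)%MM (segset P Z) m.
Proof.
move=> ur rP [i0 i0r].
have rP' i : i \in r -> (0 < P i)%N by rewrite rP.
set mu := (_ + _)%MM.
have muh : mu vh = 1%N by rewrite mnmDE mnm1E eqxx topm_h.
have muy i a : (0 < a <= Pm i)%N -> mu (vy i a) = ((i \in r) && (a == P i))%N.
  by move=> aP; rewrite mnmDE mnm1E eq_sym vy_neq_h // topm_y.
have muw i : wt i mu = (i \in r) by rewrite wtD wtUh topm_wt.
split=> [[[inm wm] tm]|[m' -> [inm wm]]].
  have lem : (mu <= m)%MM.
    apply/mnm_lepP => v; case: (vP v) => [->|[i [a [aP ->]]]].
      have iP : (0 < P i0 <= Pm i0)%N by rewrite rP' ?PP.
      have := tm _ i0r; have := wt_ge m iP; have := wm i0 (rP' _ i0r).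
      by rewrite muh; lia.
    rewrite muy //; case: (boolP (i \in r)) => //= ir.
    by case: eqP => // ->; have := tm i ir; lia.
  exists (m - mu)%MM; first exact: submKC_mnm.
  have mE := submKC_mnm lem.
  split=> [i a ia|i Pi]; first by rewrite mnmBE inm.
  have e1 : wt i m = (1 + wt i (m - mu))%N by rewrite {1}mE wtD muw rP Pi.
  have e2 : m vh = (1 + (m - mu)%MM vh)%N by rewrite {1}mE mnmDE muh.
  by have := wm i Pi; rewrite e1 e2; lia.
split=> [|i ir]; last first.
  by rewrite mnmDE muy ?ir ?eqxx // rP' ?PP.
split=> [i a ia|i Pi].
  rewrite mnmDE inm // muy; last lia.
  by case: eqP; rewrite ?andbF //; lia.
by rewrite wtD mnmDE muh muw rP Pi; have := wm i Pi; lia.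
Qed.

End Fixed.

Lemma FreeQuot_ext n P U V V' t a : (forall m, V m <-> V' m) ->
  @FreeQuot K F Pm n P U V t a -> FreeQuot K n P U V' t a.
Proof.
move=> VV' [B [deg [e [le at_ h g i]]]]; exists B, deg, e; split=> // [d f hf|c Vc].
  have [c [hc Vc]] := g d f hf; exists c; split=> //.
  by apply: supp_sub Vc => m /VV'.
by apply: i; apply: supp_sub Vc => m /VV'.
Qed.

(** The groups in [pre] are those whose last variable is already required to divide; each group of
    [post] contributes one more piece. The final piece attains the degree bound, so the flag holds
    as long as a piece remains. *)
Lemma segset_filtration n P Z js :
  (forall i, P i <= Pm i)%N -> (\sum_i P i = n.+1)%N ->
  (forall P' Z', (forall i, P' i <= Pm i)%N -> (\sum_i P' i = n)%N ->
    FreeMod K n.+1 P' (segset P' Z') (tdeg P' Z')) ->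
  uniq js -> (forall i, (i \in js) = (0 < P i)%N) ->
  pairwise (fun i k => Z i ==> Z k) js ->
  forall post pre, js = pre ++ post ->
  FreeQuot K n.+1 P (segtop P Z pre) (segtop P Z js) (tdeg P Z) (post != [::]).
Proof.
move=> PP Pn IH ujs jsP pw; elim=> [|j post IHpost] pre E.
  by rewrite cats0 in E; rewrite -E; apply: FreeQuot_refl.
have E' : js = rcons pre j ++ post by rewrite cat_rcons.
move: pw; rewrite {1}E pairwise_cat => /and3P[/allrelP pwp _ /= /andP[/allP pwj _]].
have memjs i : (i \in js) = [|| i \in pre, i == j | i \in post].
  by rewrite E mem_cat in_cons.
have [upre jpre jpost] : [/\ uniq pre, j \notin pre & j \notin post].
  move: ujs; rewrite E cat_uniq /= negb_or => /and3P[-> /andP[-> _] /andP[-> _]].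
  by [].
have Pj : (0 < P j)%N by rewrite -jsP memjs eqxx orbT.
have preP i : i \in pre -> (0 < P i)%N by rewrite -jsP memjs => ->.
(* This is [Z i + (i \in pre) - Z j]. The order of [js], with [Z] false first, keeps it in {0, 1}:
   if [Z j] is false, so is [Z] on [pre]; if [Z j] is true, so is [Z] on [post]. *)
pose Z' i := if Z j then Z i && (i \in pre) else Z i || (i \in pre).
have Z'j : Z' j = false by rewrite /Z' (negbTE jpre); case: (Z j).
have ZZ' i : (0 < P i)%N -> (Z i + (i \in pre) = Z' i + Z j)%N.
  rewrite -jsP memjs /Z'; case: (boolP (i \in pre)) => [ip _|_ /=].
    have := pwp i j ip (mem_head _ _).
    by case: (Z i) (Z j) => [] [].
  case: eqP => [->|_ /=]; first by case: (Z j).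
  by move=> /pwj; case: (Z i) (Z j) => [] [].
have decrP i : (decr j P i <= Pm i)%N.
  by apply: leq_trans (PP i); apply: leq_subr.
have decrn : (\sum_i decr j P i = n)%N.
  by move: Pn; rewrite (sum_decr Pj) => -[].
have := FreeMod_shift (topm pre P + U_(vh) *+ Z j)%MM (IH _ Z' decrP decrn).
rewrite (piece_mu_h PP (Z j) preP).
move/(FreeMod_ext (fun m => iff_sym (segtop_piece PP upre preP jpre Pj Z'j ZZ' m))).
move/(FreeQuot_step PP (@segtop_stable P Z pre) Pj).
have [tle teq] := tdeg_piece_le jpre Pj Z'j ZZ'.
move/(FreeQuot_le tle) => step.
have step' := FreeQuot_ext (V' := segtop P Z (rcons pre j)) _ step.
have <- : (true && ((Z j + tdeg (decr j P) Z')%N == tdeg P Z)) || (post != [::]) = true.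
  have [p0|] := eqVneq post [::]; last by rewrite orbT.
  by rewrite orbF teq // => i; rewrite -jsP E' p0 cats0.
apply: FreeQuot_trans (step' _) (IHpost _ E') => //.
- by move=> m [sm tm]; split=> // i ip; apply: tm; rewrite mem_rcons in_cons ip orbT.
- move=> m [sm tm]; split=> // i ip; apply: tm.
  by rewrite memjs; move: ip; rewrite mem_rcons in_cons => /orP[->|->]; rewrite ?orbT.
- exact: segtop_stable.
- exact: segtop_stable.
- move=> m; split=> [[[sm tm] mj]|[sm tm]].
    by split=> // i; rewrite mem_rcons in_cons => /predU1P[->//|]; apply: tm.
  split; last by apply: tm; rewrite mem_rcons mem_head.
  by split=> // i ip; apply: tm; rewrite mem_rcons in_cons ip orbT.
Qed.

Theorem segset_free n P Z : (forall i, P i <= Pm i)%N -> (\sum_i P i = n)%N ->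
  FreeMod K n.+1 P (segset P Z) (tdeg P Z).
Proof.
elim: n P Z => [|n IH] P Z PP Pn.
  have P0 i : P i = 0%N.
    by move/eqP: Pn; rewrite sum_nat_eq0 => /forallP/(_ i)/eqP.
  (* Without y-variables the module is K[h] with the single parameter [h], and 1 is a basis. *)
  have th0 : theta K Pm P 0 = 'X_vh.
    rewrite -[0%N]Pn theta_top; congr 'X_[_].
    rewrite (eq_filter (a2 := pred0)) => [|i]; last by rewrite P0.
    by rewrite filter_pred0 /topm big_nil addm0.
  apply: (FreeQuot_finish PP (mu := U_(vh)%MM)) => //.
  - exact: segset_stable.
  - by rewrite mnm1E eqxx.
  have combU (c : unit -> {mpoly K[0]}) : 
      comb P c (fun=> 1) = ((c tt)@_0)%:MP_[nS].
    rewrite /comb (big_pred1 tt) => [|[]] //.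
    by rewrite [c tt]nvar0_mpolyC mmapC mulr1 mcoeffC eqxx mulr1.
  exists unit, (fun=> 0%N), (fun=> 1); split=> [||x|d f hf|c Vc [] ].
  - by [].
  - by exists tt; rewrite /tdeg Pn.
  - rewrite -mpolyX0; apply: suppX; split; last by rewrite mnm0E.
    by split=> [i a _|i]; rewrite ?mnm0E // P0.
  - have [d0|dn] := eqVneq d 0%N.
      exists (fun=> (f@_0)%:MP); split=> [x|].
        rewrite -[_%:MP]mulr1 mul_mpolyC -mpolyX0; apply: suppZ; apply: suppX.
        by rewrite mdeg0 d0.
      rewrite combU mcoeffC eqxx mulr1.
      suff <- : f = (f@_0)%:MP by rewrite subrr; apply: supp0.
      apply/mpolyP => m; rewrite mcoeffC; case: eqP => [->|mn]; first by rewrite mulr1.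
      rewrite mulr0; apply/memN_msupp_eq0/negP => /hf[[inm _] mh]; apply: mn.
      apply: mnm_vP; rewrite ?mnm0E ?mh // => i a aP.
      by rewrite mnm0E inm // P0.
    exists (fun=> 0); split=> [x|]; first exact: supp0.
    rewrite /comb big1 ?subr0 => [|x _]; last by rewrite raddf0 mul0r.
    move=> m /hf[[inm wm] mh]; exists (m - U_(vh))%MM.
      by apply: submKC_mnm; rewrite lep1mP mh.
    by split=> [i a ia|i]; rewrite ?P0 // mnmBE inm.
  - rewrite [c tt]nvar0_mpolyC; apply/eqP; rewrite mpolyC_eq0; apply/eqP.
    rewrite combU in Vc.
    apply/eqP; case: eqP => // /eqP cn.
    have /Vc[m'] : 0%MM \in msupp ((c tt)@_0)%:MP_[nS].
      by rewrite mcoeff_msupp mcoeffC eqxx mulr1.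
    by move/mnmP/(_ vh); rewrite mnm0E mnmDE mnm1E eqxx.
pose live := [seq i <- index_enum F | (0 < P i)%N].
pose js := sort (fun i k => Z i ==> Z k) live.
have jsP i : (i \in js) = (0 < P i)%N.
  by rewrite mem_sort mem_filter mem_index_enum andbT.
have ujs : uniq js by rewrite sort_uniq filter_uniq // index_enum_uniq.
have pw : pairwise (fun i k => Z i ==> Z k) js.
  rewrite -sorted_pairwise => [|i k l]; last by case: (Z i) (Z k) (Z l) => [] [] [].
  by apply: sort_sorted => i k; case: (Z i) (Z k) => [] [].
have ne : exists i, i \in js.
  case: (pickP (fun i => 0 < P i)%N) => [i Pi|P0]; first by exists i; rewrite jsP.
  by move: Pn; rewrite big1 // => i _; have := P0 i; case: (P i).
have := segset_filtration PP Pn IH ujs jsP pw (post := js) (pre := [::]) erefl.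
have -> : js != [::] by case: (js) ne => // -[].
move=> H.
apply: (FreeQuot_finish PP (mu := (U_(vh) + topm js P)%MM)).
- exact: segset_stable.
- rewrite -Pn theta_top -/live; congr 'X_[_ + _]%MM.
  by apply: perm_big; rewrite perm_sym perm_sort.
- by rewrite mnmDE mnm1E eqxx topm_h // => i; rewrite jsP.
case: H => [B [deg [e [le at_ h g i]]]]; exists B, deg, e.
have top_all m := segtop_all Z PP m ujs jsP ne.
split=> // [x|d f hf|c Vc].
- by apply: supp_sub (h x) => m [[]].
- have [|c [hc Vc]] := g d f; first by apply: supp_sub hf => m [].
  by exists c; split=> //; apply: supp_sub Vc => m /top_all.
- by apply: i; apply: supp_sub Vc => m /top_all.
Qed.

End SegreFree.

(** * Graded free resolutions *)

Section Resolutions.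
Variable K : fieldType.
Local Notation "'R_ n" := {mpoly K[n]} (at level 8, n at level 2).

Definition hent n (a b : nat) (f : 'R_n) := supp (fun m => mdeg m + a = b)%N f.

Definition hmx n p q (da : 'I_p -> nat) (db : 'I_q -> nat) (A : 'M['R_n]_(p, q)) :=
  forall i j, hent (da i) (db j) (A i j).

(* A graded free resolution 0 -> F_p -> ... -> F_1 -> W of a submodule W of
   F_0, with F_0 generated in degrees [deg]; the degrees of F_i are at most
   t + i, and this bound is attained for i = p. *)
Fixpoint Res n (p t b : nat) (deg : 'I_b -> nat) (W : 'cV['R_n]_b -> Prop) : Prop :=
  if p is p'.+1 then
    (forall i, deg i <= t)%N /\
    exists b1 (deg1 : 'I_b1 -> nat) (d : 'M['R_n]_(b, b1)),
    [/\ hmx deg deg1 d, forall v, W v <-> exists w, v = d *m w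
      & Res p' t.+1 deg1 (fun w => d *m w = 0)]
  else [/\ forall i, (deg i <= t)%N, exists i, deg i = t & forall v, W v <-> v = 0].

Lemma Res_ext n p t b (deg : 'I_b -> nat) (W W' : 'cV['R_n]_b -> Prop) :
  (forall v, W v <-> W' v) -> Res p t deg W -> Res p t deg W'.
Proof.
move=> WW'; case: p => [|p] /= [h1]; first by move=> h2 h3; split=> // v; rewrite -WW'.
move=> [b1 [deg1 [d [hd im rs]]]]; split=> //; exists b1, deg1, d; split=> // v.
by rewrite -WW'.
Qed.

Lemma mrest_mul_hent n a b e (f g : 'R_n) : hent a b f ->
  mrest (fun m => mdeg m + a == e)%N (f * g) =
  f * mrest (fun m => mdeg m + b == e)%N g.
Proof.
rewrite /hent => hf; pose q := [pred m : 'X_{1..n} | mdeg m + b == e]%N.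
have s1 : supp (fun m => mdeg m + a == e)%N (f * mrest q g).
  apply: (suppM _ hf (@mrest_supp _ _ q g)) => m1 m2 /= h1 [h2 _].
  by rewrite mdegD; move/eqP: h2 => h2; apply/eqP; lia.
have s2 : supp (fun m => ~~ (mdeg m + a == e))%N (f * mrest (predC q) g).
  apply: (suppM _ hf (@mrest_supp _ _ (predC q) g)) => m1 m2 /= h1 [h2 _].
  by rewrite mdegD; move: h2; apply: contra => /eqP; lia.
by rewrite {1}[g](mrest_split q) mulrDr mrestD (mrest_id s1) (mrest0 s2) addr0.
Qed.

(** Any lifts of the columns become homogeneous when each entry is replaced by its component of the
    prescribed degree; multiplication by the homogeneous entries of [d] commutes with this. *)
Lemma hmx_lift n p q k dp dq dk (d : 'M['R_n]_(p, q)) (A : 'M['R_n]_(p, k)) :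
  hmx dp dq d -> hmx dp dk A -> (forall j, exists w, col j A = d *m w) ->
  exists2 B : 'M['R_n]_(q, k), hmx dq dk B & A = d *m B.
Proof.
move=> hd hA /fin_all_exists[w wE].
exists (\matrix_(i, j) mrest (fun m => mdeg m + dq i == dk j)%N (w j i 0)).
  by move=> i j m; rewrite mxE => /mrest_supp[/eqP].
apply/matrixP => i j; rewrite mxE.
have -> : A i j = (d *m w j) i 0 by rewrite -wE mxE.
have -> : (d *m w j) i 0 = mrest (fun m => mdeg m + dp i == dk j)%N ((d *m w j) i 0).
  by rewrite mrest_id // -wE mxE => m /hA/eqP.
rewrite mxE mrest_sum; apply: eq_bigr => l _.
by rewrite (mrest_mul_hent _ _ (hd i l)) mxE.
Qed.

(** * Adjoining a variable: division by [y - Y] and mapping cones *)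

Section Tower.
Variable n : nat.
Local Notation y := ('X_ord_max : 'R_n.+1).
Local Notation wd := (map_mx (@mwiden n K)).

Definition Xm b (Y : 'M['R_n]_b) : 'M['R_n.+1]_b := y%:M - wd Y.

Lemma Xm_mul b (Y : 'M['R_n]_b) k (h : 'M_(b, k)) : Xm Y *m h = y *: h - wd Y *m h.
Proof. by rewrite mulmxBl mul_scalar_mx. Qed.

Lemma Xm_comm b b1 (d : 'M['R_n]_(b, b1)) Y Y1 : d *m Y1 = Y *m d ->
  wd d *m Xm Y1 = Xm Y *m wd d.
Proof.
move=> dY; rewrite Xm_mul mulmxBr -!map_mxM dY; congr (_ - _).
by rewrite mul_mx_scalar.
Qed.

(** Euclidean division by the monic linear matrix [y - Y]: the recursion rewrites [y c] as
    [(y - Y) c + Y c]. Together with uniqueness it identifies the cokernel of [y - Y] with the free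
    module over the smaller ring on which [y] acts as [Y]. *)
Lemma Xm_div b (Y : 'M['R_n]_b) (v : 'cV_b) : exists h c, v = Xm Y *m h + wd c.
Proof.
have [N vN] : exists N, forall i, (msize (v i ord0) <= N)%N.
  by exists (\max_i msize (v i ord0))%N => i; apply: (leq_bigmax i).
elim: N v vN => [|N IH] v vN.
  exists 0, 0; rewrite mulmx0 map_mx0 addr0; apply/matrixP => i j; rewrite !mxE ord1.
  by apply/eqP; rewrite -msize_poly_eq0 -leqn0.
have /fin_all_exists[a /fin_all_exists[b' abP]] := fun i => mwiden_last_split (v i ord0).
have [i|h [c hc]] := IH (\col_i b' i).
  have [_ _ /msize_mulX_last sb] := abP i.
  by rewrite mxE; apply: leq_trans sb _; have := vN i; lia.
exists (y *: h + wd c), (\col_i a i + Y *m c).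
have vE : v = wd (\col_i a i) + y *: (\col_i b' i).
  by apply/matrixP => i j; rewrite !mxE ord1; case: (abP i).
rewrite vE hc mulmxDr map_mxD map_mxM [Xm Y *m wd c]Xm_mul scalerDr -scalemxAr.
rewrite -[RHS]addrA [X in _ = _ + X]addrACA addNr addr0 addrC addrA.
by rewrite [X in X + _ = _]addrC -addrA.
Qed.

(** The equation says [y h = Y h - c], whose right side has no higher degree in [y] than [h] when
    [h] is nonzero; so the top coefficient of [h] vanishes. *)
Lemma Xm_uniq b (Y : 'M['R_n]_b) h (c : 'cV_b) : Xm Y *m h + wd c = 0 -> h = 0 /\ c = 0.
Proof.
move=> E; suff h0 : h = 0.
  split=> //; apply/matrixP => i j; move/matrixP/(_ i j): E.
  by rewrite h0 mulmx0 add0r !mxE -[RHS](mwiden0 n K) => /inj_mwiden.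
have [N hN] : exists N, forall i, supp (fun m => m ord_max < N)%N (h i 0).
  exists (\max_i msize (h i ord0))%N => i m mh; apply: (@leq_trans (msize (h i ord0))).
    apply: leq_ltn_trans (msize_mdeg_lt mh).
    by rewrite mdegE (bigD1 ord_max) //= leq_addr.
  exact: (leq_bigmax i).
elim: N hN => [|N IH] hN.
  apply/matrixP => i j; rewrite ord1 mxE; apply: supp_False; exact: supp_sub (hN i).
apply: IH => i.
pose q k := [pred m : 'X_{1..n.+1} | m ord_max == k].
suff : mrest (q N) (h i 0) = 0.
  move=> h0 m mh; have := hN i m mh; rewrite ltnS leq_eqVlt => /orP[mN|//].
  move/mpolyP/(_ m): h0; rewrite mcoeff_mrest mcoeff0 /= mN => m0.
  by move: mh; rewrite mcoeff_msupp m0 eqxx.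
apply: (mulX_inj (mu := U_(ord_max)%MM)); rewrite mulr0.
have Eq : y * h i 0 = (wd Y *m h) i 0 - mwiden (c i 0).
  move/matrixP/(_ i 0): E; rewrite Xm_mul !mxE => /eqP.
  by rewrite -addrA addr_eq0 opprD opprK => /eqP.
transitivity (mrest (q N.+1) (y * h i 0)).
  have s1 : supp (fun m => q N.+1 m) (y * mrest (q N) (h i 0)).
    apply/(supp_mulX (fun m => q N.+1 m)) => m /mrest_supp[/=].
    by rewrite mnmDE mnm1E eqxx add1n eqSS.
  have s2 : supp (fun m => ~~ q N.+1 m) (y * mrest (predC (q N)) (h i 0)).
    apply/(supp_mulX (fun m => ~~ q N.+1 m)) => m /mrest_supp[/=].
    by rewrite mnmDE mnm1E eqxx add1n eqSS.
  by rewrite {2}[h i 0](mrest_split (q N)) mulrDr mrestD (mrest_id s1) (mrest0 s2) addr0.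
rewrite Eq mrest0 //.
have lastw (p : 'R_n) : supp (fun m => m ord_max = 0%N) (mwiden p).
  by apply: supp_mwiden => m _; rewrite mnmwiden_ordmax.
apply: (supp_sub (Q := fun m => m ord_max <= N)%N) => [m /=|]; first by case: eqP => // ->; rewrite ltnn.
apply: suppB; last by apply: supp_sub (lastw _) => m ->.
rewrite mxE; apply: supp_sum => k _; rewrite mxE.
apply: (suppM _ (lastw _) (hN k)) => m1 m2 m1E; rewrite mnmDE m1E; lia.
Qed.

Definition degsum b1 b2 (d1 : 'I_b1 -> nat) (d2 : 'I_b2 -> nat) (i : 'I_(b1 + b2)) :=
  match split i with inl i => d1 i | inr i => d2 i end.

Lemma hmx_row N b b1 b2 (deg : 'I_b -> nat) (d1 : 'I_b1 -> nat) (d2 : 'I_b2 -> nat)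
  (A : 'M['R_N]_(b, b1)) B :
  hmx deg d1 A -> hmx deg d2 B -> hmx deg (degsum d1 d2) (row_mx A B).
Proof.
move=> hA hB i j; rewrite /degsum mxE; case: (split j) => k; [exact: hA|exact: hB].
Qed.

Lemma hmx_col N b b1 b2 (deg : 'I_b -> nat) (d1 : 'I_b1 -> nat) (d2 : 'I_b2 -> nat)
  (A : 'M['R_N]_(b1, b)) B :
  hmx d1 deg A -> hmx d2 deg B -> hmx (degsum d1 d2) deg (col_mx A B).
Proof.
move=> hA hB i j; rewrite /degsum mxE; case: (split i) => k; [exact: hA|exact: hB].
Qed.

Lemma hmx_wd b b1 (deg : 'I_b -> nat) (deg1 : 'I_b1 -> nat) (A : 'M['R_n]_(b, b1)) :
  hmx deg deg1 A -> hmx deg deg1 (wd A).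
Proof.
move=> hA i j; rewrite mxE; apply: supp_mwiden.
by apply: supp_sub (hA i j) => m; rewrite mdeg_mnmwiden.
Qed.

Lemma hmxN N b b1 (deg : 'I_b -> nat) (deg1 : 'I_b1 -> nat) (A : 'M['R_N]_(b, b1)) :
  hmx deg deg1 A -> hmx deg deg1 (- A).
Proof. by move=> hA i j; rewrite mxE; apply: suppN; apply: hA. Qed.

Lemma hmx0 N b b1 (deg : 'I_b -> nat) (deg1 : 'I_b1 -> nat) :
  hmx deg deg1 (0 : 'M['R_N]_(b, b1)).
Proof. by move=> i j; rewrite mxE; apply: supp0. Qed.

Lemma hmxM N b b1 b2 (deg : 'I_b -> nat) (deg1 : 'I_b1 -> nat) (deg2 : 'I_b2 -> nat)
  (A : 'M['R_N]_(b, b1)) B :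
  hmx deg deg1 A -> hmx deg1 deg2 B -> hmx deg deg2 (A *m B).
Proof.
move=> hA hB i j; rewrite mxE; apply: supp_sum => k _.
by apply: (suppM _ (hA i k) (hB k j)) => m1 m2; rewrite mdegD; lia.
Qed.

Lemma hmx_Xm b (deg : 'I_b -> nat) Y : hmx deg (S \o deg) Y -> hmx deg (S \o deg) (Xm Y).
Proof.
move=> hY i j; rewrite !mxE; apply: suppB; last first.
  by have h : hmx _ _ (wd Y) := hmx_wd hY; have := h i j; rewrite mxE.
case: eqP => [->|_]; last by rewrite mulr0n; apply: supp0.
by rewrite mulr1n; apply: suppX; rewrite mdeg1.
Qed.

(** Divide [f] by [y - Y1]. As [d (y - Y1) = (y - Y) d], the relation becomes
    [(y - Y)(d h + g) + d c = 0], and uniqueness of division splits it. *)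
Lemma cone_split b b1 (d : 'M['R_n]_(b, b1)) Y Y1
  (f : 'cV_b1) (g : 'cV_b) : d *m Y1 = Y *m d ->
  wd d *m f + Xm Y *m g = 0 ->
  exists h c, [/\ f = Xm Y1 *m h + wd c, g = - (wd d *m h) & d *m c = 0].
Proof.
move=> dY E; have [h [c fE]] := Xm_div Y1 f.
have : Xm Y *m (wd d *m h + g) + wd (d *m c) = 0.
  rewrite -[RHS]E fE !mulmxDr map_mxM !mulmxA (Xm_comm dY).
  by rewrite -!addrA; congr (_ + _); rewrite addrC.
case/Xm_uniq => /eqP; rewrite addrC addr_eq0 => /eqP gE dc.
by exists h, c.
Qed.

(** The tail of the mapping cone of [y - Y], stated for the kernel of a differential so that the
    induction can move along the resolution. The shifted copy [S \o deg] accounts for the degree 1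
    of [y - Y]; the last module of the cone is the shifted last module, so the increased bound is
    again attained. *)
Lemma cone_res p t b b1 (deg : 'I_b -> nat) (deg1 : 'I_b1 -> nat) d Y Y1 :
  hmx deg deg1 d -> hmx deg (S \o deg) Y -> hmx deg1 (S \o deg1) Y1 ->
  d *m Y1 = Y *m d -> (forall i, deg i <= t)%N ->
  Res p t.+1 deg1 (fun w : 'cV['R_n]_b1 => d *m w = 0) ->
  Res p.+1 t.+1 (degsum deg1 (S \o deg))
    (fun u : 'cV['R_n.+1]_(b1 + b) => row_mx (wd d) (Xm Y) *m u = 0).
Proof.
elim: p t b b1 deg deg1 d Y Y1 => [|p IH] t b b1 deg deg1 d Y Y1 hd hY hY1 dY degt rs.
  have [le1 [i0 at1] ker0] := rs.
  split; first by move=> i; rewrite /degsum; case: (split i) => k /=; rewrite ?ltnS.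
  exists b1, (S \o deg1), (col_mx (Xm Y1) (- wd d)); split.
  - by apply: hmx_col; [apply: hmx_Xm|apply: hmxN => i j m /(hmx_wd hd) /= <-; rewrite addnS].
  - move=> v; split=> [|[w ->]]; last first.
      rewrite mulmxA mul_row_col mulmxN (Xm_comm dY) subrr; exact: mul0mx.
    rewrite -[v]vsubmxK mul_row_col => /(cone_split dY)[h [c [-> -> /ker0 ->]]].
    by exists h; rewrite map_mx0 addr0 mul_col_mx mulNmx.
  - split=> [i /=|/=|w]; rewrite ?ltnS //; first by exists i0; rewrite at1.
    split=> [|->]; last exact: mulmx0.
    rewrite mul_col_mx -[0 in X in X -> _]col_mx0 => /eq_col_mx[E _].
    by have [|//] := @Xm_uniq _ Y1 w 0; rewrite E map_mx0 addr0.
have [le1 [b2 [deg2 [d1 [hd1 im1 rs1]]]]] := rs.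
(* The action is lifted one step further: [d Y1 d1 = Y d d1 = 0], so the columns of [Y1 d1] lie in
   the kernel of [d], which is the image of [d1]. *)
have [Y2 hY2 dY1] : exists2 Y2 : 'M['R_n]_b2, hmx deg2 (S \o deg2) Y2 & Y1 *m d1 = d1 *m Y2.
  apply: (hmx_lift hd1) => [i j m|j].
    have hY1' : hmx (S \o deg1) (S \o deg2) d1 by move=> k l m' /hd1 /= <-; rewrite addnS.
    exact: (hmxM hY1 hY1').
  apply/im1; rewrite colE !mulmxA dY -!mulmxA -colE.
  have -> : d *m col j d1 = 0 by apply/im1; exists (delta_mx j 0); rewrite colE.
  exact: mulmx0.
have dd1 : d *m d1 = 0.
  apply/matrixP => i j; have /matrixP/(_ i 0) : d *m col j d1 = 0.
    by apply/im1; exists (delta_mx j 0); rewrite colE.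
  by rewrite colE mulmxA -colE !mxE.
split; first by move=> i; rewrite /degsum; case: (split i) => k /=; rewrite ?ltnS.
exists (b2 + b1)%N, (degsum deg2 (S \o deg1)), (block_mx (wd d1) (Xm Y1) 0 (- wd d)).
split.
- rewrite /block_mx; apply: hmx_col; apply: hmx_row.
  + exact: hmx_wd.
  + exact: hmx_Xm.
  + exact: hmx0.
  + by apply: hmxN => i j m /(hmx_wd hd) /= <-; rewrite addnS.
- move=> v; split=> [|[w ->]]; last first.
    rewrite -[w]vsubmxK mul_block_col mul_row_col mul0mx add0r !mulmxDr !mulmxA.
    by rewrite -map_mxM dd1 map_mx0 mul0mx add0r (Xm_comm dY) mulmxN mulNmx subrr.
  rewrite -[v]vsubmxK mul_row_col => /(cone_split dY)[h [c [-> -> /im1[e ->]]]].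
  exists (col_mx (wd e) h); rewrite mul_block_col mul0mx add0r mulNmx map_mxM.
  by rewrite addrC.
apply: Res_ext (IH _ _ _ _ _ _ _ _ hd1 hY1 hY2 _ le1 rs1) => // w.
rewrite -[w]vsubmxK mul_row_col mul_block_col mul0mx add0r; set f := usubmx w; set h := dsubmx w.
split=> [E|]; last by rewrite -[0 in X in X -> _]col_mx0 => /eq_col_mx[].
have : Xm Y *m (wd d *m h) + wd 0 = 0 :> 'cV_b.
  rewrite map_mx0 addr0 mulmxA -(Xm_comm dY) -mulmxA.
  move/eqP: E; rewrite addrC addr_eq0 => /eqP ->.
  by rewrite mulmxN mulmxA -map_mxM dd1 map_mx0 mul0mx oppr0.
by move/Xm_uniq=> [dh _]; rewrite E mulNmx dh oppr0 col_mx0.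
Qed.

(** The new submodule presents the same quotient of F_0 by [W], now with [y] acting through [Y]. The
    length grows by one while [t] stays the same. *)
Lemma tower_res p t b (deg : 'I_b -> nat) (W : 'cV['R_n]_b -> Prop) Y :
  hmx deg (S \o deg) Y -> (forall v, W v -> W (Y *m v)) ->
  Res p t deg W ->
  Res p.+1 t deg (fun u : 'cV['R_n.+1]_b => exists h c, W c /\ u = Xm Y *m h + wd c).
Proof.
move=> hY WY; case: p => [[le [i0 at0] W0]|p [le [b1 [deg1 [d [hd im rs]]]]]].
  split=> //; exists b, (S \o deg), (Xm Y); split; first exact: hmx_Xm.
    move=> v; split=> [[h [c [/W0 -> ->]]]|[w ->]].
      by exists h; rewrite map_mx0 addr0.
    by exists w, 0; rewrite map_mx0 addr0; split=> //; apply/W0.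
  split=> [i|/=|w]; first by rewrite /= ltnS.
    by exists i0; rewrite at0.
  split=> [E|->]; last exact: mulmx0.
  by have [|//] := @Xm_uniq _ Y w 0; rewrite E map_mx0 addr0.
have [Y1 hY1 dY] : exists2 Y1 : 'M['R_n]_b1, hmx deg1 (S \o deg1) Y1 & Y *m d = d *m Y1.
  apply: (hmx_lift hd) => [i j m|j].
    have hd' : hmx (S \o deg) (S \o deg1) d by move=> k l m' /hd /= <-; rewrite addnS.
    exact: (hmxM hY hd').
  apply/im; rewrite colE -mulmxA; apply: WY; apply/im.
  by exists (delta_mx j 0).
split=> //; exists (b1 + b)%N, (degsum deg1 (S \o deg)), (row_mx (wd d) (Xm Y)); split.
- by apply: hmx_row; [apply: hmx_wd|apply: hmx_Xm].
- move=> v; split=> [[h [c [/im[e ->] ->]]]|[w ->]].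
    by exists (col_mx (wd e) h); rewrite mul_row_col map_mxM addrC.
  rewrite -[w]vsubmxK mul_row_col; set e := usubmx w; set g := dsubmx w.
  have [h [c ->]] := Xm_div Y1 e.
  exists (wd d *m h + g), (d *m c); split; first by apply/im; exists c.
  rewrite !mulmxDr map_mxM !mulmxA (Xm_comm (esym dY)) -!addrA; congr (_ + _).
  by rewrite addrC.
- exact: cone_res hd hY hY1 (esym dY) le rs.
Qed.

End Tower.
End Resolutions.

(** * Cancellation of unit entries and minimal resolutions *)

Section Minimize.
Variables (K : fieldType) (n : nat).
Local Notation R := {mpoly K[n]}.

Definition ins b (y : 'I_b.+1) (w : 'cV[R]_b) : 'cV[R]_b.+1 :=
  \col_i (if unlift y i is Some j then w j 0 else 0).

Lemma ins_at b (y : 'I_b.+1) w : ins y w y 0 = 0.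
Proof. by rewrite mxE unlift_none. Qed.

Lemma ins_lift b (y : 'I_b.+1) w j : ins y w (lift y j) 0 = w j 0.
Proof. by rewrite mxE liftK. Qed.

Lemma row'_ins b (y : 'I_b.+1) w : row' y (ins y w) = w.
Proof. by apply/matrixP => i j; rewrite mxE ord1 ins_lift. Qed.

Lemma ins_row' b (y : 'I_b.+1) (v : 'cV_b.+1) : v y 0 = 0 -> ins y (row' y v) = v.
Proof.
move=> v0; apply/matrixP => i j; rewrite ord1; case: (unliftP y i) => [k|] ->.
  by rewrite ins_lift mxE.
by rewrite ins_at v0.
Qed.

Lemma mulmx_col' a b (A : 'M[R]_(a, b.+1)) (w : 'cV_b.+1) l :
  A *m w = w l 0 *: col l A + col' l A *m row' l w.
Proof.
apply/matrixP => i j; rewrite !mxE ord1 (bigD1_ord l) //= mulrC; congr (_ + _).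
by apply: eq_bigr => k _; rewrite !mxE.
Qed.

Section Cancel.
Variables (b b1 : nat) (d : 'M[R]_(b.+1, b1.+1)) (y : 'I_b.+1) (l : 'I_b1.+1) (u : K).
Hypotheses (u0 : u != 0) (dyl : d y l = u%:MP).

(** The Schur complement of the unit entry [u]: the differential that remains once row [y] and
    column [l] are eliminated. *)
Definition schur : 'M[R]_(b, b1) :=
  row' y (col' l d) - (u^-1)%:MP *: (row' y (col l d) *m row y (col' l d)).

Let uK : (u^-1)%:MP * u%:MP = 1 :> R.
Proof. by rewrite -mpolyCM mulVf. Qed.

Lemma schur_row (w : 'cV_b1.+1) : (d *m w) y 0 = u%:MP * w l 0 + (row y (col' l d) *m row' l w) 0 0.
Proof.
rewrite (mulmx_col' d w l) !mxE dyl mulrC; congr (_ + _).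
by apply: eq_bigr => k _; rewrite !mxE.
Qed.

Lemma schur_mul (w : 'cV_b1.+1) : (d *m w) y 0 = 0 -> schur *m row' l w = row' y (d *m w).
Proof.
rewrite schur_row => /eqP; rewrite addr_eq0 => /eqP E.
have wl : w l 0 = - ((u^-1)%:MP * (row y (col' l d) *m row' l w) 0 0).
  by rewrite -[LHS]mul1r -uK -mulrA E mulrN.
rewrite mulmxBl -scalemxAl -mulmxA [row y _ *m _]mx11_scalar mul_mx_scalar scalerA.
rewrite (mulmx_col' d w l) wl.
apply/matrixP => i j; rewrite !mxE.
under [X in _ = _ + X]eq_bigr do rewrite !mxE.
under [X in X - _ = _]eq_bigr do rewrite !mxE.
by rewrite mulNr addrC.
Qed.

Lemma schur_exists (w' : 'cV_b1) : exists2 w, row' l w = w' & (d *m w) y 0 = 0.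
Proof.
pose c := - ((u^-1)%:MP * (row y (col' l d) *m w') 0 0).
pose w := ins l w' + c *: delta_mx l 0.
have wE : row' l w = w'.
  apply/matrixP => i j; rewrite !mxE liftK ord1 eq_sym (negbTE (neq_lift _ _)).
  by rewrite mulr0 addr0.
exists w => //; rewrite schur_row wE !mxE unlift_none !eqxx add0r mulr1 /c mulrN.
by rewrite mulrA [u%:MP * _]mulrC uK mul1r !mxE addNr.
Qed.

Lemma schur_inj (w : 'cV_b1.+1) : (d *m w) y 0 = 0 -> row' l w = 0 -> w = 0.
Proof.
rewrite schur_row => + w0; rewrite w0 mulmx0 !mxE addr0 => /eqP.
rewrite mulf_eq0 mpolyC_eq0 (negbTE u0) /= => /eqP wl.
rewrite -(ins_row' wl) w0; apply/matrixP => i j; rewrite !mxE.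
by case: unlift => // k; rewrite mxE.
Qed.

End Cancel.

Lemma hent_const a b (f : R) : hent a b f -> f@_0 != 0 ->
  a = b /\ f = (f@_0)%:MP.
Proof.
move=> hf f0; have ab : a = b.
  by have := hf 0%MM; rewrite mcoeff_msupp f0 mdeg0 => /(_ isT).
split=> //; apply/mpolyP => m; rewrite mcoeffC; case: eqP => [->|/eqP mn].
  by rewrite mulr1.
rewrite mulr0; apply/memN_msupp_eq0/negP => /hf.
by rewrite ab => /eqP; rewrite -{2}[b]add0n eqn_add2r mdeg_eq0 (negbTE mn).
Qed.

Lemma mcoeff0M (f g : R) : (f * g)@_0 = f@_0 * g@_0.
Proof.
have [mul one] := mcoeff0_is_multiplicative n K; exact: mul.
Qed.

(** A relation with nonzero constant term at [y] forces such an entry in row [y] of the first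
    differential; by homogeneity that entry is a scalar between generators of equal degree, and both
    can be eliminated. The vector [z'] is the corresponding column. *)
Lemma Res_cancel p t b (deg : 'I_b.+1 -> nat) W y z :
  Res p t deg W -> W z -> (z y 0)@_0 != 0 ->
  (exists z' u, [/\ u != 0, W z' & z' y 0 = u%:MP]) /\
  Res p t (deg \o lift y) (fun w => W (ins y w)).
Proof.
case: p => [|p]; first by case=> _ _ W0 /W0 ->; rewrite mxE mcoeff0 eqxx.
case=> le [b1 [deg1 [d [hd im rs]]]] /im[w ->] z0.
have [l dl] : exists l, (d y l)@_0 != 0.
  apply/existsP; apply: contraNT z0; rewrite negb_exists => /forallP dl.
  rewrite mxE raddf_sum /= big1 // => l _.
  by rewrite mcoeff0M; have := dl l; rewrite negbK => /eqP ->; rewrite mul0r.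
case: b1 deg1 d hd im rs w z0 l dl => [|b1] deg1 d hd im rs w z0 l dl; first by have := ltn_ord l.
have [dy dE] := hent_const (hd y l) dl; set u := _@_0 in dl dE.
split.
  exists (col l d), u; split=> //; last by rewrite mxE dE.
  by apply/im; exists (delta_mx l 0); rewrite colE.
split=> [i|]; first exact: le.
exists b1, (deg1 \o lift l), (schur d y l u); split.
- move=> i j; rewrite !mxE big_ord1 !mxE; apply: suppB; first exact: hd.
  rewrite mul_mpolyC; apply: suppZ.
  apply: (suppM _ (hd _ l) (hd y _)) => m1 m2 /=; rewrite mdegD; lia.
- move=> v; split=> [/im[w' vE]|[w' ->]].
    exists (row' l w'); rewrite (schur_mul dl dE) -vE ?ins_at //.
    by rewrite row'_ins.
  have [x <- xy] := schur_exists dl dE w'; apply/im; exists x.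
  by rewrite (schur_mul dl dE xy) ins_row'.
have kerE (w' : 'cV_b1) : schur d y l u *m w' = 0 <-> exists2 x, d *m x = 0 & row' l x = w'.
  split=> [E|[x dx <-]].
    have [x xw xy] := schur_exists dl dE w'; exists x => //.
    by rewrite -(ins_row' xy) -(schur_mul dl dE xy) xw E; apply/matrixP => i j;
      rewrite !mxE; case: unlift => // k; rewrite mxE.
  by rewrite (schur_mul dl dE) dx ?mxE //; apply/matrixP => i j; rewrite !mxE.
case: p rs => [|p] /=.
  case=> le1 [i0 at0] ker0; split=> [i||v]; first exact: le1.
    (* The generator of degree [t.+1] cannot be the cancelled one, since [l] has the degree of [y],
       which is at most [t]. *)
    case: (unliftP l i0) => [k kE|i0l]; first by exists k; rewrite /= -kE.
    by have := le y; rewrite dy -i0l at0 ltnn.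
  by rewrite kerE; split=> [[x /ker0 -> <-]|->]; [|exists 0; rewrite ?mulmx0 //];
    apply/matrixP => i j; rewrite !mxE.
case=> le1 [b2 [deg2 [d1 [hd1 im1 rs1]]]]; split=> [i|]; first exact: le1.
exists b2, deg2, (row' l d1).
have rowM k (v : 'M_(_, k)) : row' l d1 *m v = row' l (d1 *m v).
  apply/matrixP => i j; rewrite !mxE; apply: eq_bigr => k' _; by rewrite mxE.
split=> [i j|v|]; first by rewrite mxE; apply: hd1.
  rewrite kerE; split=> [[x /im1[z' ->] <-]|[z' ->]]; first by exists z'.
  by exists (d1 *m z'); [apply/im1; exists z'|].
apply: Res_ext rs1 => x; rewrite rowM; split=> [->|E].
  by apply/matrixP => i j; rewrite !mxE.
apply: (schur_inj dl dE _ E).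
have -> : d *m (d1 *m x) = 0 by apply/im1; exists x.
by rewrite mxE.
Qed.

(** Each cancellation lowers the rank, so the process stops. The invariant [Q] carries what must be
    remembered about the generators: the map to the preceding module in one use, their values in the
    Segre ring in the other. *)
Lemma Res_reduce p t (Q : forall b, ('I_b -> nat) -> ('cV[R]_b -> Prop) -> Prop) :
  (forall b (deg : 'I_b.+1 -> nat) W y z u, Q _ deg W -> u != 0 -> W z ->
    z y 0 = u%:MP -> Q _ (deg \o lift y) (fun w => W (ins y w))) ->
  forall b (deg : 'I_b -> nat) W, Q _ deg W -> Res p t deg W ->
  exists b' (deg' : 'I_b' -> nat) W',
    [/\ Q _ deg' W', Res p t deg' W' & forall v i, W' v -> (v i 0)@_0 = 0].
Proof.
move=> Qstep; elim=> [|b IH] deg W QW rs.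
  by exists 0%N, deg, W; split=> // v [].
case: (classic (exists z y, W z /\ (z y 0)@_0 != 0)) => [[z [y [Wz zy]]]|no].
  have [[z' [u [u0 Wz' zu]]] rs'] := Res_cancel rs Wz zy.
  exact: IH (Qstep _ _ _ _ _ _ QW u0 Wz' zu) rs'.
exists b.+1, deg, W; split=> // v i Wv; apply/eqP; apply: contraT => vi.
by case: no; exists v, i.
Qed.

Fixpoint MRes (p t b : nat) (deg : 'I_b -> nat) (W : 'cV[R]_b -> Prop) : Prop :=
  if p is p'.+1 then
    (forall i, deg i <= t)%N /\
    exists b1 (deg1 : 'I_b1 -> nat) (d : 'M[R]_(b, b1)),
    [/\ hmx deg deg1 d, forall i j, (d i j)@_0 = 0,
        forall v, W v <-> exists w, v = d *m w
      & MRes p' t.+1 deg1 (fun w => d *m w = 0)]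
  else [/\ forall i, (deg i <= t)%N, exists i, deg i = t & forall v, W v <-> v = 0].

Lemma MRes_ext p t b (deg : 'I_b -> nat) (W W' : 'cV[R]_b -> Prop) :
  (forall v, W v <-> W' v) -> MRes p t deg W -> MRes p t deg W'.
Proof.
move=> WW'; case: p => [|p] /= [h1]; first by move=> h2 h3; split=> // v; rewrite -WW'.
move=> [b1 [deg1 [d [hd d0 im rs]]]]; split=> //; exists b1, deg1, d; split=> // v.
by rewrite -WW'.
Qed.

(** The invariant says that the current differential still has image [W]. Its columns therefore lie
    in [W], so its entries have no constant term. *)
Lemma Res_minimal p t b (deg : 'I_b -> nat) (W : 'cV[R]_b -> Prop) :
  Res p t deg W -> (forall v i, W v -> (v i 0)@_0 = 0) -> MRes p t deg W.
Proof.
elim: p t b deg W => [//|p IH] t b deg W [le [b1 [deg1 [d [hd im rs]]]]] W0.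
split=> //.
pose Q c (degc : 'I_c -> nat) (X : 'cV[R]_c -> Prop) := exists dc : 'M[R]_(b, c),
  [/\ hmx deg degc dc, forall v, W v <-> exists w, v = dc *m w
    & forall w, X w <-> dc *m w = 0].
have Qstep c (degc : 'I_c.+1 -> nat) X y z u : Q _ degc X -> u != 0 -> X z ->
    z y 0 = u%:MP -> Q _ (degc \o lift y) (fun w => X (ins y w)).
  case=> dc [hdc imc kc] u0 /kc dz zy.
  have dins w : col' y dc *m w = dc *m ins y w.
    by rewrite (mulmx_col' dc _ y) ins_at scale0r add0r row'_ins.
  exists (col' y dc); split=> [i j|v|w].
  - by rewrite mxE; apply: hdc.
  - rewrite imc; split=> [[w ->]|[w ->]]; last by exists (ins y w).
    exists (row' y (w - (w y 0 * (u^-1)%:MP) *: z)).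
    rewrite dins ins_row'; last first.
      by rewrite !mxE zy -mulrA -mpolyCM mulVf // mulr1 subrr.
    by rewrite mulmxBr -scalemxAr dz scaler0 subr0.
  - by rewrite kc dins.
have Q0 : Q _ deg1 (fun w => d *m w = 0) by exists d.
have [b1' [deg1' [W1 [[d' [hd' im' kd']] rs' W10]]]] := Res_reduce Qstep Q0 rs.
exists b1', deg1', d'; split=> // [i j|].
  rewrite -(W0 (d' *m delta_mx j 0) i); first by rewrite -colE mxE.
  by apply/im'; exists (delta_mx j 0).
by apply: MRes_ext (IH _ _ _ _ rs' W10).
Qed.

Definition full (b : nat) (bs : nat -> nat) (i : nat) : nat :=
  if i is j.+1 then bs j else b.

Definition fdeg (b : nat) (bs : nat -> nat) (deg : 'I_b -> nat)
  (degs : forall i, 'I_(bs i) -> nat) (i : nat) : 'I_(full b bs i) -> nat :=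
  match i with 0 => deg | j.+1 => degs j end.

Lemma MRes_seq p t b (deg : 'I_b -> nat) (W : 'cV[R]_b -> Prop) :
  MRes p t deg W ->
  exists (bs : nat -> nat) (degs : forall i, 'I_(bs i) -> nat)
    (M : forall i, 'M[R]_(full b bs i, full b bs i.+1)),
  [/\ forall i, (p <= i)%N -> bs i = 0%N,
      forall i, hmx (fdeg deg degs (i := i)) (fdeg deg degs (i := i.+1)) (M i) /\
        forall k l, (M i k l)@_0 = 0,
      forall u, W u <-> exists v, u = M 0%N *m v,
      forall i (v : 'cV_(full b bs i.+1)), M i *m v = 0 <-> exists w, v = M i.+1 *m w
    & (forall i l, fdeg deg degs (i := i) l <= t + i)%N /\
      exists l, fdeg deg degs (i := p) l = (t + p)%N].
Proof.
elim: p t b deg W => [|p IH] t b deg W /=.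
  case=> le [i0 at0] W0; exists (fun=> 0%N), (fun=> fun=> 0%N), (fun=> 0).
  split=> // [i|u|i v|].
  - split=> [k l|k l]; last by rewrite mxE mcoeff0.
    by rewrite mxE; apply: supp0.
  - rewrite W0; split=> [->|[v ->]]; last exact: mul0mx.
    by exists 0; rewrite mul0mx.
  - rewrite mul0mx; split=> // _; exists 0; rewrite mul0mx.
    by apply/matrixP => -[].
  - by split=> [[|i]|]; [move=> l; rewrite addn0; apply: le|case|exists i0; rewrite addn0].
case=> le [b1 [deg1 [d [hd d0 im rs]]]].
have [bs [degs [M [fin hM imM ex [leM atM]]]]] := IH _ _ _ _ rs.
exists (full b1 bs), (fdeg deg1 degs), (fun i => match i return
  'M[R]_(full b (full b1 bs) i, full b (full b1 bs) i.+1) with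
  0 => d | j.+1 => M j end).
split.
- by case=> // i; rewrite ltnS; apply: fin.
- by case=> [|i]; [split|apply: hM].
- exact: im.
- by case=> [|i] v; [apply: imM|apply: ex].
- split; first by case=> [|i] l; [rewrite addn0; apply: le|rewrite addnS -addSn; apply: leM].
  by case: atM => l lE; exists l; rewrite lE addnS addSn.
Qed.

End Minimize.

(** * Ideals and kernels of monomial maps *)

Section Ideals.
Variables (K : fieldType) (N : nat).
Local Notation R := {mpoly K[N]}.
Implicit Types (G : R -> Prop) (p q : R).

Lemma in_ideal_gen G p : G p -> in_ideal G p.
Proof.
move=> Gp; exists [:: (1, p)]; split=> [x|]; first by rewrite inE => /eqP ->.
by rewrite big_seq1 mul1r.
Qed.

Lemma in_ideal0 G : in_ideal G 0.
Proof. by exists [::]; rewrite big_nil. Qed.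

Lemma in_idealD G p q : in_ideal G p -> in_ideal G q -> in_ideal G (p + q).
Proof.
move=> [s [Gs ->]] [t [Gt ->]]; exists (s ++ t); rewrite big_cat; split=> // x.
by rewrite mem_cat => /orP[/Gs|/Gt].
Qed.

Lemma in_idealM G p q : in_ideal G q -> in_ideal G (p * q).
Proof.
move=> [s [Gs ->]]; exists [seq (p * x.1, x.2) | x <- s]; split.
  by move=> _ /mapP[x /Gs Gx ->].
by rewrite big_map mulr_sumr; apply: eq_bigr => x _; rewrite mulrA.
Qed.

Lemma in_idealZ G c q : in_ideal G q -> in_ideal G (c *: q).
Proof. by rewrite -mul_mpolyC; apply: in_idealM. Qed.

Lemma in_idealN G q : in_ideal G q -> in_ideal G (- q).
Proof. by rewrite -mulN1r; apply: in_idealM. Qed.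

Lemma in_ideal_sum G (I : Type) (r : seq I) (P : pred I) (F : I -> R) :
  (forall i, P i -> in_ideal G (F i)) -> in_ideal G (\sum_(i <- r | P i) F i).
Proof. by move=> GF; apply: big_ind => //; [exact: in_ideal0|exact: in_idealD]. Qed.

Lemma in_ideal_min G (J : R -> Prop) : J 0 -> (forall p q, J p -> J q -> J (p + q)) ->
  (forall p q, J q -> J (p * q)) -> (forall p, G p -> J p) ->
  forall p, in_ideal G p -> J p.
Proof.
move=> J0 JD JM GJ p [s [Gs ->]]; rewrite big_seq; apply: big_ind => // x xs.
exact/JM/GJ/Gs.
Qed.

Definition icong G p q := in_ideal G (p - q).

Lemma icong_refl G p : icong G p p.
Proof. by rewrite /icong subrr; apply: in_ideal0. Qed.

Lemma icong_sym G p q : icong G p q -> icong G q p.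
Proof. by move=> /in_idealN; rewrite opprB. Qed.

Lemma icong_trans G p q s : icong G p q -> icong G q s -> icong G p s.
Proof. by move=> pq qs; have := in_idealD pq qs; rewrite addrA subrK. Qed.

Lemma icongM G p q s : icong G p q -> icong G (s * p) (s * q).
Proof. by rewrite /icong -mulrBr; apply: in_idealM. Qed.

End Ideals.

(** Replace each monomial of [f] by the first monomial [rep] of [f] with the same image. The
    replaced sum is zero, because its coefficients are those of the image of [f]; so [f] is a
    combination of differences of monomials with equal image. *)
Lemma toric_kernel (K : fieldType) (N k : nat) (xm : 'I_N -> 'X_{1..k}) G
  (Phi : 'X_{1..N} -> 'X_{1..k}) :
  (forall m, psub (fun v => 'X_[xm v] : {mpoly K[k]}) 'X_[m] = 'X_[Phi m]) ->
  (forall m m', Phi m = Phi m' -> icong G ('X_[m] : {mpoly K[N]}) 'X_[m']) ->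
  forall f, psub (fun v => 'X_[xm v]) f = 0 -> in_ideal G f.
Proof.
move=> phiX PhiG f f0.
pose rep e := nth 0%MM (msupp f) (find (fun m => Phi m == e) (msupp f)).
have repP m : m \in msupp f -> Phi (rep (Phi m)) = Phi m.
  by move=> mf; apply/eqP/(nth_find _ (a := fun m' => Phi m' == Phi m))/hasP; exists m.
pose E := undup [seq Phi m | m <- msupp f].
have part (V : nmodType) (F : 'X_{1..N} -> V) : \sum_(m <- msupp f) F m =
    \sum_(e <- E) \sum_(m <- msupp f | Phi m == e) F m.
  rewrite (exchange_big_dep predT) //= big_seq [RHS]big_seq; apply: eq_bigr => m mf.
  rewrite (eq_bigl (pred1 (Phi m))) => [|e]; last by rewrite /= eq_sym.
  by rewrite -big_filter filter_pred1_uniq ?undup_uniq ?mem_undup ?map_f ?big_seq1.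
have z0 : \sum_(m <- msupp f) f@_m *: ('X_[rep (Phi m)] : {mpoly K[N]}) = 0.
  rewrite part big1 // => e _.
  have -> : \sum_(m <- msupp f | Phi m == e) f@_m *: 'X_[rep (Phi m)] =
      (psub (fun v => 'X_[xm v]) f)@_e *: ('X_[rep e] : {mpoly K[N]}).
    have -> : psub (fun v => 'X_[xm v]) f = \sum_(m <- msupp f) f@_m *: 'X_[Phi m].
      by rewrite {1}[f]mpolyE raddf_sum /=; apply: eq_bigr => m _; rewrite psubZ phiX.
    rewrite raddf_sum /= scaler_suml [LHS]big_mkcond /=.
    apply: eq_bigr => m _; rewrite mcoeffZ mcoeffX.
    by case: eqP => [->|_]; rewrite ?mulr1 // mulr0 scale0r.
  by rewrite f0 mcoeff0 scale0r.
rewrite -[f]subr0 -{1}z0 {1}[f]mpolyE -sumrB big_seq.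
apply: in_ideal_sum => m mf; rewrite -scalerBr; apply: in_idealZ.
by apply: PhiG; rewrite repP.
Qed.

(** * The Segre map and the Hilbert function *)

Section SortedTuples.
Variables (d n : nat).

Definition stuples : {set d.-tuple 'I_n} := 
  [set t : d.-tuple 'I_n | sorted leq (map val t)].

Lemma sort_tuple (a : 'I_d -> 'I_n) :
  exists (t : d.-tuple 'I_n) (s : 'S_d), t \in stuples /\ forall l, tnth t l = a (s l).
Proof.
pose t0 := [tuple a l | l < d]; pose t1 := sort (relpre val leq) t0.
have st1 : size t1 == d by rewrite size_sort size_tuple.
have /tuple_permP[s sE] : perm_eq (Tuple st1) t0 by rewrite /= perm_sort.
exists (Tuple st1), s; split.
  rewrite inE /= sorted_map sort_sorted // => i j; exact: leq_total.
have -> : Tuple st1 = [tuple tnth t0 (s i) | i < d] by apply: val_inj.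
by move=> l; rewrite !tnth_mktuple.
Qed.

(** The multiplicity of the letter 0 follows from the length [d]. It has to, since y_(.,0) = 1
    leaves no trace in a Segre monomial. *)
Lemma stuples_inj t t' : t \in stuples -> t' \in stuples ->
  (forall i : 'I_n, (0 < i)%N -> count_mem i t = count_mem i t') -> t = t'.
Proof.
rewrite !inE => st st' ct; apply/val_inj/(inj_map val_inj).
apply: (sorted_eq leq_trans anti_leq st st'); apply: perm_map.
have cE i : count_mem i t = count_mem i t'.
  have [i0|] := posnP i; last exact: ct.
  have sz (u : d.-tuple 'I_n) :
      (count_mem i u + \sum_(j < n | j != i) count_mem j u = d)%N.
    rewrite -(bigD1 i (P := predT) (F := fun j => count_mem j u)) //=.
    rewrite -[RHS](size_tuple u) -sum1_size.
    under eq_bigr => j _ do rewrite -sum1_count.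
    rewrite (exchange_big_dep predT) //=; apply: eq_bigr => j _.
    by rewrite (big_pred1 j) // => k; rewrite /= eq_sym.
  have ee : (\sum_(j < n | j != i) count_mem j t = \sum_(j < n | j != i) count_mem j t')%N.
    apply: eq_bigr => j ji; apply: ct; rewrite lt0n.
    by apply: contra ji => /eqP j0; apply/eqP/val_inj; rewrite /= i0 j0.
  by apply/eqP; rewrite -(eqn_add2r (\sum_(j < n | j != i) count_mem j t)) sz ee sz.
by apply/allP => i _; rewrite /= cE.
Qed.

End SortedTuples.

Lemma card_stuples d n : (0 < n)%N -> #|stuples d n| = 'C(n - 1 + d, d).
Proof. by case: n => // n _; rewrite /stuples card_sorted_tuples subn1 addnC. Qed.

Section SegreMap.
Variables (K : fieldType) (m n r : nat).
Hypotheses (hm : (0 < m)%N) (hn : (0 < n)%N) (hr : (0 < r)%N).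
Local Notation N := (nvars m n r).
Local Notation R := {mpoly K[N]}.
Local Notation I := (Imnr K m n r).
Local Notation "p =~ q" := (icong (@gensI K m n r) p q) (at level 70).

Definition szs (i : 'I_3) : nat := nth 0%N [:: m.-1; n.-1; r.-1] i.
Definition f0 : 'I_3 := @Ordinal 3 0 isT.
Definition f1 : 'I_3 := @Ordinal 3 1 isT.
Definition f2 : 'I_3 := @Ordinal 3 2 isT.
Local Notation nS := #|{: svar szs}|.
Local Notation S := {mpoly K[nS]}.
Local Notation vh := (vh szs).
Local Notation vy := (vy szs).

Definition ymn (i : 'I_3) (a : nat) : 'X_{1..nS} :=
  (if a is 0 then 0 else U_(vy i a))%MM.

Definition xmon (x : 'I_m * 'I_n * 'I_r) : 'X_{1..nS} :=
  (U_(vh) + (ymn f0 x.1.1 + (ymn f1 x.1.2 + ymn f2 x.2)))%MM.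

Definition xmap (v : 'I_N) : 'X_{1..nS} := xmon (enum_val v).

Local Notation phi := (psub (fun v => 'X_[xmap v] : S)).

Definition Phi (mm : 'X_{1..N}) : 'X_{1..nS} := (\sum_v xmap v *+ mm v)%MM.

Lemma phiX mm : phi 'X_[mm] = 'X_[Phi mm].
Proof.
rewrite mmapX /mmap1 /Phi -mprodXE; apply: eq_bigr => v _.
by rewrite mpolyXn.
Qed.

Lemma phi_xv i j k : phi (xv K i j k) = 'X_[xmon (i, j, k)].
Proof. by rewrite psubX /xmap enum_rankK. Qed.

Definition mono d (a : 'I_d -> 'I_m) (b : 'I_d -> 'I_n) (c : 'I_d -> 'I_r) : R :=
  \prod_l xv K (a l) (b l) (c l).

Lemma phi_gens p : gensI p -> phi p = 0.
Proof.
have X i1 j1 k1 i2 j2 k2 : phi (xv K i1 j1 k1 * xv K i2 j2 k2) =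
    'X_[xmon (i1, j1, k1) + xmon (i2, j2, k2)].
  by rewrite rmorphM /= !phi_xv mpolyXD.
case=> [[i1 [i2 [[j1 k1] [[j2 k2] ->]]]]|[[i1 k1] [[i2 k2] [j1 [j2 ->]]]]];
  rewrite /minor2 /Hmat /Vmat /= raddfB /= !X; apply/eqP; rewrite subr_eq0; apply/eqP;
  congr 'X_[_]; rewrite /xmon /=; apply/mnmP => v; rewrite !mnmDE; ring.
Qed.

Lemma phi_ideal p : I p -> phi p = 0.
Proof.
apply: (in_ideal_min (J := fun p => phi p = 0)) => [|p1 p2 h1 h2|p1 p2 h2|].
- exact: raddf0.
- by rewrite raddfD /= h1 h2 addr0.
- by rewrite rmorphM /= h2 mulr0.
- exact: phi_gens.
Qed.

Lemma mono_swap d (X : Type) (F : ('I_d -> X) -> R) :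
  (forall f g, f =1 g -> F f = F g) ->
  (forall f (l1 l2 : 'I_d), l1 != l2 -> F f =~ F (f \o tperm l1 l2)) ->
  forall f (s : 'S_d), F f =~ F (f \o s).
Proof.
move=> Fext Fswap f s; have [ts -> _] := prod_tpermP s.
elim: ts f => [|t ts IH] f.
  rewrite big_nil (Fext (f \o _) f) => [|l]; first exact: icong_refl.
  by rewrite /= perm1.
rewrite big_cons; move: IH; set s' := (\prod_(t <- ts) _)%g => IH.
have -> : F (f \o (tperm t.1 t.2 * s')%g) = F ((f \o s') \o tperm t.1 t.2).
  by apply: Fext => l; rewrite /= permM.
apply: icong_trans (IH f) _; case: (eqVneq t.1 t.2) => [->|tt]; last exact: Fswap.
have -> : F ((f \o s') \o tperm t.2 t.2) = F (f \o s').
  by apply: Fext => l; rewrite /= tperm1 perm1.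
exact: icong_refl.
Qed.

Lemma mono_ext d (a a' : 'I_d -> 'I_m) b b' c c' : a =1 a' -> b =1 b' -> c =1 c' ->
  mono a b c = mono a' b' c'.
Proof. by move=> aa bb cc; apply: eq_bigr => l _; rewrite aa bb cc. Qed.

Lemma mono_permc d (a : 'I_d -> 'I_m) b c (s : 'S_d) :
  mono (a \o s) (b \o s) (c \o s) = mono a b c.
Proof. by rewrite [RHS](reindex_inj (@perm_inj _ s)). Qed.

(** Exchanging the first indices of two factors changes the product by a multiple of a 2-minor of H,
    whose rows carry the first index. *)
Lemma mono_perm1 d (a : 'I_d -> 'I_m) b c (s : 'S_d) : mono a b c =~ mono (a \o s) b c.
Proof.
apply: (mono_swap (F := fun a => mono a b c)) => [f g fg|f l1 l2 l12].
  exact: mono_ext.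
have l21 : l2 != l1 by rewrite eq_sym.
rewrite /mono (bigD1 l1) //= (bigD1 l2) //= [X in _ =~ X](bigD1 l1) //=.
rewrite [X in _ =~ _ * X](bigD1 l2) //= tpermL tpermR.
set A := \prod_(_ | _) _; set B := \prod_(_ | _) _.
have -> : B = A.
  by apply: eq_bigr => l /andP[h1 h2]; rewrite tpermD // eq_sym.
rewrite !mulrA ![_ * A]mulrC; apply: icongM; apply: in_ideal_gen; left.
by exists (f l1), (f l2), (b l1, c l1), (b l2, c l2); rewrite /minor2 /Hmat /= [X in _ - X]mulrC.
Qed.

(** Here the minors of V are used, since its columns carry the second index. *)
Lemma mono_perm2 d (a : 'I_d -> 'I_m) b c (s : 'S_d) : mono a b c =~ mono a (b \o s) c.
Proof.
apply: (mono_swap (F := fun b => mono a b c)) => [f g fg|f l1 l2 l12].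
  exact: mono_ext.
have l21 : l2 != l1 by rewrite eq_sym.
rewrite /mono (bigD1 l1) //= (bigD1 l2) //= [X in _ =~ X](bigD1 l1) //=.
rewrite [X in _ =~ _ * X](bigD1 l2) //= tpermL tpermR.
set A := \prod_(_ | _) _; set B := \prod_(_ | _) _.
have -> : B = A.
  by apply: eq_bigr => l /andP[h1 h2]; rewrite tpermD // eq_sym.
rewrite !mulrA ![_ * A]mulrC; apply: icongM; apply: in_ideal_gen; right.
by exists (a l1, c l1), (a l2, c l2), (f l1), (f l2).
Qed.

Definition mono_t d (x : d.-tuple 'I_m * d.-tuple 'I_n * d.-tuple 'I_r) : R :=
  mono (tnth x.1.1) (tnth x.1.2) (tnth x.2).

Definition stri d : {set d.-tuple 'I_m * d.-tuple 'I_n * d.-tuple 'I_r} :=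
  setX (setX (stuples d m) (stuples d n)) (stuples d r).

Lemma card_stri d :
  #|stri d| = ('C(m - 1 + d, d) * 'C(n - 1 + d, d) * 'C(r - 1 + d, d))%N.
Proof. by rewrite !cardsX !card_stuples. Qed.

(** The third indices are sorted by reordering the factors, an equality in R; the minors then sort
    the first and second indices. *)
Lemma mono_sort d (a : 'I_d -> 'I_m) b c : exists2 x, x \in stri d & mono a b c =~ mono_t x.
Proof.
have [tc [sc [tcs tcE]]] := sort_tuple c.
have [ta [sa [tas taE]]] := sort_tuple (a \o sc).
have [tb [sb [tbs tbE]]] := sort_tuple (b \o sc).
exists (ta, tb, tc); first by rewrite !in_setX tas tbs tcs.
rewrite -(mono_permc a b c sc).
apply: icong_trans (mono_perm1 _ _ _ sa) _; apply: icong_trans (mono_perm2 _ _ _ sb) _.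
by rewrite /mono_t (mono_ext taE tbE tcE); apply: icong_refl.
Qed.

Lemma mpolyX_mono (mm : 'X_{1..N}) :
  exists (a : 'I_(mdeg mm) -> 'I_m) b c, 'X_[mm] = mono a b c.
Proof.
have sz : size (m2s mm) == mdeg mm by rewrite size_m2s.
pose t := Tuple sz; pose v l : 'I_m * 'I_n * 'I_r := enum_val (tnth t l).
exists (fun l => (v l).1.1), (fun l => (v l).1.2), (fun l => (v l).2).
transitivity (\prod_(u <- t) ('X_u : R)).
  rewrite -{1}[mm]s2mK /= mpolyXE_id.
  transitivity (\prod_(i < N) \prod_(u <- m2s mm | u == i) ('X_i : R)).
    apply: eq_bigr => i _; rewrite mnmE big_const_seq iter_mulr_1.
    by congr (_ ^+ _); apply: eq_count.
  rewrite (exchange_big_dep predT) //= big_tnth [RHS]big_tnth.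
  apply: eq_bigr => l _; rewrite (big_pred1 (tnth (in_tuple (m2s mm)) l)) //.
rewrite big_tuple; apply: eq_bigr => l _.
by rewrite /xv -!surjective_pairing enum_valK.
Qed.

Definition tmon d (x : d.-tuple 'I_m * d.-tuple 'I_n * d.-tuple 'I_r) : 'X_{1..nS} :=
  (\sum_l xmon (tnth x.1.1 l, tnth x.1.2 l, tnth x.2 l))%MM.

Lemma phi_mono_t d (x : d.-tuple 'I_m * d.-tuple 'I_n * d.-tuple 'I_r) :
  phi (mono_t x) = 'X_[tmon x].
Proof.
rewrite /mono_t /mono rmorph_prod /= -mprodXE; apply: eq_bigr => l _.
exact: phi_xv.
Qed.

Lemma ymn_h i a : (a <= szs i)%N -> ymn i a vh = 0%N.
Proof. by case: a => [|a] ai; rewrite ?mnm0E // mnm1E vy_neq_h. Qed.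

Lemma ymn_y i a j b : (a <= szs i)%N -> (0 < b <= szs j)%N ->
  ymn i a (vy j b) = ((i == j) && (a == b))%N.
Proof.
case: a => [|a] ai bj; last by rewrite mnm1E vy_eq.
by rewrite mnm0E; case/andP: bj => /prednK <-; rewrite andbF.
Qed.

Lemma leq_szs0 (i : 'I_m) : (i <= szs f0)%N.
Proof. by rewrite /szs /= -ltnS prednK. Qed.
Lemma leq_szs1 (i : 'I_n) : (i <= szs f1)%N.
Proof. by rewrite /szs /= -ltnS prednK. Qed.
Lemma leq_szs2 (i : 'I_r) : (i <= szs f2)%N.
Proof. by rewrite /szs /= -ltnS prednK. Qed.

Lemma xmon_h x : xmon x vh = 1%N.
Proof.
by rewrite /xmon !mnmDE mnm1E eqxx !ymn_h ?leq_szs0 ?leq_szs1 ?leq_szs2.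
Qed.

Lemma xmon_y x i b : (0 < b <= szs i)%N ->
  xmon x (vy i b) = (((f0 == i) && (x.1.1 == b :> nat)) +
    (((f1 == i) && (x.1.2 == b :> nat)) + ((f2 == i) && (x.2 == b :> nat))))%N.
Proof.
move=> bi; rewrite /xmon !mnmDE mnm1E [vh == _]eq_sym vy_neq_h //.
by rewrite !ymn_y ?leq_szs0 ?leq_szs1 ?leq_szs2.
Qed.

Lemma tmon_y0 d (x : d.-tuple 'I_m * d.-tuple 'I_n * d.-tuple 'I_r) b :
  (0 < b <= szs f0)%N -> tmon x (vy f0 b) = (\sum_l (tnth x.1.1 l == b :> nat))%N.
Proof.
by move=> bP; rewrite /tmon mnm_sumE; apply: eq_bigr => l _; rewrite xmon_y // -!val_eqE /= ?add0n ?addn0.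
Qed.

Lemma tmon_y1 d (x : d.-tuple 'I_m * d.-tuple 'I_n * d.-tuple 'I_r) b :
  (0 < b <= szs f1)%N -> tmon x (vy f1 b) = (\sum_l (tnth x.1.2 l == b :> nat))%N.
Proof.
by move=> bP; rewrite /tmon mnm_sumE; apply: eq_bigr => l _; rewrite xmon_y // -!val_eqE /= ?add0n ?addn0.
Qed.

Lemma tmon_y2 d (x : d.-tuple 'I_m * d.-tuple 'I_n * d.-tuple 'I_r) b :
  (0 < b <= szs f2)%N -> tmon x (vy f2 b) = (\sum_l (tnth x.2 l == b :> nat))%N.
Proof.
by move=> bP; rewrite /tmon mnm_sumE; apply: eq_bigr => l _; rewrite xmon_y // -!val_eqE /= ?add0n ?addn0.
Qed.

Lemma tmon_inj d : {in stri d &, injective (@tmon d)}.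
Proof.
move=> [[ta tb] tc] [[ta' tb'] tc']; rewrite !in_setX /=.
move=> /andP[/andP[sa sb] sc] /andP[/andP[sa' sb'] sc'] E.
have cnt k (t : d.-tuple 'I_k) (i : 'I_k) :
    count_mem i t = (\sum_l (tnth t l == i :> nat))%N.
  rewrite -sum1_count big_mkcond big_tuple /=; apply: eq_bigr => l _.
  by rewrite -val_eqE; case: eqP.
congr (_, _, _); apply: stuples_inj => // i i0; rewrite !cnt.
- have bi : (0 < i <= szs f0)%N by rewrite i0 leq_szs0.
  by rewrite -[LHS](tmon_y0 (ta, tb, tc) bi) -[RHS](tmon_y0 (ta', tb', tc') bi) E.
- have bi : (0 < i <= szs f1)%N by rewrite i0 leq_szs1.
  by rewrite -[LHS](tmon_y1 (ta, tb, tc) bi) -[RHS](tmon_y1 (ta', tb', tc') bi) E.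
- have bi : (0 < i <= szs f2)%N by rewrite i0 leq_szs2.
  by rewrite -[LHS](tmon_y2 (ta, tb, tc) bi) -[RHS](tmon_y2 (ta', tb', tc') bi) E.
Qed.

Lemma mpolyX_sort (mm : 'X_{1..N}) :
  exists2 x, x \in stri (mdeg mm) & 'X_[mm] =~ mono_t x.
Proof. by have [a [b [c ->]]] := mpolyX_mono mm; apply: mono_sort. Qed.

Lemma mpolyX_inj k (m1 m2 : 'X_{1..k}) : 'X_[K, m1] = 'X_[m2] -> m1 = m2.
Proof. by move/(congr1 (@msupp _ _)); rewrite !msuppX => -[]. Qed.

Lemma icong_phi p q : p =~ q -> phi p = phi q.
Proof. by move/phi_ideal; rewrite raddfB /= => /eqP; rewrite subr_eq0 => /eqP. Qed.

Lemma Phi_h mm : Phi mm vh = mdeg mm.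
Proof.
rewrite /Phi mnm_sumE mdegE; apply: eq_bigr => v _.
by rewrite mulmnE xmon_h mul1n.
Qed.

Lemma Phi_icong m1 m2 : Phi m1 = Phi m2 -> 'X_[m1] =~ 'X_[m2].
Proof.
move=> E; have := Phi_h m1; rewrite E Phi_h => dE.
have [x xs xE] := mpolyX_sort m1; have [x' xs' xE'] := mpolyX_sort m2.
move: x xs xE; rewrite -dE => x xs xE.
have := icong_phi xE; have := icong_phi xE'; rewrite !phiX !phi_mono_t E.
move=> /mpolyX_inj -> /mpolyX_inj/(tmon_inj xs' xs) xx.
by apply: icong_trans xE _; rewrite -xx; apply: icong_sym.
Qed.

Theorem ker_phi p : I p <-> phi p = 0.
Proof.
split; first exact: phi_ideal.
exact: toric_kernel phiX Phi_icong p.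
Qed.

Lemma mono_t_homog d x : is_homog d (@mono_t d x).
Proof.
apply: (supp_sub (Q := fun mm => mdeg mm = (\sum_(l < d) 1)%N)) => [mm ->|].
  by rewrite sum_nat_const card_ord muln1.
rewrite /mono_t /mono; elim/big_rec2: _ => [|l e p _ IH].
  by rewrite -mpolyX0; apply: suppX; rewrite mdeg0.
by rewrite /xv; apply/supp_mulX; apply: supp_sub IH => mm E; rewrite mdegD mdeg1 E.
Qed.

(** The sorted products span modulo I, and [phi] sends them to distinct monomials, so they form a
    basis of the degree [d] part. *)
Theorem hilb_funI d :
  hilb_fun I d ('C(m - 1 + d, d) * 'C(n - 1 + d, d) * 'C(r - 1 + d, d)).
Proof.
rewrite -card_stri; exists [tuple mono_t (enum_val i) | i < #|stri d|]; split.
  by move=> i; rewrite tnth_mktuple; apply: mono_t_homog.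
split=> [c [_ /phi_ideal]|z].
  under eq_bigr => i _ do rewrite tnth_mktuple.
  rewrite raddf_sum /=; under eq_bigr => i _ do rewrite psubZ phi_mono_t.
  move=> E i; move/mpolyP/(_ (tmon (enum_val i))): E.
  rewrite raddf_sum (bigD1 i) //= mcoeffZ mcoeffX eqxx mulr1 mcoeff0 big1 ?addr0 //.
  move=> j ji; rewrite mcoeffZ mcoeffX; case: eqP => [|_]; last by rewrite mulr0.
  by move/(tmon_inj (enum_valP j) (enum_valP i))/enum_val_inj/eqP; rewrite (negbTE ji).
pose good (z : R) := exists c : 'I_#|stri d| -> K,
  I (z - \sum_i c i *: tnth [tuple mono_t (enum_val i) | i < #|stri d|] i).
move=> hz; suff [c Ic] : good z.
  exists c; split=> //; apply: suppB; first exact: hz.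
  by apply: supp_sum => i _; rewrite tnth_mktuple; apply: suppZ; apply: mono_t_homog.
apply: (supp_ind hz) => [|p q [c Ic] [c' Ic']|k mm mmd].
- exists (fun=> 0); rewrite big1 ?subr0 => [|i _]; last by rewrite scale0r.
  exact: in_ideal0.
- exists (fun i => c i + c' i); under eq_bigr do rewrite scalerDl.
  by rewrite big_split opprD addrACA; apply: in_idealD.
have [x xs xE] := mpolyX_sort mm; move: x xs xE; rewrite mmd => x xs xE.
exists (fun i => if enum_val i == x then k else 0).
rewrite (bigD1 (enum_rank_in xs x)) //= enum_rankK_in // eqxx tnth_mktuple.
rewrite enum_rankK_in // big1 ?addr0.
  by rewrite -scalerBr; apply: in_idealZ.
move=> i ix; case: eqP => [E|_]; last by rewrite scale0r.
by case/eqP: ix; apply: enum_val_inj; rewrite enum_rankK_in.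
Qed.

End SegreMap.

(** * Number of generators and multiplicity *)

Section BinomialPolynomial.

(** The polynomial (d+1)...(d+p)/p! in d, which interpolates the binomial coefficients of the
    Hilbert function. *)
Definition binpoly (p : nat) : {poly rat} :=
  (p`!%:R)^-1 *: \prod_(a < p) ('X + (a.+1)%:R%:P).

Lemma fact_neq0 p : p`!%:R != 0 :> rat.
Proof. by rewrite pnatr_eq0 -lt0n fact_gt0. Qed.

Lemma binpoly_prod p : (\prod_(a < p) ('X + (a.+1)%:R%:P) : {poly rat}) \is monic /\
  size (\prod_(a < p) ('X + (a.+1)%:R%:P) : {poly rat}) = p.+1.
Proof.
elim: p => [|p [IHm IHs]]; first by rewrite big_ord0 monic1 size_poly1.
rewrite big_ord_recr /= monicMl // -[(p.+1)%:R%:P]opprK -polyCN monicXsubC.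
by rewrite size_Mmonic ?monicXsubC ?monic_neq0 // IHs size_XsubC addn2.
Qed.

Lemma lead_binpoly p : lead_coef (binpoly p) = (p`!%:R)^-1.
Proof. by rewrite lead_coefZ (monicP (binpoly_prod p).1) mulr1. Qed.

Lemma size_binpoly p : size (binpoly p) = p.+1.
Proof. by rewrite size_scale ?invr_eq0 ?fact_neq0 // (binpoly_prod p).2. Qed.

Lemma horner_binpoly p d : (binpoly p).[d%:R] = ('C(p + d, d))%:R.
Proof.
have E : (\prod_(a < p) ('X + (a.+1)%:R%:P) : {poly rat}).[d%:R] * d`!%:R = (p + d)`!%:R.
  elim: p => [|p IH]; first by rewrite big_ord0 hornerC mul1r.
  rewrite big_ord_recr /= hornerM hornerD hornerX hornerC mulrAC IH.
  by rewrite addSn factS mulrC natrM -natrD; congr (_%:R * _); lia.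
have E2 : ('C(p + d, d))%:R * (d`!%:R * p`!%:R) = (p + d)`!%:R :> rat.
  by rewrite -!natrM -(@bin_fact (p + d) d) ?leq_addl // addnK.
apply: (mulIf (fact_neq0 d)); apply: (mulIf (fact_neq0 p)).
rewrite -[RHS]mulrA E2 -E hornerZ -!mulrA mulrC -!mulrA mulfV ?fact_neq0 //.
by rewrite mulr1.
Qed.

End BinomialPolynomial.

(** If [h' < h], the transition matrix has a nonzero left kernel vector, which is a forbidden
    relation modulo [B]. *)
Lemma quot_dim_le (K : fieldType) (V : lmodType K) (Z B : V -> Prop) h h' :
  B 0 -> (forall u v, B u -> B v -> B (u + v)) -> (forall a v, B v -> B (a *: v)) ->
  quot_dim Z B h -> quot_dim Z B h' -> (h <= h')%N.
Proof.
move=> B0 BD BZ [s [Zs [Bs _]]] [s' [_ [_ Gs']]].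
have /fin_all_exists[c cE] := fun i => Gs' _ (Zs i).
pose C : 'M[K]_(h, h') := \matrix_(i, j) c i j.
rewrite leqNgt; apply/negP => hh.
have kn : kermx C != 0.
  rewrite -mxrank_eq0 mxrank_ker subn_eq0 -ltnNge.
  exact: leq_ltn_trans (rank_leq_col C) hh.
have /rowV0Pn[v vC vn] := kn; move: vC; rewrite sub_kermx => /eqP vC.
case/eqP: vn; apply/rowP => i; rewrite mxE.
apply: (Bs (fun i => v 0 i)).
have -> : \sum_i v 0 i *: tnth s i = \sum_i v 0 i *: (tnth s i - \sum_j c i j *: tnth s' j).
  under [RHS]eq_bigr do rewrite scalerBr; rewrite sumrB.
  suff -> : \sum_i v 0 i *: (\sum_j c i j *: tnth s' j) = 0 by rewrite subr0.
  under eq_bigr do rewrite scaler_sumr; rewrite exchange_big big1 //= => j _.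
  under eq_bigr do rewrite scalerA; rewrite -scaler_suml.
  suff -> : \sum_i v 0 i * c i j = (v *m C) 0 j by rewrite vC mxE scale0r.
  by rewrite mxE; apply: eq_bigr => k _; rewrite mxE.
by apply: big_ind => // k _; apply: BZ.
Qed.

Section Generators.
Variables (K : fieldType) (m n r : nat).
Hypotheses (hm : (0 < m)%N) (hn : (0 < n)%N) (hr : (0 < r)%N).
Local Notation N := (nvars m n r).
Local Notation R := {mpoly K[N]}.
Local Notation I := (Imnr K m n r).

Definition tmm d (x : d.-tuple 'I_m * d.-tuple 'I_n * d.-tuple 'I_r) : 'X_{1..N} :=
  (\sum_l U_(enum_rank (tnth x.1.1 l, tnth x.1.2 l, tnth x.2 l)))%MM.

Lemma mono_tE d (x : d.-tuple 'I_m * d.-tuple 'I_n * d.-tuple 'I_r) :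
  mono_t K x = 'X_[tmm x].
Proof. by rewrite /tmm -mprodXE. Qed.

Lemma tmm_inj d : {in stri m n r d &, injective (@tmm d)}.
Proof.
move=> x x' xs xs' E; apply: (tmon_inj hm hn hr xs xs').
by apply: (@mpolyX_inj K); rewrite -!phi_mono_t !mono_tE E.
Qed.

Lemma mdeg_tmm d x : mdeg (@tmm d x) = d.
Proof.
by rewrite mdeg_sum (eq_bigr (fun=> 1%N)) ?sum_nat_const ?card_ord ?muln1 // => l _; rewrite mdeg1.
Qed.

Lemma gens_binomial p : @gensI K m n r p -> exists m1 m2 : 'X_{1..N},
  [/\ mdeg m1 = 2%N, mdeg m2 = 2%N & p = 'X_[m1] - 'X_[m2]].
Proof.
have two i j : mdeg (U_(i) + U_(j) : 'X_{1..N})%MM = 2%N by rewrite mdegD !mdeg1.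
case=> [[i1 [i2 [[j1 k1] [[j2 k2] ->]]]]|[[i1 k1] [[i2 k2] [j1 [j2 ->]]]]];
  rewrite /minor2 /Hmat /Vmat /xv -!mpolyXD; do 2 eexists; split=> //; exact: two.
Qed.

Lemma ideal_mdeg p : I p -> supp (fun mm => 2 <= mdeg mm)%N p.
Proof.
apply: (in_ideal_min (J := supp (fun mm => 2 <= mdeg mm)%N)).
- exact: supp0.
- by move=> p1 p2; apply: suppD.
- move=> p1 p2 h2; apply: (suppM (Q1 := fun=> True) _ _ h2) => // m1 m2 _.
  by rewrite mdegD; lia.
- move=> q /gens_binomial[m1 [m2 [h1 h2 ->]]].
  by apply: suppB; apply: suppX; rewrite ?h1 ?h2.
Qed.

(** The ideal starts in degree 2, so there only the constant terms of multipliers count: an explicit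
    form of Nakayama's lemma. *)
Lemma mcoeff_mul2 (a q : R) mm : mdeg mm = 2%N -> supp (fun mm => 2 <= mdeg mm)%N q ->
  (a * q)@_mm = a@_0 * q@_mm.
Proof.
move=> m2 hq; rewrite {1}[a](mrest_split (pred1 0%MM)) mulrDl mcoeffD.
have -> : mrest (pred1 0%MM) a = (a@_0)%:MP.
  apply/mpolyP => m'; rewrite mcoeff_mrest mcoeffC /=.
  by case: eqP => [->|]; rewrite ?mulr1 ?mulr0.
rewrite mcoeffCM [X in _ + X]memN_msupp_eq0 ?addr0 //; apply/negP.
have : supp (fun m' => 2 < mdeg m')%N (mrest (predC (pred1 0%MM)) a * q).
  apply: (suppM _ (@mrest_supp _ _ (predC (pred1 0%MM)) a) hq) => m1 m3 /= [m1n _] m3q.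
  by rewrite mdegD; move: m1n; rewrite -mdeg_eq0; lia.
by move=> h /h; rewrite m2.
Qed.

(** There is one generator for each degree 2 monomial outside the sorted ones, namely its difference
    with its sorted form. *)
Theorem min_gensI : exists k, min_num_gens I k /\
  k%:Z = ('C(m * n * r + 1, 2))%:Z
         - ('C(m + 1, 2) * 'C(n + 1, 2) * 'C(r + 1, 2))%:Z.
Proof.
pose D2 := [seq s2m t | t : 2.-tuple 'I_N <- enum (mpoly.basis N 2)].
have D2P mm : (mm \in D2) = (mdeg mm == 2%N) by rewrite /D2 -basis_cover.
have uD2 : uniq D2 by exact: uniq_basis.
have NE : N = (m * n * r)%N by rewrite /nvars !card_prod !card_ord.
have sD2 : size D2 = 'C(m * n * r + 1, 2).
  have N0 : (0 < N)%N by rewrite NE !muln_gt0 hm hn hr.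
  rewrite -NE /D2; case: (nvars m n r) N0 => // N' _.
  by rewrite size_basis; congr 'C(_, 2); lia.
pose reps := [seq tmm x | x <- enum (stri m n r 2)].
have ureps : uniq reps.
  rewrite map_inj_in_uniq ?enum_uniq // => x x'; rewrite !mem_enum; exact: tmm_inj.
have sreps : size reps = ('C(m + 1, 2) * 'C(n + 1, 2) * 'C(r + 1, 2))%N.
  by rewrite size_map -cardE card_stri //; congr ('C(_, _) * 'C(_, _) * 'C(_, _))%N; lia.
pose NR := [seq mm <- D2 | mm \notin reps].
have uNR : uniq NR by exact: filter_uniq.
have szE : (size reps + size NR = size D2)%N.
  rewrite -size_cat; apply/perm_size; rewrite perm_sym; apply: uniq_perm => //.
    rewrite cat_uniq ureps uNR andbT /=; apply/hasPn => mm.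
    by rewrite mem_filter => /andP[].
  move=> mm; rewrite mem_cat mem_filter; case: (boolP (mm \in reps)) => //= /mapP[x _ ->].
  by rewrite D2P mdeg_tmm.
pose k := size NR; pose nr (i : 'I_k) := nth 0%MM NR i.
have nrP (i : 'I_k) : nr i \in NR by rewrite mem_nth.
have nrdeg i : mdeg (nr i) = 2%N.
  by have := nrP i; rewrite mem_filter D2P => /andP[_ /eqP].
have sortP (mm : 'X_{1..N}) : mdeg mm = 2%N -> exists2 x, x \in stri m n r 2 &
    icong (@gensI K m n r) 'X_[mm] 'X_[tmm x].
  move=> m2; have [x xs xE] := mpolyX_sort K mm.
  by move: x xs xE; rewrite m2 => x xs xE; exists x; rewrite -?mono_tE.
have /fin_all_exists2[x xs xE] := fun i => sortP (nr i) (nrdeg i).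
pose g := [tuple ('X_[nr i] - 'X_[tmm (x i)] : R) | i < k].
have gI q : q \in g -> I q.
  by case/mapP=> i _ ->; apply: xE.
have gnr (i : 'I_k) j : (tnth g i)@_(nr j) = (i == j)%:R.
  rewrite tnth_mktuple mcoeffB mcoeffX /nr nth_uniq // -val_eqE /=.
  rewrite [X in _ - X]memN_msupp_eq0 ?subr0 //; apply/negP => /mem_msuppXP E.
  by have := nrP j; rewrite mem_filter -[nr j]E map_f // mem_enum.
(* The coefficients at the unsorted monomials turn [g] into the identity matrix, whose rows are
   combinations of those of any generating family. *)
have lower k' (g' : k'.-tuple R) :
    (forall p, I p <-> in_ideal (fun q => q \in g') p) -> (k <= k')%N.
  move=> g'I; pose G : 'M[K]_(k', k) := \matrix_(t, j) (tnth g' t)@_(nr j).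
  suff /mxrankS : (1%:M <= G)%MS.
    by rewrite mxrank1 => /leq_trans; apply; apply: rank_leq_row.
  apply/row_subP => i.
  have [s [sg sE]] : in_ideal (fun q => q \in g') (tnth g i).
    by apply/g'I/gI/mem_tnth.
  have -> : row i 1%:M = \sum_(y <- s) y.1@_0 *: (\row_j (y.2)@_(nr j)).
    apply/rowP => j; rewrite !mxE -gnr sE raddf_sum summxE /= !big_seq.
    apply: eq_bigr => y ys; rewrite !mxE mcoeff_mul2 //.
    by apply: ideal_mdeg; apply/g'I/in_ideal_gen/sg.
  rewrite big_seq; apply: summx_sub => y /sg/tnthP[t ->]; apply: scalemx_sub.
  have -> : \row_j (tnth g' t)@_(nr j) = row t G by apply/rowP => j; rewrite !mxE.
  exact: row_sub.
exists k; split; last by lia.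
split; last exact: lower.
exists g => p; split; last first.
  apply: (in_ideal_min (J := I)) gI p; [exact: in_ideal0|exact: in_idealD|exact: in_idealM].
have red (mm : 'X_{1..N}) : mdeg mm = 2%N -> exists2 x, x \in stri m n r 2 &
    icong (fun q => q \in g) 'X_[mm] 'X_[tmm x].
  move=> m2; case: (boolP (mm \in reps)) => [/mapP[x' x's ->]|mr].
    by exists x'; [rewrite -mem_enum|apply: icong_refl].
  have mNR : mm \in NR by rewrite mem_filter mr D2P m2 eqxx.
  have iP : (index mm NR < k)%N by rewrite index_mem.
  exists (x (Ordinal iP)) => //; apply: in_ideal_gen.
  apply/mapP; exists (Ordinal iP); first by rewrite mem_enum.
  by rewrite /nr nth_index.
apply: in_ideal_min p; [exact: in_ideal0|exact: in_idealD|exact: in_idealM|].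
move=> p gp; have [m1 [m2 [h1 h2 pE]]] := gens_binomial gp.
have [x1 x1s c1] := red m1 h1; have [x2 x2s c2] := red m2 h2.
(* Both terms of a minor reduce through [g] to sorted monomials with the same image under [phi],
   hence to the same one. *)
suff E : x1 = x2.
  rewrite pE; apply: (icong_trans c1); rewrite E; exact: icong_sym.
apply: (tmon_inj hm hn hr x1s x2s); apply: (@mpolyX_inj K).
have gI' p1 p2 : icong (fun q => q \in g) p1 p2 -> icong (@gensI K m n r) p1 p2.
  apply: (in_ideal_min (J := I)) gI _; [exact: in_ideal0|exact: in_idealD|exact: in_idealM].
rewrite -!phi_mono_t !mono_tE; apply: icong_phi.
apply: icong_trans (icong_sym (gI' _ _ c1)) _.
apply: icong_trans (gI' _ _ c2).
by rewrite /icong -pE; apply: in_ideal_gen.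
Qed.

Theorem multiplicityI : multiplicity I
  ((m + n + r - 3)`!%:R / ((m - 1)`! * (n - 1)`! * (r - 1)`!)%:R).
Proof.
exists (binpoly (m - 1) * binpoly (n - 1) * binpoly (r - 1)); split.
  exists 0%N => d _; exists ('C(m - 1 + d, d) * 'C(n - 1 + d, d) * 'C(r - 1 + d, d))%N.
  by split; [apply: hilb_funI|rewrite !hornerM !horner_binpoly -!natrM].
have nz p : binpoly p != 0 by rewrite -size_poly_gt0 size_binpoly.
rewrite !lead_coefM !lead_binpoly !size_mul ?mulf_neq0 ?nz // !size_binpoly.
rewrite -!invfM -!natrM [RHS]mulrC; congr (_%:R * _^-1); congr (_`!); lia.
Qed.

End Generators.

(** * Krull dimension *)

(* The t^k products of powers with exponents < t live in a space of dimension
   O(t^s). *)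
Lemma mpoly_alg_dep (K : fieldType) (s k : nat) (f : 'I_k -> {mpoly K[s]}) :
  (s < k)%N -> exists2 q : {mpoly K[k]}, q != 0 & psub f q = 0.
Proof.
move=> sk; pose e := (\max_i msize (f i))%N.
have fe i : supp (fun m => forall v, m v <= e)%N (f i).
  move=> m mf v; apply: (@leq_trans (mdeg m)).
    by rewrite mdegE (bigD1 v) //= leq_addr.
  apply: leq_trans (ltnW (msize_mdeg_lt mf)) _; exact: (leq_bigmax i).
(* The images have exponents at most [k * t * e], so they lie in a space of dimension [E ^ s], at
   most ((ke+1)t)^s. This is less than t^(s+1), hence than t^k, as soon as t exceeds (ke+1)^s. *)
pose t := (((k * e).+1 ^ s).+1)%N; pose E := (k * t * e).+1.
pose A := {ffun 'I_k -> 'I_t}; pose B := {ffun 'I_s -> 'I_E}.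
pose M (a : A) : 'X_{1..k} := [multinom (a i : nat) | i < k].
pose L (b : B) : 'X_{1..s} := [multinom (b i : nat) | i < s].
have Minj : injective M.
  move=> a a' /mnmP H; apply/ffunP => i; apply: val_inj.
  by have := H i; rewrite !mnmE.
have supM (a : A) : supp (fun m => forall v, m v < E)%N (psub f 'X_[M a]).
  rewrite mmapX /mmap1.
  have : supp (fun m => forall v, m v <= \sum_(i < k) t * e)%N (\prod_(i < k) f i ^+ M a i).
    elim/big_rec2: _ => [|p u i' _ IH].
      by rewrite -mpolyX0; apply: suppX => v; rewrite mnm0E.
    have IH' : supp (fun m : 'X_{1..s} => forall v, m v <= i')%N u := IH.
    suff H : supp (fun m : 'X_{1..s} => forall v, m v <= t * e)%N (f p ^+ M a p).
      by apply: (suppM _ H IH') => m1 m2 h1 h2 v; rewrite mnmDE leq_add.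
    have H j : supp (fun m => forall v, m v <= j * e)%N (f p ^+ j).
      elim: j => [|j IHj]; first by rewrite expr0 -mpolyX0; apply: suppX => v; rewrite mnm0E.
      rewrite exprS; apply: (suppM _ (fe p) IHj) => m1 m2 h1 h2 v.
      by rewrite mnmDE mulSn leq_add.
    apply: supp_sub (H _) => m h v; apply: leq_trans (h v) _.
    by rewrite leq_mul2r mnmE ltnW ?orbT.
  apply: supp_sub => m h v; rewrite ltnS; apply: leq_trans (h v) _.
  by rewrite sum_nat_const card_ord mulnA.
pose C : 'M[K]_(#|A|, #|B|) :=
  \matrix_(i, j) (psub f 'X_[M (enum_val i)])@_(L (enum_val j)).
have lt : (#|B| < #|A|)%N.
  rewrite !card_ffun !card_ord.
  apply: (@leq_ltn_trans (((k * e).+1 * t) ^ s)%N).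
    have EE : (E <= (k * e).+1 * t)%N.
      by rewrite /E mulSn -mulnA [(t * e)%N]mulnC mulnA; lia.
    by case: (s) => // s'; rewrite leq_exp2r.
  rewrite expnMn; apply: (@leq_trans (t ^ s.+1)%N); last by rewrite leq_pexp2l.
  by rewrite expnS ltn_pmul2r ?expn_gt0.
have kn : kermx C != 0.
  rewrite -mxrank_eq0 mxrank_ker subn_eq0 -ltnNge.
  exact: leq_ltn_trans (rank_leq_col C) lt.
have /rowV0Pn[v vC vn] := kn; move: vC; rewrite sub_kermx => /eqP vC.
pose q : {mpoly K[k]} := \sum_i v 0 i *: 'X_[M (enum_val i)].
exists q.
  apply: contraNneq vn => q0; apply/eqP/rowP => i; rewrite mxE.
  move/mpolyP/(_ (M (enum_val i))): q0.
  rewrite raddf_sum (bigD1 i) //= mcoeffZ mcoeffX eqxx mulr1 mcoeff0 big1 ?addr0 //.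
  move=> j ji; rewrite mcoeffZ mcoeffX; case: eqP => [|_]; last by rewrite mulr0.
  by move/Minj/enum_val_inj/eqP; rewrite (negbTE ji).
have -> : psub f q = \sum_i v 0 i *: psub f 'X_[M (enum_val i)].
  by rewrite raddf_sum; apply: eq_bigr => i _; apply: psubZ.
apply/mpolyP => m; rewrite mcoeff0 raddf_sum /=.
under eq_bigr => i _ do rewrite mcoeffZ.
case: (boolP [forall u, m u < E]%N) => [/forallP mE|mE].
  have mL : m = L [ffun u => Ordinal (mE u)] by apply/mnmP => u; rewrite mnmE ffunE.
  move/matrixP/(_ 0 (enum_rank [ffun u => Ordinal (mE u)])): vC.
  rewrite !mxE => {2}<-; apply: eq_bigr => i _.
  by rewrite mxE enum_rankK -mL.
rewrite big1 // => i _; rewrite memN_msupp_eq0 ?mulr0 //.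
by apply: contra mE => /supM mE; apply/forallP.
Qed.

(** The chain descends. Write [q = a + x_k b]. Since [f k] lies in [Q k], the value of [a] does too,
    and [a = 0] by induction. Then primality of [Q k.+1], which does not contain [f k], puts the
    value of the smaller polynomial [b] into it. *)
Lemma prime_alg_indep (K : fieldType) (N k : nat) (Q : nat -> {mpoly K[N]} -> Prop)
  (f : nat -> {mpoly K[N]}) :
  (forall i, (i <= k)%N -> is_prime (Q i)) ->
  (forall i, (i < k)%N -> [/\ forall p, Q i.+1 p -> Q i p, Q i (f i) & ~ Q i.+1 (f i)]) ->
  forall q : {mpoly K[k]}, Q k (psub (fun i : 'I_k => f i) q) -> q = 0.
Proof.
elim: k => [|k IH] prQ step q.
  rewrite (nvar0_mpolyC q) mmapC => Qc.
  case: (eqVneq (q@_0) 0) => [->|c0]; first by rewrite mpolyC0.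
  have [[_ [_ QM]] [Q1 _]] := prQ 0%N (leqnn _); case: Q1.
  have -> : 1 = ((q@_0)^-1)%:MP * (q@_0)%:MP :> {mpoly K[N]}.
    by rewrite -mpolyCM mulVf // mpolyC1.
  exact: QM.
have [Qsub Qf Qnf] := step k (ltnSn k).
have [[_ [QD QM]] [_ Qpr]] := prQ k.+1 (leqnn _).
have [[_ [QkD QkM]] _] := prQ k (leqnSn k).
have IHk := IH (fun i ik => prQ i (leqW ik)) (fun i ik => step i (leqW ik)).
have [L qL] : exists L, (msize q <= L)%N by exists (msize q).
elim: L q qL => [|L IHL] q qL Qq.
  by apply/eqP; rewrite -msize_poly_eq0 -leqn0.
have [a [b [qE _ /msize_mulX_last sb]]] := mwiden_last_split q.
have subE : psub (fun i : 'I_k.+1 => f i) q =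
    psub (fun i : 'I_k => f i) a + f k * psub (fun i : 'I_k.+1 => f i) b.
  rewrite {1}qE raddfD /= rmorphM /= psubX psub_mwiden; congr (_ + _); exact: eq_psub.
have a0 : a = 0.
  apply: IHk; have := Qsub _ Qq; rewrite subE => Qs.
  set A := psub _ a in Qs *; set B := f k * _ in Qs.
  have -> : A = (A + B) + (-1) * B by rewrite mulN1r addrK.
  by apply: (QkD) => //; apply: (QkM); rewrite /B mulrC; apply: (QkM).
have Qb : Q k.+1 (psub (fun i : 'I_k.+1 => f i) b).
  move: Qq; rewrite subE a0 raddf0 add0r => /Qpr[] //.
have b0 : b = 0 by apply: IHL Qb; apply: leq_trans sb _; lia.
by rewrite qE a0 b0 raddf0 mulr0 addr0.
Qed.

Lemma ker_prime (K : fieldType) (N k : nat) (phi : {rmorphism {mpoly K[N]} -> {mpoly K[k]}}) :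
  is_prime (fun p => phi p = 0).
Proof.
split; first split; first exact: raddf0.
  split=> [a b a0 b0|a b b0]; first by rewrite raddfD /= a0 b0 addr0.
  by rewrite rmorphM /= b0 mulr0.
split=> [|a b]; first by rewrite rmorph1 => /eqP; rewrite oner_eq0.
by rewrite rmorphM => /eqP; rewrite mulf_eq0 => /orP[/eqP|/eqP]; [left|right].
Qed.

Section Krull.
Variables (K : fieldType) (m n r : nat).
Hypotheses (hm : (0 < m)%N) (hn : (0 < n)%N) (hr : (0 < r)%N).
Local Notation N := (nvars m n r).
Local Notation R := {mpoly K[N]}.
Local Notation I := (Imnr K m n r).
Local Notation szs := (szs m n r).
Local Notation nS := #|{: svar szs}|.
Local Notation S := {mpoly K[nS]}.
Local Notation vh := (vh szs).
Local Notation vy := (vy szs).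
Local Notation phi := (psub (fun v => 'X_[xmap v] : S)).

Lemma card_svars : nS = (m + n + r - 2)%N.
Proof. by rewrite card_svar !big_ord_recl big_ord0 /szs /=; lia. Qed.

Lemma f012 (i : 'I_3) : [\/ i = f0, i = f1 | i = f2].
Proof.
case: i => [[|[|[|i]]] lt] //; [apply: Or31|apply: Or32|apply: Or33]; exact: val_inj.
Qed.

Lemma xmon_var i a : (0 < a <= szs i)%N ->
  exists x : 'I_m * 'I_n * 'I_r, xmon x = (U_(vh) + U_(vy i a))%MM.
Proof.
case: (f012 i) => -> aP; have a0 : (0 < a)%N by case/andP: aP.
- have am : (a < m)%N by move: aP; rewrite /szs /=; lia.
  exists (Ordinal am, Ordinal hn, Ordinal hr); rewrite /xmon /=.
  by rewrite !addm0; case: (a) a0.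
- have an : (a < n)%N by move: aP; rewrite /szs /=; lia.
  exists (Ordinal hm, Ordinal an, Ordinal hr); rewrite /xmon /=.
  by rewrite add0m addm0; case: (a) a0.
- have ar : (a < r)%N by move: aP; rewrite /szs /=; lia.
  exists (Ordinal hm, Ordinal hn, Ordinal ar); rewrite /xmon /=.
  by rewrite !add0m; case: (a) a0.
Qed.

Lemma xmon_0 : exists x : 'I_m * 'I_n * 'I_r, xmon x = U_(vh)%MM.
Proof. by exists (Ordinal hm, Ordinal hn, Ordinal hr); rewrite /xmon /= !addm0. Qed.

Theorem krullI : krull_dim_quot I (m + n + r - 2).
Proof.
rewrite -card_svars; split; last first.
  case=> P [prP stP]; set k := nS in prP stP.
  have st i : (i < k.+1)%N -> exists p, P i.+1 p /\ ~ P i p by move=> /stP[].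
  have [f fP] : exists f : nat -> R, forall i, (i < k.+1)%N -> P i.+1 (f i) /\ ~ P i (f i).
    have /fin_all_exists[g gP] := fun i : 'I_k.+1 => st i (ltn_ord i).
    exists (fun i => g (inord i)) => i ik; have := gP (inord i).
    by rewrite inordK.
  (* The given chain ascends, so it is read backwards; its bottom [P 0] contains I, the kernel of
     [phi]. *)
  pose f' i := f (k - i)%N.
  have [q q0 qE] := mpoly_alg_dep (fun i : 'I_k.+1 => phi (f' i)) (ltnSn k).
  case/eqP: q0.
  apply: (@prime_alg_indep K N k.+1 (fun i => P (k.+1 - i)%N) f') => [i ik|i ik|].
  - by case: (prP (k.+1 - i)%N (leq_subr _ _)).
  - have ki : (k - i < k.+1)%N by rewrite ltnS leq_subr.
    have [sub _] := stP _ ki; have [h1 h2] := fP _ ki.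
    by rewrite subSS; rewrite subSn.
  - rewrite subnn; apply: (prP 0%N (leq0n _)).2; apply/(ker_phi hm hn hr).
    by rewrite psub_comp -[RHS]qE.
(* For a chain of full length the Segre variables are killed one at a time. [h] must come last,
   because it divides the image of every x_ijk. *)
pose vs := rcons [seq v <- enum 'I_nS | v != vh] vh.
have vsP v : v \in vs by rewrite mem_rcons in_cons mem_filter mem_enum andbT orbN.
have uvs : uniq vs by rewrite rcons_uniq mem_filter eqxx /= filter_uniq // enum_uniq.
have svs : size vs = nS.
  transitivity (size (enum 'I_nS)); last by rewrite size_enum_ord.
  apply/perm_size/uniq_perm => //; first exact: enum_uniq.
  by move=> v; rewrite vsP mem_enum.
pose z i v : S := if v \in take i vs then 0 else 'X_v.
pose P i (p : R) := psub (z i) (phi p) = 0.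
have zS i p : (i < nS)%N -> psub (z i.+1) p = psub (zv K (nth vh vs i)) (psub (z i) p).
  move=> iS; rewrite psub_comp; apply: eq_psub => v /=; rewrite /z.
  rewrite (take_nth vh) ?svs // mem_rcons in_cons orbC.
  case: (v \in take i vs) => /=; first by rewrite raddf0.
  by rewrite psubX /zv.
have phP (x : 'I_m * 'I_n * 'I_r) : phi (xv K x.1.1 x.1.2 x.2) = 'X_[xmon x].
  by rewrite phi_xv -!surjective_pairing.
have zh i : (i < nS)%N -> z i vh = 'X_vh.
  move=> iS; rewrite /z; case: ifP => //; rewrite /vs -cats1 takel_cat.
    by move/mem_take; rewrite mem_filter eqxx.
  by have := svs; rewrite size_rcons; lia.
exists P; split=> i iS.
  split; first by have := ker_prime (psub (z i) \o phi).
  by move=> p /(ker_phi hm hn hr) p0; rewrite /P p0 raddf0.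
split; first by move=> p; rewrite /P zS // => ->; rewrite raddf0.
have nz v : (v \notin take i vs) -> z i v = 'X_v by rewrite /z => /negbTE ->.
have vi : nth vh vs i \notin take i vs.
  have := uvs; rewrite -{1}(cat_take_drop i vs) cat_uniq => /and3P[_ /hasPn H _].
  by apply: H; rewrite (drop_nth vh) ?svs // mem_head.
case: (vP (nth vh vs i)) => [E|[j [a [aP E]]]].
  have [x xE] := xmon_0; exists (xv K x.1.1 x.1.2 x.2).
  rewrite /P zS // phP xE psubX zh // E psubX /zv eqxx; split=> //.
  by apply/eqP/mpolyX_neq0.
have [x xE] := xmon_var aP; exists (xv K x.1.1 x.1.2 x.2).
have zE : psub (z i) 'X_[xmon x] = 'X_vh * 'X_(vy j a).
  by rewrite xE mpolyXD rmorphM /= !psubX zh // nz -?E.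
rewrite /P zS // phP zE rmorphM /= !psubX /zv E eqxx mulr0.
by split=> // /eqP; rewrite mulf_eq0 !(negbTE (mpolyX_neq0 _ _)).
Qed.

End Krull.

(** * Resolution of an algebra by adjoining variables *)

Section AlgebraTower.
Variables (K : fieldType) (s : nat).
Local Notation S := {mpoly K[s]}.
Variables (g : nat -> S) (b : nat) (e : 'I_b -> S) (deg : 'I_b -> nat).

Local Notation ev := (psub (fun i : 'I__ => g i)).

Definition relmod n (v : 'cV[{mpoly K[n]}]_b) : Prop := \sum_i ev (v i 0) * e i = 0.

Definition acts n k (Y : 'M[{mpoly K[n]}]_b) :=
  hmx deg (succn \o deg) Y /\ forall j, g k * e j = \sum_i ev (Y i j) * e i.

Lemma ev_mwiden n (p : {mpoly K[n]}) : ev (mwiden p) = ev p.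
Proof. by rewrite psub_mwiden; apply: eq_psub. Qed.

Lemma acts_mwiden n k (Y : 'M[{mpoly K[n]}]_b) : acts k Y -> acts k (map_mx (@mwiden n K) Y).
Proof.
case=> hY eY; split; first exact: hmx_wd.
by move=> j; rewrite eY; apply: eq_bigr => i _; rewrite mxE ev_mwiden.
Qed.

Lemma acts_sum n k (Y : 'M[{mpoly K[n]}]_b) (v : 'cV_b) : acts k Y ->
  \sum_i ev ((Y *m v) i 0) * e i = g k * \sum_i ev (v i 0) * e i.
Proof.
case=> _ eY; rewrite mulr_sumr.
transitivity (\sum_j \sum_i ev (v j 0) * (ev (Y i j) * e i)).
  rewrite exchange_big; apply: eq_bigr => i _; rewrite mxE raddf_sum /= mulr_suml.
  apply: eq_bigr => j _; rewrite rmorphM /= -mulrA; exact: mulrCA.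
by apply: eq_bigr => j _; rewrite -mulr_sumr -(eY j) mulrCA.
Qed.

(** The columns of [y - Y] are relations, and division by [y - Y] reduces any relation to one
    without the new variable. *)
Lemma relmodE n (Y : 'M[{mpoly K[n]}]_b) u : acts n Y ->
  relmod u <-> exists h c, relmod c /\ u = Xm Y *m h + map_mx (@mwiden n K) c.
Proof.
move=> aY; have aY' := acts_mwiden aY.
have key (h : 'cV_b) (c : 'cV_b) : \sum_i ev ((Xm Y *m h + map_mx (@mwiden n K) c) i 0) * e i =
    \sum_i ev (c i 0) * e i.
  transitivity (\sum_i (ev ((Xm Y *m h) i 0) * e i + ev (c i 0) * e i)).
    apply: eq_bigr => i _; rewrite -mulrDl !mxE; congr (_ * _).
    by rewrite raddfD /=; congr (_ + _); apply: ev_mwiden.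
  rewrite big_split /= -[RHS]add0r; congr (_ + _).
  transitivity (\sum_i (g n * (ev (h i 0) * e i) -
      ev ((map_mx (@mwiden n K) Y *m h) i 0) * e i)).
    apply: eq_bigr => i _; rewrite Xm_mul !mxE mulrA -mulrBl; congr (_ * _).
    by rewrite raddfB /= rmorphM /= psubX.
  by rewrite sumrB -mulr_sumr (acts_sum h aY') subrr.
split=> [Wu|[h [c [Wc ->]]]]; last by rewrite /relmod key.
have [h [c uE]] := Xm_div Y u; exists h, c; split=> //.
by rewrite /relmod -(key h) -uE.
Qed.

(** The action matrices over the first [D] variables suffice: widened, they still describe the same
    actions after further variables are adjoined. *)
Lemma alg_tower t D c :
  (forall k, (D <= k < D + c)%N -> exists Y : 'M[{mpoly K[D]}]_b, acts k Y) ->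
  Res 0 t deg (@relmod D) -> Res c t deg (@relmod (D + c)%N).
Proof.
move=> HY R0.
have HY' c' k : (D <= k < D + c)%N -> exists Y : 'M[{mpoly K[(D + c')%N]}]_b, acts k Y.
  move=> kP; elim: c' => [|c' [Y aY]]; first by rewrite addn0; apply: HY.
  by rewrite addnS; exists (map_mx (@mwiden (D + c')%N K) Y); apply: acts_mwiden.
suff : forall c', (c' <= c)%N -> Res c' t deg (@relmod (D + c')%N) by apply.
elim=> [_|c' IH c'c]; first by rewrite addn0.
have [Y aY] : exists Y : 'M[{mpoly K[(D + c')%N]}]_b, acts (D + c') Y by apply: HY'; lia.
rewrite addnS; apply: Res_ext (tower_res aY.1 _ (IH (ltnW c'c))).
  by move=> v; exact: iff_sym (relmodE v aY).
by move=> v; rewrite /relmod (acts_sum v aY) => ->; rewrite mulr0.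
Qed.

End AlgebraTower.

Lemma hmx_psub (K : fieldType) n k (h : 'I_n -> {mpoly K[k]}) p q dp dq
  (A : 'M[{mpoly K[n]}]_(p, q)) :
  (forall i, supp (fun m => mdeg m = 1%N) (h i)) -> hmx dp dq A ->
  hmx dp dq (map_mx (psub h) A).
Proof.
move=> hd hA i j; rewrite mxE.
case: (leqP (dp i) (dq j)) => dd.
  have : supp (fun m => mdeg m = dq j - dp i)%N (psub h (A i j)).
    apply: (psub_supp (@mdegD _) (@mdeg0 _) hd).
    by apply: supp_sub (hA i j) => m /=; lia.
  by apply: supp_sub => m ->; rewrite subnK.
have -> : A i j = 0 by apply: supp_False; apply: supp_sub (hA i j) => m; lia.
by rewrite raddf0; apply: supp0.
Qed.

(** Used to return from the coordinates formed by the parameters and the adjoined variables to the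
    x_ijk. *)
Lemma Res_transfer (K : fieldType) n k (h : 'I_n -> {mpoly K[k]})
  (h' : 'I_k -> {mpoly K[n]}) :
  (forall i, supp (fun m => mdeg m = 1%N) (h i)) ->
  (forall p, psub h (psub h' p) = p) -> (forall p, psub h' (psub h p) = p) ->
  forall p t b (deg : 'I_b -> nat) W, Res p t deg W ->
  Res p t deg (fun v => W (map_mx (psub h') v)).
Proof.
move=> hd hh' h'h.
have mhh' a b (A : 'M[{mpoly K[k]}]_(a, b)) : map_mx (psub h) (map_mx (psub h') A) = A.
  by apply/matrixP => i j; rewrite !mxE hh'.
have mh'h a b (A : 'M[{mpoly K[n]}]_(a, b)) : map_mx (psub h') (map_mx (psub h) A) = A.
  by apply/matrixP => i j; rewrite !mxE h'h.
elim=> [|p IH] t b deg W /=.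
  case=> le at_ W0; split=> // v; rewrite W0; split=> [E|->]; last exact: map_mx0.
  by rewrite -[v]mhh' E map_mx0.
case=> le [b1 [deg1 [d [hmd im rs]]]]; split=> //.
exists b1, deg1, (map_mx (psub h) d); split.
- exact: hmx_psub.
- move=> v; rewrite im; split=> [[w E]|[w ->]].
    by exists (map_mx (psub h) w); rewrite -map_mxM -E mhh'.
  by exists (map_mx (psub h') w); rewrite map_mxM /= mh'h.
apply: Res_ext (IH _ _ _ _ rs) => w; split=> E.
  by rewrite -[w]mhh' -map_mxM E map_mx0.
by rewrite -[d]mh'h -map_mxM E map_mx0.
Qed.

(** * The image of the Segre map *)

Section Surjectivity.
Variables (K : fieldType) (m n r : nat).
Hypotheses (hm : (0 < m)%N) (hn : (0 < n)%N) (hr : (0 < r)%N).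
Local Notation T := ('I_m * 'I_n * 'I_r)%type.
Local Notation N := (nvars m n r).
Local Notation R := {mpoly K[N]}.
Local Notation szs := (szs m n r).
Local Notation nS := #|{: svar szs}|.
Local Notation S := {mpoly K[nS]}.
Local Notation vh := (vh szs).
Local Notation vy := (vy szs).
Local Notation phi := (psub (fun v => 'X_[xmap v] : S)).
Local Notation U := (segset szs (fun=> false)).

Definition comp (x : T) (i : 'I_3) : nat := nth 0%N [:: x.1.1 : nat; x.1.2 : nat; x.2 : nat] i.

Lemma comp_le x i : (comp x i <= szs i)%N.
Proof.
by case: (f012 i) => ->; [apply: leq_szs0|apply: leq_szs1|apply: leq_szs2].
Qed.

Lemma xmon_comp x i b : (0 < b <= szs i)%N -> xmon x (vy i b) = (comp x i == b).
Proof.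
move=> bi; rewrite (xmon_y hm hn hr) //.
by case: (f012 i) => ->; rewrite -!val_eqE /= ?addn0 ?add0n.
Qed.

Lemma xmon_wt (x : T) i : wt i (xmon x) = (0 < comp x i)%N.
Proof.
rewrite /wt (eq_big_nat _ _ (F2 := fun b => (comp x i == b) : nat)) => [|b bi]; last first.
  by rewrite xmon_comp.
case: posnP => c0; first by rewrite c0 big_nat big1 // => -[].
rewrite (bigD1_seq (comp x i)) ?iota_uniq ?mem_index_iota ?c0 ?ltnS ?comp_le //=.
by rewrite eqxx big1 // => b; rewrite eq_sym => /negbTE ->.
Qed.

Lemma xmon_slin (x : T) : slin szs (xmon x).
Proof.
split; first exact: xmon_h.
  by move=> i a /andP[/leq_trans h /h]; rewrite ltnn.
by move=> i; rewrite xmon_wt; case: (0 < _)%N.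
Qed.

Lemma comp_exists (a : 'I_3 -> nat) : (forall i, a i <= szs i)%N ->
  exists x : T, forall i, comp x i = a i.
Proof.
move=> aP.
have a0 : (a f0 < m)%N by have := aP f0; rewrite /szs /=; lia.
have a1 : (a f1 < n)%N by have := aP f1; rewrite /szs /=; lia.
have a2 : (a f2 < r)%N by have := aP f2; rewrite /szs /=; lia.
by exists (Ordinal a0, Ordinal a1, Ordinal a2) => i; case: (f012 i) => ->.
Qed.

Lemma PhiD m1 m2 : Phi (m1 + m2)%MM = (Phi m1 + Phi m2)%MM :> 'X_{1..nS}.
Proof. by apply: (@mpolyX_inj K); rewrite mpolyXD -!phiX mpolyXD rmorphM. Qed.

Lemma PhiU v : Phi U_(v)%MM = xmap v :> 'X_{1..nS}.
Proof. by apply: (@mpolyX_inj K); rewrite -phiX psubX. Qed.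

Lemma Phi_surj d mu : U mu -> mu vh = d -> exists mm : 'X_{1..N}, Phi mm = mu.
Proof.
elim: d mu => [|d IH] mu [inm wm] mud.
  exists 0%MM; apply: mnm_vP => [|i a aP].
    by rewrite mud Phi_h // mdeg0.
  have szi : (0 < szs i)%N by lia.
  have := wm i szi; have := wt_ge mu aP; rewrite mud.
  have := wt_ge (Phi 0%MM : 'X_{1..nS}) aP; rewrite /Phi.
  rewrite (eq_bigr (fun=> 0%MM)) => [|v _]; last by rewrite mnm0E mulm0n.
  by rewrite big1 // mnm0E; lia.
(* From each group one variable of [mu] is taken, or 1 if there is none. Removing them with one [h]
   lowers every positive weight, so the bounds survive. *)
have /fin_all_exists[a aP] : forall i : 'I_3, exists a, [/\ (a <= szs i)%N,
    (0 < a -> 0 < mu (vy i a))%N & (0 < a)%N = (0 < wt i mu)%N].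
  move=> i; have [w0|w0] := posnP (wt i mu); first by exists 0%N.
  case: (boolP (has (fun a => 0 < mu (vy i a))%N (index_iota 1 (szs i).+1))).
    move=> /hasP[a]; rewrite mem_index_iota ltnS => /andP[a0 ai] ma; exists a.
    by rewrite a0.
  move=> /hasPn H; move: w0; rewrite /wt big_seq big1 // => a /H.
  by rewrite lt0n negbK => /eqP.
have [x xE] := comp_exists (fun i => let: And3 h _ _ := aP i in h).
have xmu : (xmon x <= mu)%MM.
  apply/mnm_lepP => v; case: (vP v) => [->|[i [b [bi ->]]]].
    by rewrite xmon_h // mud.
  rewrite xmon_comp // xE; case: eqP => // ab; have [_ h _] := aP i.
  by rewrite -ab; apply: h; rewrite ab; case/andP: bi.
have mE := submKC_mnm xmu.
have muh : (mu - xmon x)%MM vh = d by rewrite mnmBE mud xmon_h // subn1.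
have [mm mmE] : exists mm : 'X_{1..N}, Phi mm = (mu - xmon x)%MM.
  apply: (IH (mu - xmon x)%MM _ muh); split=> [i b bi|i szi]; first by rewrite mnmBE inm.
  have e1 : wt i mu = (wt i (xmon x) + wt i (mu - xmon x)%MM)%N by rewrite -wtD -mE.
  have [_ _ h] := aP i.
  by have := wm i szi; move: e1; rewrite xmon_wt xE h mud muh; case: posnP; lia.
exists (U_(enum_rank x) + mm)%MM.
by rewrite PhiD PhiU mmE /xmap enum_rankK -mE.
Qed.

Lemma phi_surj d f : homU U d f -> exists2 p : R, supp (fun mm => mdeg mm = d) p & phi p = f.
Proof.
move=> hf; apply: (supp_ind (P := fun f => exists2 p : R,
  supp (fun mm => mdeg mm = d) p & phi p = f) hf) => [|f1 f2 [p1 h1 <-] [p2 h2 <-]|c mu [Umu muh]].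
- by exists 0; [apply: supp0|rewrite raddf0].
- by exists (p1 + p2); [apply: suppD|rewrite raddfD].
have [mm mmE] := Phi_surj Umu muh; exists (c *: 'X_[mm]).
  by apply: suppZ; apply: suppX; rewrite -muh -mmE Phi_h.
by rewrite psubZ phiX mmE.
Qed.

Lemma U_slin (m1 m2 : 'X_{1..nS}) : slin szs m1 -> U m2 -> U (m1 + m2)%MM.
Proof. exact: segset_stable. Qed.

Lemma U_Phi (mm : 'X_{1..N}) : U (Phi mm).
Proof.
have U0 : U 0%MM by split=> [i a _|i _]; rewrite ?mnm0E ?wt0.
rewrite /Phi; apply: (big_ind U) => // [m1 m2 [in1 w1] [in2 w2]|v _].
  split=> [i a ia|i Pi]; first by rewrite mnmDE in1 ?in2.
  by rewrite wtD mnmDE; have := w1 i Pi; have := w2 i Pi; lia.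
elim: (mm v) => [|k IH]; first by rewrite mulm0n.
by rewrite mulmS; apply: U_slin => //; apply: xmon_slin.
Qed.

Lemma phi_homU d p : supp (fun mm => mdeg mm = d) p -> homU U d (phi p).
Proof.
move=> hp; apply: (supp_ind (P := fun p => homU U d (phi p)) hp).
- by rewrite raddf0; apply: supp0.
- by move=> p1 p2; rewrite raddfD; apply: suppD.
- move=> c mm md; rewrite psubZ phiX; apply: suppZ; apply: suppX.
  by split; [apply: U_Phi|rewrite Phi_h].
Qed.

Definition rank (x : T) : nat := (x.1.1 + x.1.2 + x.2)%N.

Definition thetaR k : R := \sum_(x : T | rank x == k) 'X_(enum_rank x).

Lemma phi_thetaR k : phi (thetaR k) = theta K szs szs k.
Proof.
have polyE i l : (szs i).+1 = l -> \poly_(a < (szs i).+1) yv K szs i a =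
    \sum_(a < l) (yv K szs i a)%:P * 'X^a.
  by move=> <-; rewrite poly_def; apply: eq_bigr => a _; rewrite mul_polyC.
rewrite /theta !big_ord_recl big_ord0 mulr1.
have -> : lift ord0 (lift ord0 (ord0 : 'I_1)) = f2 by apply: val_inj.
have -> : lift ord0 (ord0 : 'I_2) = f1 by apply: val_inj.
have -> : ord0 = f0 by apply: val_inj.
rewrite (polyE f0 m) ?(polyE f1 n) ?(polyE f2 r) /szs /= ?prednK //.
rewrite mulrA big_distrlr /= pair_bigA /= big_distrlr /= pair_bigA /=.
rewrite raddf_sum coef_sum mulr_sumr big_mkcond /=; apply: eq_bigr => x _.
have yE i a : (a <= szs i)%N -> yv K szs i a = 'X_[@ymn m n r i a].
  by case: a => [|a] ai; rewrite /= ?mpolyX0.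
have -> : (yv K szs f0 x.1.1)%:P * 'X^(x.1.1) * ((yv K szs f1 x.1.2)%:P * 'X^(x.1.2)) *
    ((yv K szs f2 x.2)%:P * 'X^(x.2)) =
    (yv K szs f0 x.1.1 * (yv K szs f1 x.1.2 * yv K szs f2 x.2))%:P * 'X^(rank x).
  by rewrite /rank !exprD !polyCM; ring.
rewrite coefCM coefXn eq_sym; case: eqP => _; last by rewrite !mulr0.
rewrite mulr1 psubX /xmap enum_rankK /xmon !mpolyXD.
by rewrite !yE ?leq_szs0 ?leq_szs1 ?leq_szs2.
Qed.

Lemma sum_szs : (\sum_i szs i)%N = (m + n + r - 3)%N.
Proof. by rewrite !big_ord_recl big_ord0 /szs /=; lia. Qed.

Lemma tdeg_szs : tdeg szs (fun=> false) = (m + n + r - 2 - maxn m (maxn n r))%N.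
Proof.
rewrite /tdeg sum_szs !big_ord_recl big_ord0 /szs /= !subn0 maxn0.
have maxE : maxn m (maxn n r) = (maxn m.-1 (maxn n.-1 r.-1)).+1.
  by rewrite -[in LHS](prednK hm) -[in LHS](prednK hn) -[in LHS](prednK hr) !maxnSS.
rewrite maxE; move: (maxn _ _) (m + n + r)%N => M s.
by rewrite -!subnDA add3n add2n.
Qed.

Lemma rank_exists k : (k < m + n + r - 2)%N -> exists x : T, rank x = k.
Proof.
move=> kD.
have [a0 [b0 c0]] : [/\ minn k m.-1 < m, minn (k - m.-1) n.-1 < n
    & k - m.-1 - n.-1 < r]%N by split; lia.
by exists (Ordinal a0, Ordinal b0, Ordinal c0); rewrite /rank /=; lia.
Qed.

Lemma rank_lt x : (rank x < m + n + r - 2)%N.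
Proof.
rewrite /rank; have := ltn_ord x.1.1; have := ltn_ord x.1.2; have := ltn_ord x.2; lia.
Qed.

End Surjectivity.

(** * Regularity *)

Section Regularity.
Variables (K : fieldType) (m n r : nat).
Hypotheses (hm : (0 < m)%N) (hn : (0 < n)%N) (hr : (0 < r)%N).
Local Notation T := ('I_m * 'I_n * 'I_r)%type.
Local Notation N := (nvars m n r).
Local Notation R := {mpoly K[N]}.
Local Notation I := (Imnr K m n r).
Local Notation szs := (szs m n r).
Local Notation nS := #|{: svar szs}|.
Local Notation S := {mpoly K[nS]}.
Local Notation phi := (psub (fun v => 'X_[xmap v] : S)).
Local Notation U := (segset szs (fun=> false)).
Local Notation D := (m + n + r - 2)%N.
Local Notation rho := (m + n + r - 2 - maxn m (maxn n r))%N.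

Section Coordinates.
Variable gam : nat -> T.
Hypothesis gamP : forall k, (k < D)%N -> rank (gam k) = k.

(** One variable [gam k] per rank is traded for the parameter [thetaR k]. This is a linear change of
    coordinates: the traded variable is the parameter minus the other variables of its rank. *)
Definition offchain : seq T := [seq x <- enum {: T} | x != gam (rank x)].

Let c := size offchain.

Definition tower_elt (k : nat) : R :=
  if (k < D)%N then thetaR K m n r k else 'X_(enum_rank (nth (gam 0%N) offchain (k - D))).

Lemma mem_offchain x : (x \in offchain) = (x != gam (rank x)).
Proof. by rewrite mem_filter mem_enum andbT. Qed.

Lemma off_index_lt x : x \in offchain -> (D + index x offchain < D + c)%N.
Proof. by move=> xo; rewrite ltn_add2l index_mem. Qed.

Definition offvar (x : T) : {mpoly K[D + c]} :=
  if insub (D + index x offchain)%N is Some o then 'X_o else 0.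

Definition tower_inv (v : 'I_N) : {mpoly K[D + c]} :=
  let x := enum_val v in
  if x == gam (rank x) then
    (if insub (rank x) is Some o then 'X_o else 0) -
    \sum_(z : T | (rank z == rank x) && (z != x)) offvar z
  else offvar x.

Lemma tower_elt_homog k : supp (fun mm => mdeg mm = 1%N) (tower_elt k).
Proof.
rewrite /tower_elt; case: ifP => _; last by apply: suppX; rewrite mdeg1.
by apply: supp_sum => x _; apply: suppX; rewrite mdeg1.
Qed.

Local Notation h := (fun i : 'I_(D + c) => tower_elt i).

Lemma psub_offvar x : x \in offchain -> psub h (offvar x) = 'X_(enum_rank x).
Proof.
move=> xo; rewrite /offvar insubT ?off_index_lt // => lt.
rewrite psubX /tower_elt /= ltnNge leq_addr /= addKn nth_index //.
Qed.

Lemma gam_uniq x z : rank x = rank z -> x = gam (rank x) -> z != x -> z \in offchain.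
Proof. by move=> E xg; rewrite mem_offchain -E -xg. Qed.

Lemma towerK p : psub h (psub tower_inv p) = p.
Proof.
rewrite psub_comp -[RHS]psub_id; apply: eq_psub => v /=; rewrite /tower_inv.
set x := enum_val v; have vE : v = enum_rank x by rewrite enum_valK.
case: (eqVneq x (gam (rank x))) => [xg|xg]; last first.
  by rewrite psub_offvar ?mem_offchain // vE.
have xD : (rank x < D + c)%N by rewrite ltn_addr // rank_lt.
rewrite insubT raddfB /= psubX.
have -> : psub h (\sum_(z | (rank z == rank x) && (z != x)) offvar z) =
    \sum_(z | (rank z == rank x) && (z != x)) 'X_(enum_rank z).
  rewrite raddf_sum; apply: eq_bigr => z /andP[/eqP zx zn].
  exact: psub_offvar (gam_uniq (esym zx) xg zn).
by rewrite /tower_elt /= rank_lt // /thetaR (bigD1 x) //= vE addrK.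
Qed.

Lemma tower_invK p : psub tower_inv (psub h p) = p.
Proof.
rewrite psub_comp -[RHS]psub_id; apply: eq_psub => i /=; rewrite /tower_elt.
have offE x : x \notin [seq gam k | k <- iota 0 D] -> x \in offchain.
  move=> xn; rewrite mem_offchain; apply: contra xn => /eqP ->.
  by apply: map_f; rewrite mem_iota rank_lt.
case: ltnP => iD.
  rewrite /thetaR raddf_sum (bigD1 (gam i)) ?gamP //= psubX /tower_inv enum_rankK gamP //.
  rewrite eqxx insubT // => lt.
  rewrite [X in _ + X](eq_bigr offvar) => [|z /andP[/eqP zi zg]]; last first.
    by rewrite psubX /tower_inv enum_rankK zi (negbTE zg).
  by rewrite subrK; congr ('X_ _); apply: val_inj.
have io : (i - D < c)%N by rewrite ltn_subLR.
have := mem_nth (gam 0%N) io; set x := nth _ _ _ => xo.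
rewrite psubX /tower_inv enum_rankK; move: (xo); rewrite mem_offchain => /negbTE ->.
rewrite /offvar insubT ?off_index_lt // => lt; congr ('X_ _); apply: val_inj => /=.
by rewrite index_uniq ?subnKC // filter_uniq // enum_uniq.
Qed.

Lemma phi_tower_elt k : phi (tower_elt k) =
  if (k < D)%N then theta K szs szs k else 'X_[xmon (nth (gam 0%N) offchain (k - D))].
Proof.
rewrite /tower_elt; case: ifP => _; first exact: phi_thetaR.
by rewrite psubX /xmap enum_rankK.
Qed.

(** Over the [D] parameters the basis has no relations, which is a resolution of length 0. Each of
    the other coordinates acts on the basis by a homogeneous matrix, obtained by expanding its
    products with basis elements. *)
Lemma Res_segre : exists b (deg : 'I_b -> nat) (e : 'I_b -> S),
  [/\ forall i, homU U (deg i) (e i),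
      forall d f, homU U d f -> exists v : 'cV[R]_b, f = \sum_i phi (v i 0) * e i
    & Res c rho deg (fun v : 'cV[R]_b => \sum_i phi (v i 0) * e i = 0)].
Proof.
have sP : (forall i, szs i <= szs i)%N by [].
have := @segset_free K _ szs _ szs (fun=> false) sP (sum_szs hm hn hr).
rewrite tdeg_szs // (_ : (m + n + r - 3).+1 = D); last by lia.
case=> B [degB [eB [le [x0 at0] hB gB iB]]].
pose b := #|B|; pose deg (i : 'I_b) := degB (enum_val i).
pose e (i : 'I_b) := eB (enum_val i); pose g k := phi (tower_elt k).
have evE (p : {mpoly K[D]}) :
    psub (fun i : 'I_D => g i) p = psub (fun k : 'I_D => theta K szs szs k) p.
  by apply: eq_psub => k; rewrite /g phi_tower_elt ltn_ord.
have combE (cc : B -> {mpoly K[D]}) : comb szs cc eB =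
    \sum_i psub (fun i : 'I_D => g i) (cc (enum_val i)) * e i.
  rewrite /comb (reindex (@enum_val B predT)) /=; last first.
    by exists enum_rank => x _; rewrite ?enum_valK ?enum_rankK.
  by apply: eq_bigr => i _; rewrite evE.
have g_slin k : supp (slin szs) (g k).
  rewrite /g phi_tower_elt; case: ifP => _; first exact: theta_supp.
  by apply: suppX; apply: xmon_slin.
have actY k : exists Y : 'M[{mpoly K[D]}]_b, acts g e deg k Y.
  have gen j : exists v : 'I_b -> {mpoly K[D]},
      (forall i, hent (deg i) (deg j).+1 (v i)) /\
      g k * e j = \sum_i psub (fun i : 'I_D => g i) (v i) * e i.
    have hj : homU U (deg j).+1 (g k * e j).
      apply: (suppM _ (g_slin k) (hB _)) => m1 m2 s1 [U2 d2]; split.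
        exact: segset_stable.
      by rewrite mnmDE; case: s1 => -> _ _; rewrite d2.
    have [cc [hc ->]] := gB _ _ hj; exists (fun i => cc (enum_val i)); split.
      by move=> i; apply: hc.
    exact: combE.
  have /fin_all_exists[v vP] := gen.
  exists (\matrix_(i, j) v j i); split=> [i j|j].
    by rewrite mxE; apply: (vP j).1.
  by rewrite (vP j).2; apply: eq_bigr => i _; rewrite mxE.
have R0 : Res 0 rho deg (@relmod _ _ g _ e D).
  split=> [i||v]; first exact: le.
    by exists (enum_rank x0); rewrite /deg enum_rankK.
  split=> [W|->]; last by rewrite /relmod big1 // => i _; rewrite mxE raddf0 mul0r.
  apply/matrixP => i j; rewrite mxE ord1.
  have := iB (fun x => v (enum_rank x) 0); rewrite combE => /(_ _ (enum_val i)).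
  rewrite enum_valK; apply; rewrite -[RHS]W; apply: eq_bigr => k _.
  by rewrite enum_valK.
have := alg_tower (c := c) (fun k _ => actY k) R0.
move/(Res_transfer (h := h) (fun i => @tower_elt_homog i) towerK tower_invK) => RR.
exists b, deg, e; split=> [i|d f /gB[cc [_ ->]]|]; first exact: hB.
  exists (\col_i psub (fun k : 'I_D => tower_elt k) (cc (enum_val i))).
  rewrite combE; apply: eq_bigr => i _; congr (_ * _).
  rewrite mxE psub_comp; exact: eq_psub.
apply: Res_ext RR => v; rewrite /relmod.
have E i : psub (fun i : 'I_(D + c) => g i) ((map_mx (psub tower_inv) v) i 0) = phi (v i 0).
  by rewrite mxE -{2}[v i 0]towerK [RHS]psub_comp; apply: eq_psub.
by split=> H; rewrite -[RHS]H; apply: eq_bigr => i _; rewrite E.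
Qed.

End Coordinates.
End Regularity.

(** * Minimal resolution and regularity of R/I *)

Section Final.
Variables (K : fieldType) (m n r : nat).
Hypotheses (hm : (0 < m)%N) (hn : (0 < n)%N) (hr : (0 < r)%N).
Local Notation T := ('I_m * 'I_n * 'I_r)%type.
Local Notation N := (nvars m n r).
Local Notation R := {mpoly K[N]}.
Local Notation I := (Imnr K m n r).
Local Notation szs := (szs m n r).
Local Notation nS := #|{: svar szs}|.
Local Notation S := {mpoly K[nS]}.
Local Notation phi := (psub (fun v => 'X_[xmap v] : S)).
Local Notation U := (segset szs (fun=> false)).
Local Notation D := (m + n + r - 2)%N.
Local Notation rho := (m + n + r - 2 - maxn m (maxn n r))%N.

Lemma MRes_segre : exists c (deg : 'I_1 -> nat) (W : 'cV[R]_1 -> Prop),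
  [/\ MRes c rho deg W, forall i, deg i = 0%N & forall v, W v <-> I (v 0 0)].
Proof.
have [gam gamP] : exists gam : nat -> T, forall k, (k < D)%N -> rank (gam k) = k.
  have /fin_all_exists[g gP] := fun k : 'I_D => rank_exists hm hn hr (ltn_ord k).
  exists (fun k => if insub k is Some o then g o else (Ordinal hm, Ordinal hn, Ordinal hr)).
  by move=> k kD; rewrite insubT gP.
(* The invariant [Q] below keeps 1 in the span of the remaining generators; this is what identifies
   the module as R/I after cancellation. *)
have [b [deg [e [he gen rs]]]] := Res_segre K hm hn hr gamP.
set c := size _ in rs.
pose Q b (deg : 'I_b -> nat) (W : 'cV[R]_b -> Prop) := exists e : 'I_b -> S,
  [/\ forall i, homU U (deg i) (e i),
      forall v, W v <-> \sum_i phi (v i 0) * e i = 0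
    & exists v : 'cV[R]_b, 1 = \sum_i phi (v i 0) * e i].
have Qstep b' (deg' : 'I_b'.+1 -> nat) W y z u : Q _ deg' W -> u != 0 -> W z ->
    z y 0 = u%:MP -> Q _ (deg' \o lift y) (fun w => W (ins y w)).
  case=> e' [he' WE [v vE]] u0 /WE Wz zy; exists (e' \o lift y).
  have insE (w : 'cV[R]_b') : \sum_i phi (ins y w i 0) * e' i =
      \sum_i phi (w i 0) * e' (lift y i).
    rewrite (bigD1_ord y) //= ins_at raddf0 mul0r add0r.
    by apply: eq_bigr => i _; rewrite ins_lift.
  split=> [i|w|]; [exact: he'|by rewrite WE insE|].
  have [a v'y] : exists a, (v - a *: z) y 0 = 0.
    exists (v y 0 * (u^-1)%:MP).
    by rewrite !mxE zy -mulrA -mpolyCM mulVf // mulr1 subrr.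
  exists (row' y (v - a *: z)); rewrite -insE ins_row' //.
  transitivity (\sum_i phi (v i 0) * e' i - phi a * \sum_i phi (z i 0) * e' i).
    by rewrite Wz mulr0 subr0.
  rewrite mulr_sumr -sumrB.
  apply: eq_bigr => i _; rewrite !mxE raddfB /= rmorphM /= mulrBl; congr (_ - _).
  exact: mulrA.
have Q0 : Q _ deg (fun v : 'cV[R]_b => \sum_i phi (v i 0) * e i = 0).
  exists e; split=> //; apply: (gen 0%N); rewrite -mpolyX0; apply: suppX.
  by split; [split=> [i a _|i _]; rewrite ?mnm0E ?wt0|rewrite mnm0E].
have [b1 [deg1 [W1 [[e1 [he1 W1E [v vE]]] rs1 nu]]]] := Res_reduce Qstep Q0 rs.
have /fin_all_exists2[p hp pE] := fun i => phi_surj hm hn hr (he1 i).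
(* With [p i] mapping to [e1 i], substituting the expansion of 1 into [e1 i = phi (p i) * 1] gives a
   relation, whose constant terms vanish by minimality. The identity matrix thus has rank at most 1,
   so one generator remains, and its degree is 0. *)
have unit_rel i j : (i == j)%:R = (p i)@_0 * (v j 0)@_0.
  have Ww : W1 (delta_mx i 0 - p i *: v).
    rewrite W1E; transitivity (\sum_j ((if j == i then e1 j else 0) -
        phi (p i) * (phi (v j 0) * e1 j))).
      apply: eq_bigr => k _; rewrite !mxE eqxx andbT raddfB /= rmorphM /= mulrBl mulrA.
      by congr (_ - _); case: eqP => _; rewrite ?rmorph1 ?mul1r // raddf0 mul0r.
    by rewrite sumrB -mulr_sumr -vE mulr1 -big_mkcond /= big_pred1_eq pE subrr.
  have := nu _ j Ww; rewrite !mxE mcoeffB mcoeff0M eqxx andbT => /eqP.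
  rewrite subr_eq0 => /eqP <-; rewrite eq_sym.
  by case: eqP => _; rewrite ?mcoeff1 ?mcoeff0 ?eqxx.
have eqI (i j : 'I_b1) : i = j.
  apply/eqP; apply: contraT => ij; have := unit_rel i j; rewrite (negbTE ij).
  have := unit_rel i i; have := unit_rel j j; rewrite !eqxx => h1 h2 /esym/eqP.
  rewrite mulf_eq0 => /orP[] /eqP E; [move/eqP: h2|move/eqP: h1];
    by rewrite E ?mul0r ?mulr0 oner_eq0.
have b10 : (0 < b1)%N.
  rewrite lt0n; apply/eqP => b0; move/eqP: vE; rewrite big1 ?oner_eq0 // => i _.
  by have := ltn_ord i; rewrite {2}b0.
have b1E : b1 = 1%N.
  apply/eqP; rewrite eqn_leq b10 andbT leqNgt; apply/negP => b2.
  by have /(congr1 val) := eqI (Ordinal b10) (Ordinal b2).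
subst b1; exists c, deg1, W1; split.
- exact: Res_minimal rs1 nu.
- move=> i; rewrite ord1; have := unit_rel 0 0; rewrite eqxx => h1.
  have p0 : (p 0)@_0 != 0.
    by apply/eqP => p0; move/eqP: h1; rewrite p0 mul0r oner_eq0.
  by have := hp 0 0%MM; rewrite mcoeff_msupp p0 mdeg0 => /(_ isT).
- move=> w; rewrite W1E big_ord1; rewrite big_ord1 in vE.
  rewrite (ker_phi hm hn hr); split=> [/eqP|->]; last by rewrite mul0r.
  rewrite mulf_eq0 => /orP[/eqP//|/eqP e0].
  by move/eqP: vE; rewrite e0 mulr0 oner_eq0.
Qed.

Lemma maxmnr_le : (maxn m (maxn n r) <= D)%N.
Proof. lia. Qed.

Theorem regularityI : regularity I (D%:Z - (maxn m (maxn n r))%:Z).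
Proof.
have [c [deg [W [mr deg0 WI]]]] := MRes_segre.
have [bs [degs [M [fin hM imM ex [leM [l atM]]]]]] := MRes_seq mr.
have rhoE : D%:Z - (maxn m (maxn n r))%:Z = rho%:Z by have := maxmnr_le; lia.
rewrite rhoE; exists (full 1 bs), (fdeg deg degs), M; split; last first.
  split=> [i k|]; first by have := leM i k; lia.
  by exists c, l; rewrite atM; lia.
split=> //; split; first exact: deg0.
split; first by exists c => -[//|i] ci; apply: fin; lia.
split.
  move=> i k j; have [hi h0] := hM i; split=> [mm /hi|]; first lia.
  (* A nonzero homogeneous entry without constant term has positive degree. *)
  case: (eqVneq (M i k j) 0) => [->|nz]; [by left|right].
  have /hi := mlead_supp nz; case: (posnP (mdeg (mlead (M i k j)))) => [/eqP|]; last lia.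
  rewrite mdeg_eq0 => /eqP E; have := mlead_supp nz.
  by rewrite mcoeff_msupp E h0 eqxx.
split; last exact: ex.
move=> u; rewrite -imM WI; split=> [Iu|Iu k]; first exact: Iu.
by rewrite ord1.
Qed.

End Final.

(** * Coefficients of [t^a / (1 - t)^(n+1)] *)

Section HilbertSeries.

Lemma coefM_le (p q1 q2 : {poly int}) k : (forall i, (i <= k)%N -> q1`_i = q2`_i) ->
  (p * q1)`_k = (p * q2)`_k.
Proof.
by move=> q12; rewrite !coefM; apply: eq_bigr => i _; rewrite q12 // leq_subr.
Qed.

(** The series is truncated at degree [k]. By Pascal's rule one factor [1 - X] lowers [n] by one. *)
Lemma inv_one_minus n a k :
  \sum_(i < k.+1) ((1 - 'X) ^+ n.+1 : {poly int})`_(k - i) *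
    (if (a <= i)%N then 'C(i - a + n, n) else 0%N)%:R = (a == k)%:R.
Proof.
pose f n i := (if (a <= i)%N then 'C(i - a + n, n) else 0%N)%:R : int.
transitivity (((1 - 'X) ^+ n.+1 * \poly_(i < k.+1) f n i)`_k).
  rewrite coefMr; apply: eq_bigr => i _; congr (_ * _).
  by rewrite coef_poly ltn_ord.
have step (g g' : nat -> int) : g 0%N = g' 0%N ->
    (forall i, g i.+1 - g i = g' i.+1) -> forall i, (i <= k)%N ->
    ((1 - 'X) * \poly_(i < k.+1) g i)`_i = (\poly_(i < k.+1) g' i)`_i.
  move=> g0 gS i ik; rewrite mulrBl mul1r coefB coefXM !coef_poly ltnS ik.
  by case: i ik => [|i] ik; rewrite ?subr0 ?g0 //= ltnS ltnW // gS.
elim: n => [|n IH].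
  rewrite expr1 (step _ (fun i => (a == i)%:R)) // ?coef_poly ?ltnSn //.
    by rewrite /f bin0 leqn0; case: eqP.
  move=> i; rewrite /f !addn0 !bin0; case: (ltngtP a i.+1) => ai.
  - by rewrite -ltnS ai subrr.
  - by rewrite leqNgt (ltnW ai) subr0.
  - by rewrite ai ltnn subr0.
rewrite exprSr -mulrA -[RHS]IH; apply: coefM_le; apply: step.
  by rewrite /f leqn0; case: eqP => // ->; rewrite !subn0 !add0n !binn.
move=> i; rewrite /f; case: (ltngtP a i.+1) => ai.
- by rewrite -ltnS ai subSn // [in LHS]addSn binS natrD addrAC subrr add0r addSnnS.
- by rewrite leqNgt (ltnW ai) subr0.
- by rewrite ai ltnn subr0 subnn !binn.
Qed.

End HilbertSeries.

(** * The Hilbert series *)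

Lemma mpoly_sum_seq (K : fieldType) n (p : {mpoly K[n]}) (s : seq 'X_{1..n}) :
  uniq s -> {subset msupp p <= s} -> p = \sum_(mm <- s) p@_mm *: 'X_[mm].
Proof.
move=> us ps; rewrite [LHS]mpolyE [RHS](bigID (mem (msupp p))) /=.
rewrite [X in _ + X]big1 ?addr0 => [|mm /memN_msupp_eq0 ->]; last by rewrite scale0r.
rewrite -[RHS]big_filter; apply: perm_big; apply: uniq_perm.
- exact: msupp_uniq.
- exact: filter_uniq.
- by move=> mm; rewrite mem_filter; case: (boolP (mm \in msupp p)) => //= /ps ->.
Qed.

Section HilbertFunction.
Variables (K : fieldType) (m n r : nat).
Hypotheses (hm : (0 < m)%N) (hn : (0 < n)%N) (hr : (0 < r)%N).
Local Notation N := (nvars m n r).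
Local Notation R := {mpoly K[N]}.
Local Notation I := (Imnr K m n r).
Local Notation szs := (szs m n r).
Local Notation nS := #|{: svar szs}|.
Local Notation S := {mpoly K[nS]}.
Local Notation phi := (psub (fun v => 'X_[xmap v] : S)).
Local Notation U := (segset szs (fun=> false)).
Local Notation rho := (m + n + r - 2 - maxn m (maxn n r))%N.
Local Notation n' := (m + n + r - 3)%N.
Local Notation hf d := ('C(m - 1 + d, d) * 'C(n - 1 + d, d) * 'C(r - 1 + d, d))%N.

Lemma quot_dim_image d : quot_dim (homU U d : S -> Prop) (fun f => f = 0) (hf d).
Proof.
have [s [Zs [Bs Gs]]] := hilb_funI K hm hn hr d.
have sumE (c : 'I_(hf d) -> K) : \sum_i c i *: tnth [tuple phi (tnth s i) | i < hf d] i =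
    phi (\sum_i c i *: tnth s i).
  by rewrite raddf_sum; apply: eq_bigr => i _; rewrite tnth_mktuple /= psubZ.
exists [tuple phi (tnth s i) | i < hf d]; split=> [i|].
  by rewrite tnth_mktuple; apply: phi_homU => //; apply: Zs.
split=> [c|z hz].
  rewrite sumE => E; apply: Bs; split; last exact/(ker_phi hm hn hr).
  by apply: supp_sum => i _; apply: suppZ; apply: Zs.
have [p hp <-] := phi_surj hm hn hr hz; have [c [_ Ic]] := Gs p hp; exists c.
by rewrite sumE; have /(ker_phi hm hn hr) := Ic; rewrite raddfB.
Qed.

(** Both sides are the dimension of the degree [d] part of the Segre ring: the left one is known
    from sorted monomials, the right one counts monomials in the parameters times basis elements. *)
Lemma hilb_fun_free : exists (B : finType) (degB : B -> nat),
  [/\ forall x, (degB x <= rho)%N, exists x, degB x = rho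
    & forall d, hf d = (\sum_x if degB x <= d then 'C(d - degB x + n', n') else 0)%N].
Proof.
have sP : (forall i, szs i <= szs i)%N by [].
have := @segset_free K _ szs _ szs (fun=> false) sP (sum_szs hm hn hr).
rewrite tdeg_szs // => -[B [degB [e [le at_ hB gB iB]]]].
exists B, degB; split=> // d.
pose sb x : seq 'X_{1..n'.+1} := if (degB x <= d)%N
  then [seq s2m t | t : (d - degB x).-tuple 'I_n'.+1 <- enum (mpoly.basis n'.+1 (d - degB x))]
  else [::].
have usb x : uniq (sb x) by rewrite /sb; case: ifP => // _; apply: uniq_basis.
have memsb x mm : (mm \in sb x) = (mdeg mm + degB x == d)%N.
  rewrite /sb; case: ifP => dx; last by apply/esym/negP => /eqP; lia.
  by rewrite -basis_cover; apply/eqP/eqP; lia.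
have -> : (\sum_x if degB x <= d then 'C(d - degB x + n', n') else 0)%N =
    #|{: {x : B & 'I_(size (sb x))}}|.
  rewrite card_tagged sumnE big_map big_enum /=; apply: eq_bigr => x _.
  rewrite card_ord /sb; case: ifP => // dx.
  by rewrite size_basis -[RHS]bin_sub ?leq_addr // addKn.
have sigE (V : nmodType) (G : {x : B & 'I_(size (sb x))} -> V) : \sum_t G t =
    \sum_x \sum_(j < size (sb x)) G (Tagged (fun x => 'I_(size (sb x))) j).
  by rewrite sig_big_dep /=; apply: eq_bigr => -[].
pose mon (t : {x : B & 'I_(size (sb x))}) := nth 0%MM (sb (tag t)) (tagged t).
have monP t : (mdeg (mon t) + degB (tag t))%N = d.
  by apply/eqP; rewrite -memsb mem_nth.
pose F t : S := psub (fun k : 'I_n'.+1 => theta K szs szs k) 'X_[mon t] * e (tag t).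
have sumF (c : {x : B & 'I_(size (sb x))} -> K) : \sum_t c t *: F t =
    comb szs (fun x => \sum_(j < size (sb x)) c (Tagged (fun x => 'I_(size (sb x))) j) *:
      'X_[nth 0%MM (sb x) j]) e.
  rewrite sigE; apply: eq_bigr => x _; rewrite raddf_sum mulr_suml.
  by apply: eq_bigr => j _; rewrite /= psubZ scalerAl.
have qd : quot_dim (homU U d : S -> Prop) (fun f => f = 0) #|{: {x : B & 'I_(size (sb x))}}|.
  exists [tuple F (enum_val i) | i < #|{: {x : B & 'I_(size (sb x))}}|].
  have sumE (c : {x : B & 'I_(size (sb x))} -> K) : \sum_i c (enum_val i) *:
      tnth [tuple F (enum_val i) | i < #|{: {x : B & 'I_(size (sb x))}}|] i = \sum_t c t *: F t.
    rewrite [RHS](reindex (@enum_val _ predT)) /=; last first.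
      by exists enum_rank => x _; rewrite ?enum_valK ?enum_rankK.
    by apply: eq_bigr => i _; rewrite tnth_mktuple.
  split=> [i|].
    rewrite tnth_mktuple /F; set t := enum_val i; apply: homU_and.
      apply: stable_mul => //; first exact: segset_stable.
      exact: homU_supp (hB (tag t)).
    apply: (@suppM _ _ (fun mm => mm (vh szs) = mdeg (mon t)) _ _ _ _ _ _ (homU_deg (hB (tag t)))).
      by move=> m1 m2; rewrite mnmDE => -> ->.
    apply: (psub_supp (d := fun mm : 'X_{1..nS} => mm (vh szs))) => [a b||k|].
    - by rewrite mnmDE.
    - by rewrite mnm0E.
    - by apply: supp_sub (theta_supp (k := k) sP) => mm [].
    - exact: suppX.
  split=> [c|z hz].
    have cE i : c i = c (enum_rank (enum_val i)) by rewrite enum_valK.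
    under eq_bigr => i _ do rewrite cE.
    rewrite (sumE (fun t => c (enum_rank t))) sumF => /iB c0 i.
    rewrite cE; case: (enum_val i) => x j.
    move/mpolyP/(_ (nth 0%MM (sb x) j)): (c0 x); rewrite raddf_sum (bigD1 j) //=.
    rewrite mcoeffZ mcoeffX eqxx mulr1 mcoeff0 big1 ?addr0 // => k kj.
    rewrite mcoeffZ memN_msupp_eq0 ?mulr0 //; apply/negP => /mem_msuppXP/eqP.
    by rewrite nth_uniq // => /eqP/val_inj/eqP; rewrite (negbTE kj).
  have [cc [hc zE]] := gB _ _ hz.
  exists (fun i => (cc (tag (enum_val i)))@_(mon (enum_val i))).
  rewrite (sumE (fun t => (cc (tag t))@_(mon t))) sumF zE; apply/eqP.
  rewrite subr_eq0; apply/eqP/eq_comb => x /=.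
  rewrite [LHS](@mpoly_sum_seq _ _ _ (sb x)) // => [|mm /hc E]; last by rewrite memsb E.
  by rewrite (big_nth 0%MM) big_mkord.
have B0 : (fun f : S => f = 0) 0 by [].
have BD (u v : S) : u = 0 -> v = 0 -> u + v = 0 by move=> -> ->; rewrite addr0.
have BZ (a : K) (v : S) : v = 0 -> a *: v = 0 by move=> ->; rewrite scaler0.
by apply/eqP; rewrite eqn_leq (quot_dim_le B0 BD BZ (quot_dim_image d) qd)
  (quot_dim_le B0 BD BZ qd (quot_dim_image d)).
Qed.

(** The numerator is the sum of the ['X^(degB x)]. Nothing cancels in it, so its degree is the
    attained bound, and subtracting the m+n+r-2 parameters leaves minus the maximum. *)
Theorem a_invariantI : a_invariant I (- (maxn m (maxn n r))%:Z).
Proof.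
have [B [degB [le [x0 at0] hE]]] := hilb_fun_free.
pose Q : {poly int} := \sum_x 'X^(degB x).
have QE k : Q`_k = (\sum_x (degB x == k))%N%:R.
  rewrite coef_sum natr_sum; apply: eq_bigr => x _; by rewrite coefXn eq_sym.
have Qrho : Q`_rho != 0.
  by rewrite QE pnatr_eq0 (bigD1 x0) //= at0 eqxx.
have sQ : size Q = rho.+1.
  apply/eqP; rewrite eqn_leq; apply/andP; split.
    apply: leq_trans (size_sum _ _ _) _; apply/bigmax_leqP => x _.
    by rewrite size_polyXn ltnS.
  by rewrite ltnNge; apply: contra Qrho => /leq_sizeP ->.
exists n'.+1, Q; split; first by rewrite -size_poly_gt0 sQ.
split=> [k|]; last by rewrite sQ /=; have := maxmnr_le hm hn hr; lia.
exists (fun i : 'I_k.+1 => hf i); split=> [i|]; first exact: hilb_funI.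
rewrite QE natr_sum.
under [RHS]eq_bigr => i _ do rewrite hE natr_sum mulr_sumr.
rewrite exchange_big /=; apply: eq_bigr => x _.
by rewrite inv_one_minus.
Qed.

End HilbertFunction.

Theorem theorem4p3 (K : fieldType) (m n r : nat)
  (hm : (0 < m)%N) (hn : (0 < n)%N) (hr : (0 < r)%N) :
  (exists k, min_num_gens (Imnr K m n r) k /\
        k%:Z = ('C(m * n * r + 1, 2))%:Z
               - ('C(m + 1, 2) * 'C(n + 1, 2) * 'C(r + 1, 2))%:Z) /\
      [/\ krull_dim_quot (Imnr K m n r) (m + n + r - 2),
      multiplicity (Imnr K m n r)
        ((m + n + r - 3)`!%:R / ((m - 1)`! * (n - 1)`! * (r - 1)`!)%:R),
      regularity (Imnr K m n r)
        ((m + n + r - 2)%:Z - (maxn m (maxn n r))%:Z),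
      a_invariant (Imnr K m n r) (- (maxn m (maxn n r))%:Z) &
      (forall d : nat, hilb_fun (Imnr K m n r) d
        ('C(m - 1 + d, d) * 'C(n - 1 + d, d) * 'C(r - 1 + d, d)))].
Proof.
split; first exact: min_gensI.
by split; [apply: krullI|apply: multiplicityI|apply: regularityI|apply: a_invariantI
  |move=> d; apply: hilb_funI].
Qed.
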